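(* Let $n>2$. Consider a smooth $n$-dimensional system $\dot x=f(x;\alpha)$, $x\in\mathbb{R}^n$, $\alpha\in\mathbb{R}$, undergoing a codimension one Hopf bifurcation at $\alpha=\alpha^*$ (in the sense given in the context), inducing a limit cycle solution $x(t)=x(t;\alpha)$ of period $T=T(\alpha)$ for $\alpha\in\tilde I_{\alpha^*}$ emerging from an equilibrium $x_0(\alpha)$. Let $\langle x\rangle_\alpha=\frac1T\int_0^Tx(t)\,dt$ for $\alpha\in\tilde I_{\alpha^*}$ and $\langle x\rangle_\alpha=x_0(\alpha)$ for $\alpha\in I_{\alpha^*}$. Then, as $\alpha\to\alpha^*$, $$\langle x\rangle_\alpha-x_0(\alpha)=\begin{cases}K(\alpha)\,\mu(\alpha)+\mathcal{O}(\mu(\alpha)^2), & \alpha\in\tilde I_{\alpha^*},\\ 0, & \alpha\in I_{\alpha^*},\end{cases}$$ where the vector $K(\alpha)\in\mathbb{R}^n$ is $$K=-\operatorname{Re}\Big(\frac{2g_{11}}{\bar\lambda\,\operatorname{Re}(c_1)}\Big)\operatorname{Re}(q)+\operatorname{Im}\Big(\frac{2g_{11}}{\bar\lambda\,\operatorname{Re}(c_1)}\Big)\operatorname{Im}(q)-\frac{1}{\operatorname{Re}(c_1)}\,\eta_{11},$$ with $\lambda=\lambda(\alpha)$, $q=q(\alpha)$, $g_{11}=g_{11}(\alpha)$, $c_1=c_1(\alpha)$ and $\eta_{11}=\eta_{11}(\alpha)$ as defined in the context.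
   Context: Setting. $x_0(\alpha)$ is an equilibrium, $f(x_0(\alpha);\alpha)=0$, existing for $\alpha$ in an open interval containing $\alpha^*$. Write $f(x_0(\alpha)+x;\alpha)=A(\alpha)x+F(x;\alpha)$, where $A(\alpha)$ is the $n\times n$ Jacobian matrix of $f$ in $x$ at $x_0(\alpha)$ and $F$ is the nonlinear part (with $F$ and its first $x$-derivatives vanishing at $x=0$). Eigenvalues. $A(\alpha)$ has a single pair of complex conjugate eigenvalues $\lambda(\alpha)=\mu(\alpha)+i\omega(\alpha)$, $\bar\lambda(\alpha)$, with $\mu,\omega$ real and $\omega(\alpha)>0$, whose real part vanishes at $\alpha^*$; all other eigenvalues have negative real part for all $\alpha$ near $\alpha^*$. Inner product and eigenvectors. $\langle u,v\rangle=\sum_{j=1}^n\bar u_jv_j$ on $\mathbb{C}^n$. The vectors $q=q(\alpha),p=p(\alpha)\in\mathbb{C}^n$ satisfy $Aq=\lambda q$, $p^TA=\bar\lambda p^T$, $\langle p,q\rangle=1$ (hence $\langle p,\bar q\rangle=0$). Tensors. For $m=1,\dots,n$, with all partial derivatives of $F_m$ in $x$ evaluated at $x=0$, $$B_m(x,y)=\sum_{j,k=1}^n(\partial_{jk}F_m)\,x_ky_j,\qquad C_m(x,y,u)=\sum_{j,k,\ell=1}^n(\partial_{\ell jk}F_m)\,x_ky_ju_\ell,$$ extended multilinearly to complex arguments, so that $F(x)=\frac12B(x,x)+\frac16C(x,x,x)+\mathcal{O}(\|x\|^4)$. Coefficients. $$g_{20}=\langle p,B(q,q)\rangle,\quad g_{11}=\langle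 p,B(q,\bar q)\rangle,\quad g_{02}=\langle p,B(\bar q,\bar q)\rangle,\quad g_{21}=\langle p,C(q,q,\bar q)\rangle,$$ $$H_{20}=B(q,q)-\langle p,B(q,q)\rangle q-\langle\bar p,B(q,q)\rangle\bar q,\qquad H_{11}=B(q,\bar q)-\langle p,B(q,\bar q)\rangle q-\langle\bar p,B(q,\bar q)\rangle\bar q,$$ $$\eta_{20}=(2\lambda I_n-A)^{-1}H_{20},\qquad \eta_{11}=(2\operatorname{Re}(\lambda)I_n-A)^{-1}H_{11},$$ where $I_n$ is the $n\times n$ identity matrix (the inverses exist for $\alpha$ near $\alpha^*$), and $$\tilde g_{21}=g_{21}+2\langle p,B(q,\eta_{11})\rangle+\langle p,B(\bar q,\eta_{20})\rangle,$$ $$c_1=\frac{2\lambda+\bar\lambda}{2|\lambda|^2}\,g_{20}g_{11}+\frac1\lambda|g_{11}|^2+\frac{1}{2(2\lambda-\bar\lambda)}|g_{02}|^2+\frac12\tilde g_{21}.$$ Codimension one Hopf bifurcation at $\alpha^*$ means: the eigenvalue conditions above hold, $\mu(\alpha^* )=0$, $\omega(\alpha^* )>0$, $\mu'(\alpha^* )\neq0$, and $\operatorname{Re}(c_1)\ne0$. In this case, on one side of $\alpha^*$ (and close to $\alpha^*$) there is a single limit cycle emerging from $x_0(\alpha)$ whose amplitude grows from zero at $\alpha^*$ and whose period is near $2\pi/\omega$. $\tilde I_{\alpha^*}$ denotes the one-sided interval of parameter values for which this cycle exists, with the boundary point $\alpha^*$ included (at $\alpha^*$ the cycle has amplitude zero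 and is understood as the equilibrium); $I_{\alpha^*}$ is its complement. The solution $x(t)$ is this limit cycle and $T$ its period, $x(t+T)=x(t)$. The bifurcation may be supercritical or subcritical. *)

(* Defs.v *)
From HB Require Import structures.
From mathcomp Require Import all_boot all_order all_algebra.
From mathcomp Require Import all_classical all_reals all_analysis.
From mathcomp Require Export complex.

Set Implicit Arguments.
Unset Strict Implicit.
Unset Printing Implicit Defensive.

Import Order.TTheory GRing.Theory Num.Theory numFieldNormedType.Exports.
Local Open Scope classical_set_scope.
Local Open Scope ring_scope.

Local Notation Re := complex.Re.
Local Notation Im := complex.Im.

(* [Ck k] and [smooth] are meant for finite-dimensional [V], where existence
   and continuity of all iterated directional derivatives along constant
   vectors is the usual class C^k. *)
Fixpoint Ck (R : realType) (V W : normedModType R) (k : nat) (h : V -> W) :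
    Prop :=
  if k is k'.+1 then
    forall v : V, (forall x, derivable h x v) /\ Ck k' (fun x => 'D_v h x)
  else continuous h.

Definition smooth (R : realType) (V W : normedModType R) (h : V -> W) : Prop :=
  forall k, Ck k h.

Section VectorField.
Variables (R : realType) (n : nat).
Implicit Types (g : 'cV[R]_n -> 'cV[R]_n) (y : R -> 'cV[R]_n).

Definition partial (j : 'I_n) (h : 'cV[R]_n -> R) : 'cV[R]_n -> R :=
  fun x => 'D_(delta_mx j 0) h x.

Definition jac g (x0 : 'cV[R]_n) : 'M[R]_n :=
  \matrix_(m, j) partial j (fun x => g x m 0) x0.

Definition nonlin g (x0 : 'cV[R]_n) : 'cV[R]_n -> 'cV[R]_n :=
  fun x => g (x0 + x) - jac g x0 *m x.

Definition solution g y : Prop :=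
  forall t : R, is_derive t (1 : R) y (g (y t)).

Definition least_period y (T : R) : Prop :=
  [/\ 0 < T, forall t, y (t + T) = y t
    & forall s : R, 0 < s < T -> exists t, y (t + s) <> y t].

(* Having a least positive period excludes equilibria. *)
Definition periodic_orbit g y (T : R) : Prop :=
  solution g y /\ least_period y T.

Definition time_average y (T : R) : 'cV[R]_n :=
  \col_m (T^-1 * \int[lebesgue_measure]_(t in `[0, T]) y t m 0).

End VectorField.

Definition toC (R : realType) (m k : nat) (M : 'M[R]_(m, k)) : 'M[R[i]]_(m, k) :=
  map_mx (fun r : R => r%:C%C) M.

Definition conjv (R : realType) (n : nat) (u : 'cV[R[i]]_n) : 'cV[R[i]]_n :=
  map_mx (fun z => z^*) u.

Definition inner (R : realType) (n : nat) (u v : 'cV[R[i]]_n) : R[i] :=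
  \sum_j (u j 0)^* * v j 0.

Section Coefficients.
Variables (R : realType) (n : nat).
Variables (g : 'cV[R]_n -> 'cV[R]_n) (x0 : 'cV[R]_n).
Variables (lam : R[i]) (q p : 'cV[R[i]]_n).

Local Notation A := (toC (jac g x0)).
Local Notation F m := (fun x => nonlin g x0 x m 0).
Local Notation qb := (conjv q).
Local Notation pb := (conjv p).

Definition Btensor (x y : 'cV[R[i]]_n) : 'cV[R[i]]_n :=
  \col_m \sum_j \sum_k (partial j (partial k (F m)) 0)%:C%C * x k 0 * y j 0.

Definition Ctensor (x y u : 'cV[R[i]]_n) : 'cV[R[i]]_n :=
  \col_m \sum_j \sum_k \sum_l
    (partial l (partial j (partial k (F m))) 0)%:C%C * x k 0 * y j 0 * u l 0.

Definition g20 : R[i] := inner p (Btensor q q).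
Definition g11 : R[i] := inner p (Btensor q qb).
Definition g02 : R[i] := inner p (Btensor qb qb).
Definition g21 : R[i] := inner p (Ctensor q q qb).

Definition H20 : 'cV[R[i]]_n :=
  Btensor q q - inner p (Btensor q q) *: q - inner pb (Btensor q q) *: qb.
Definition H11 : 'cV[R[i]]_n :=
  Btensor q qb - inner p (Btensor q qb) *: q - inner pb (Btensor q qb) *: qb.

Definition eta20 : 'cV[R[i]]_n :=
  invmx (((2 * lam)%:M : 'M[R[i]]_n) - A) *m H20.
Definition eta11 : 'cV[R[i]]_n :=
  invmx (((2 * (Re lam)%:C%C)%:M : 'M[R[i]]_n) - A) *m H11.

Definition g21t : R[i] :=
  g21 + 2 * inner p (Btensor q eta11) + inner p (Btensor qb eta20).

Definition c1 : R[i] :=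
  (2 * lam + lam^*) / (2 * `|lam| ^+ 2) * g20 * g11
  + lam^-1 * `|g11| ^+ 2
  + (2 * (2 * lam - lam^*))^-1 * `|g02| ^+ 2
  + 2^-1 * g21t.

(* Typed in C^n because [eta11] is; [eta11] is in fact a real vector, since
   [Btensor q qb] is, so that [Kvec] has real entries. *)
Definition Kvec : 'cV[R[i]]_n :=
  let w := 2 * g11 / (lam^* * (Re c1)%:C%C) in
  - (Re w)%:C%C *: toC (map_mx (fun z => Re z) q)
  + (Im w)%:C%C *: toC (map_mx (fun z => Im z) q)
  - ((Re c1)^-1)%:C%C *: eta11.

End Coefficients.

Section Hopf.
Variables (R : realType) (n : nat) (f : 'cV[R]_n -> R -> 'cV[R]_n).
Variables (x0 : R -> 'cV[R]_n) (astar : R).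

Local Notation A a := (toC (jac (f^~ a) (x0 a))).

(* Continuity is what makes [x0] a branch of equilibria; smoothness near
   [astar] then follows, since 0 is not an eigenvalue of the Jacobian. *)
Definition equilibrium_branch (J : set R) : Prop :=
  [/\ open J, is_interval J, J astar &
    forall a, J a -> f (x0 a) a = 0 /\ {for a, continuous x0}].

(* The critical pair is simple: each member has algebraic multiplicity one. *)
Definition critical_pair (mu omega : R -> R) : Prop :=
  \forall a \near astar, let lam := (mu a +i* omega a)%C in
  [/\ 0 < omega a,
      mup lam (char_poly (A a)) = 1%N,
      mup lam^* (char_poly (A a)) = 1%N
    & forall z : R[i], eigenvalue (A a) z -> z != lam -> z != lam^* -> Re z < 0].

Definition eigenvectors (mu omega : R -> R) (q p : R -> 'cV[R[i]]_n) : Prop :=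
  \forall a \near astar, let lam := (mu a +i* omega a)%C in
  [/\ A a *m q a = lam *: q a,
      (p a)^T *m A a = lam^* *: (p a)^T
    & inner (p a) (q a) = 1].

Definition codim1_hopf (mu omega : R -> R) (q p : R -> 'cV[R[i]]_n) : Prop :=
  [/\ critical_pair mu omega,
      mu astar = 0,
      derivable mu astar 1 /\ 'D_1 mu astar != 0 &
      Re (c1 (f^~ astar) (x0 astar) (mu astar +i* omega astar)%C
             (q astar) (p astar)) != 0].

Definition one_sided_interval (I : set R) : Prop :=
  [/\ is_interval I, I astar &
      ((forall a, I a -> astar <= a) /\ (exists2 b, astar < b & I b)) \/
      ((forall a, I a -> a <= astar) /\ (exists2 b, b < astar & I b))].

(* The family of limit cycles [x a], of period [T a], for [a] in [I];
   at [astar] it degenerates to the equilibrium, and [T astar] is then any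
   positive number. *)
Record emerging_cycle (omega : R -> R) (I : set R)
    (x : R -> R -> 'cV[R]_n) (T : R -> R) : Prop := EmergingCycle {
  cycle_interval : one_sided_interval I;
  cycle_orbit : forall a, I a -> a != astar ->
    periodic_orbit (f^~ a) (x a) (T a);
  cycle_at_astar : 0 < T astar /\ forall t, x astar t = x0 astar;
  cycle_amplitude : forall e : R, 0 < e ->
    \forall a \near astar, I a -> forall t, `|x a t - x0 a| < e;
  cycle_period :
    T @ within (I `\ astar) (nbhs astar) --> 2 * pi / omega astar;
  (* Close to the bifurcation, it is the only cycle near the equilibrium, and
     there is none for parameters outside [I]. *)
  cycle_single : exists2 r : R, 0 < r &
    \forall a \near astar, forall (y : R -> 'cV[R]_n) (S : R),
      periodic_orbit (f^~ a) y S -> (forall t, `|y t - x0 a| < r) ->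
      [/\ I a, a != astar & range y = range (x a)]
}.

Definition mean_state (I : set R) (x : R -> R -> 'cV[R]_n) (T : R -> R)
    (a : R) : 'cV[R]_n :=
  if a \in I then time_average (x a) (T a) else x0 a.

End Hopf.

(* Main.v *)
Require Import Defs.
From mathcomp Require Import all_boot all_order all_algebra.
From mathcomp Require Import all_classical all_reals all_analysis.
From mathcomp Require Import ring lra.
Import Order.TTheory GRing.Theory Num.Theory numFieldNormedType.Exports.
Local Open Scope classical_set_scope.
Local Open Scope ring_scope.

(** Each cycle is a small periodic solution of the equation, and its Fourier
    modes are compared order by order in its amplitude M and in the distance of
    parameters (harmonic balance).

    Around the equilibrium at the critical parameter, the deviation of a cycle
    splits into the part o that changes sign when time is shifted by half a
    period and the part e that does not ([orbit_oscillation]). Only e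
    contributes to the mean ([time_average_even]). The nonlinear terms respect
    the splitting: up to higher order, the forcing of e is B(o, o) / 2 and that
    of o is B(e, o) + C(o, o, o) / 6 ([even_taylor], [odd_taylor],
    [rest_taylor]). A periodic solution of the linear equation with no first
    Fourier mode is bounded by its forcing ([linear_estimate]): all eigenvalues
    but the critical pair are stable, and only the first mode resonates with
    that pair. Consequently e = O(M^2), and o agrees up to O(M^3) with its first
    mode ([odd_leading]), which to leading order is al q e^(iWt) plus its
    conjugate, with al of order exactly M ([w1_bO], [amplitude_lower]).

    The balance of the constant mode then makes the mean equal to |al|^2 h0 to
    leading order, where A h0 = - B(q, qb) and qb is the conjugate of q
    ([u0_leading]). The balance of the first mode, paired with p, is the
    amplitude equation of the Hopf normal form; its real part reads
    mu + |al|^2 Re c1 = O((M^2 + |a - astar|)^2) ([amplitude_law]). As Re c1 is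
    nonzero and mu vanishes to first order only, M^2 and |a - astar| are both
    O(|mu|) ([kap_mu], [crossing_speed]), and the mean is
    - (mu / Re c1) h0 + O(mu^2) ([mean_leading]).

    At the critical parameter K is exactly - h0 / Re c1
    ([mean_slope_critical]). For the neighbouring parameters K has to differ
    from this by O(|a - astar|), although q and p may depend on the parameter
    irregularly. But K is unchanged when q and p are rescaled
    ([mean_slope_scale]); the eigenvalue being simple, q and p are determined up
    to scale; and after normalisation against those at astar they solve linear
    systems with an invertible bordered matrix ([right_vector_eigen],
    [left_vector_eigen]), which is Lipschitz at astar because the Jacobian and
    the critical eigenvalue are ([lipm_jac], [lip_lam]). Hence K is Lipschitz at
    astar ([lipm_mean_slope], [slope_lipschitz]), and the product with mu absorbs
    the difference ([mean_expansion]). *)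

Set Implicit Arguments.
Unset Strict Implicit.
Unset Printing Implicit Defensive.

Local Notation Re := complex.Re.
Local Notation Im := complex.Im.
Local Notation cmod := Normc.normc.

(** * Directional derivatives along lines *)

Section LineCalculus.
Variables (R : realType) (V : normedModType R).
Implicit Types (g : V -> R) (x v w : V).

Lemma line_derive g x v (t : R) : derivable g (x + t *: v) v ->
  is_derive t (1 : R) (fun s : R => g (x + s *: v)) ('D_v g (x + t *: v)).
Proof.
have E : (fun h : R => h^-1 *: (((fun s : R => g (x + s *: v)) \o shift t) (h *: (1:R))
   - g (x + t *: v))) = (fun h : R => h^-1 *: ((g \o shift (x + t *: v)) (h *: v)
    - g (x + t *: v))).
  apply/funext => h /=; congr (_ *: (g _ - _)).
  by rewrite [_%:A]mulr1 scalerDl addrCA.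
by move=> dg; apply: DeriveDef; rewrite /derivable /derive E.
Qed.

Lemma line_mvt g x v : (forall y, derivable g y v) ->
  exists2 s : R, 0 <= s <= 1 & g (x + v) - g x = 'D_v g (x + s *: v).
Proof.
move=> dg.
have ld t : is_derive t (1 : R) (fun s : R => g (x + s *: v)) ('D_v g (x + t *: v)).
  exact: line_derive.
have cg : {within `[0, 1], continuous (fun s : R => g (x + s *: v))}.
  apply: continuous_subspaceT => s.
  apply: differentiable_continuous; apply/derivable1_diffP.
  by have [] := ld s.
have [s] := @MVT_segment R (fun s : R => g (x + s *: v))
   (fun s => 'D_v g (x + s *: v)) 0 1 ler01 (fun t _ => ld t) cg.
rewrite in_itv /= => s01; rewrite scale1r scale0r addr0 subr0 mulr1 => e.
by exists s.
Qed.

Lemma deriveZv g x v (c : R) : (forall y, derivable g y v) ->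
  is_derive x (c *: v) g (c * 'D_v g x).
Proof.
move=> dg.
have [->|c0] := eqVneq c 0.
  by rewrite scale0r mul0r; exact: is_derive0.
have L := @line_derive g x v 0 (dg _).
have M : is_derive (0:R) (1:R) (fun s : R => c *: s) (c *: (1 : R)).
  exact: (is_deriveZ c (is_derive_id (0:R) (1:R))).
have := L; rewrite scale0r addr0 => L0.
have N : is_derive ((fun s : R => c *: s) 0) (1:R) (fun s : R => g (x + s *: v)) ('D_v g x).
  by rewrite /= scaler0.
have := @is_derive1_comp R _ _ (0:R) _ _ N M.
move=> [d1 e1].
have E : (fun h : R => h^-1 *: ((((fun s : R => g (x + s *: v)) \o (fun s : R => c *: s)) \o shift (0:R)) (h *: (1:R))
   - ((fun s : R => g (x + s *: v)) \o (fun s : R => c *: s)) 0)) = (fun h : R => h^-1 *: ((g \o shift x) (h *: (c *: v))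
    - g x)).
  apply/funext => h /=; congr (_ *: (g _ - g _)).
    by rewrite addr0 [_%:A]mulr1 scalerA (_ : c *: h = c * h) // mulrC addrC.
  by rewrite scaler0 scale0r addr0.
apply: DeriveDef; first by move: d1; rewrite /derivable E.
move: e1; rewrite /derive E => ->.
by rewrite [_%:A]mulr1 mulrC.
Qed.

(** Directional differentiability alone does not give additivity in the
    direction, which comes from moving first along h v, then along h w: by the
    mean value theorem the second increment is h times a value of the
    w-derivative at a nearby point, and continuity of that derivative brings
    it back to x. *)
Lemma deriveDv g x v w : (forall y, derivable g y v) -> (forall y, derivable g y w) ->
  {for x, continuous (fun y => 'D_w g y)} ->
  is_derive x (v + w) g ('D_v g x + 'D_w g x).
Proof.
move=> dv dw cw.
have H : (fun h : R => h^-1 *: ((g \o shift x) (h *: (v + w)) - g x)) @ 0^' --> 'D_v g x + 'D_w g x.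
  have -> : (fun h : R => h^-1 *: ((g \o shift x) (h *: (v + w)) - g x)) =
    (fun h : R => h^-1 *: ((g \o shift x) (h *: v) - g x)) \+
    (fun h : R => h^-1 *: (g (h *: v + x + h *: w) - g (h *: v + x))).
    apply/funext => h /=; rewrite -scalerDr; congr (_ *: _).
    by rewrite scalerDr addrAC [g (h *: v + x) - _ + _]addrC subrKA.
  apply: cvgD; first exact: dv.
  apply/cvgrPdist_le => /= e e0.
  move/cvgrPdist_le : cw => /(_ _ e0) /= cw.
  have [r r0 rP] : exists2 r : R, 0 < r & forall y, `|x - y| < r -> `|'D_w g x - 'D_w g y| <= e.
    by move/nbhs_normP: cw => [r r0 rP]; exists r => // y xy; apply: rP.
  have K0 : 0 < `|v| + `|w| + 1 by rewrite ltr_wpDl // addr_ge0.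
  near=> h.
  have h0 : h != 0 by near: h; exact: nbhs_dnbhs_neq.
  have hr : `|h| < r / (`|v| + `|w| + 1).
    near: h; apply: dnbhs0_lt; exact: divr_gt0.
  have [s /andP[s0 s1] ->] := @line_mvt g (h *: v + x) (h *: w) (fun y => @ex_derive _ _ _ _ _ _ _ (deriveZv y h dw)).
  rewrite (@derive_val _ _ _ _ _ _ _ (deriveZv _ h dw)).
  rewrite (_ : h^-1 *: _ = 'D_w g (h *: v + x + s *: (h *: w))); last first.
    by rewrite -[LHS]/(h^-1 * (h * _)) mulKf.
  apply: rP.
  rewrite addrAC -[X in `|x - X|]addrC opprD addrA subrr sub0r normrN.
  apply: (@le_lt_trans _ _ (`|h| * (`|v| + `|w| + 1))); last by rewrite -ltr_pdivlMr.
  apply: (le_trans (ler_normD _ _)); rewrite !normrZ mulrDr mulrDr mulr1 -addrA lerD //.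
  rewrite (@le_trans _ _ (`|h| * `|w|)) ?lerDl //.
  by rewrite ger0_norm // ler_piMl // mulr_ge0.
apply: DeriveDef; first by apply/cvg_ex; exists ('D_v g x + 'D_w g x).
exact: cvg_lim H.
Unshelve. all: by end_near. Qed.

Lemma smoothD g v : smooth g -> smooth (fun x => 'D_v g x).
Proof. by move=> sg k; have [] := sg k.+1 v. Qed.

Lemma smooth_derivable g x v : smooth g -> derivable g x v.
Proof. by move=> sg; have [+ _] := sg 1%N v; apply. Qed.

Lemma smooth_continuous g : smooth g -> continuous g.
Proof. by move=> sg; exact: (sg 0%N). Qed.

Lemma smooth_deriveD g x v w : smooth g -> 'D_(v + w) g x = 'D_v g x + 'D_w g x.
Proof.
move=> sg; apply: derive_val; apply: deriveDv.
- by move=> y; exact: smooth_derivable.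
- by move=> y; exact: smooth_derivable.
- exact: (smooth_continuous (smoothD _ sg)).
Qed.

Lemma smooth_deriveZ g x v (c : R) : smooth g -> 'D_(c *: v) g x = c * 'D_v g x.
Proof.
by move=> sg; apply: derive_val; apply: deriveZv => y; exact: smooth_derivable.
Qed.

Lemma smooth_derive_sum g x (T : Type) (s : seq T) (c : T -> R) (b : T -> V) : smooth g ->
  'D_(\sum_(j <- s) c j *: b j) g x = \sum_(j <- s) c j * 'D_(b j) g x.
Proof.
move=> sg; elim: s => [|j s IH]; first by rewrite !big_nil derive0.
by rewrite !big_cons smooth_deriveD // smooth_deriveZ // IH.
Qed.

End LineCalculus.

(** * Symmetry, bounds and Taylor estimates for iterated derivatives *)

Section MultiDerivative.
Variables (R : realType) (V : normedModType R).
Implicit Types (g : V -> R) (x v w : V) (vs : seq V).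

Lemma is_derive_translate g x v (b : V) : derivable g (x + b) v ->
  is_derive x v (fun y => g (y + b)) ('D_v g (x + b)).
Proof.
have E : (fun h : R => h^-1 *: (((fun y => g (y + b)) \o shift x) (h *: v) - g (x + b)))
   = (fun h : R => h^-1 *: ((g \o shift (x + b)) (h *: v) - g (x + b))).
  by apply/funext => h /=; rewrite addrA.
by move=> dg; apply: DeriveDef; rewrite /derivable /derive E.
Qed.

(** The second difference is the increment along v of y |-> g (y + w) - g y;
    the mean value theorem, applied once in each direction, turns it into a
    second derivative. *)
Lemma second_difference g x v w : smooth g -> exists s t : R,
  [/\ 0 <= s <= 1, 0 <= t <= 1 &
  g (x + v + w) - g (x + v) - (g (x + w) - g x)
    = 'D_w (fun y => 'D_v g y) (x + s *: v + t *: w)].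
Proof.
move=> sg.
pose G y := g (y + w) - g y.
have dG y : is_derive y v G ('D_v g (y + w) - 'D_v g y).
  apply: is_deriveB; first by apply: is_derive_translate; exact: smooth_derivable.
  by apply: derivableP; exact: smooth_derivable.
have [s s01 e] := @line_mvt _ _ G x v (fun y => @ex_derive _ _ _ _ _ _ _ (dG y)).
have [t t01 e'] := @line_mvt _ _ _ (x + s *: v) w
  (fun y => @smooth_derivable _ _ _ y w (smoothD v sg)).
exists s, t; split => //.
by rewrite -e' -(@derive_val _ _ _ _ _ _ _ (dG _)) -e.
Qed.

(** The second difference is symmetric in v and w. Along h v and h w it is h^2
    times either mixed derivative at some point within O(h) of x, so both
    derivatives agree at x by continuity. *)
Lemma derive_comm g x v w : smooth g ->
  'D_w (fun y => 'D_v g y) x = 'D_v (fun y => 'D_w g y) x.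
Proof.
move=> sg; apply/eqP; rewrite -subr_eq0 -normr_le0.
apply/ler_addgt0Pr => e e0; rewrite add0r.
have c1 := smooth_continuous (smoothD w (smoothD v sg)).
have c2 := smooth_continuous (smoothD v (smoothD w sg)).
have e2 : 0 < e / 2 by rewrite divr_gt0.
have [r r0 rP] : exists2 r : R, 0 < r & forall y, `|x - y| < r ->
   `|'D_w (fun y => 'D_v g y) x - 'D_w (fun y => 'D_v g y) y| <= e / 2 /\
   `|'D_v (fun y => 'D_w g y) x - 'D_v (fun y => 'D_w g y) y| <= e / 2.
  have /cvgrPdist_le /(_ _ e2) n1 := c1 x.
  have /cvgrPdist_le /(_ _ e2) n2 := c2 x.
  have n12 : \forall y \near x,
      `|'D_w (fun y => 'D_v g y) x - 'D_w (fun y => 'D_v g y) y| <= e / 2 /\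
      `|'D_v (fun y => 'D_w g y) x - 'D_v (fun y => 'D_w g y) y| <= e / 2.
    exact: filterI n1 n2.
  move/nbhs_normP: n12 => [r r0 rP].
  by exists r => // y xy; apply: rP.
have K0 : 0 < `|v| + `|w| + 1 by rewrite ltr_wpDl // addr_ge0.
pose h := r / (`|v| + `|w| + 1) / 2.
have h0 : 0 < h by rewrite divr_gt0 // divr_gt0.
have hr : h * (`|v| + `|w|) < r.
  apply: (@le_lt_trans _ _ (h * (`|v| + `|w| + 1))).
    by rewrite ler_pM2l // lerDl.
  rewrite /h mulrAC mulfVK ?gt_eqF // ltr_pdivrMr //; lra.
have small s t v' w' : 0 <= s <= 1 -> 0 <= t <= 1 -> `|v'| + `|w'| = `|v| + `|w| ->
   `|x - (x + s *: (h *: v') + t *: (h *: w'))| < r.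
  move=> /andP[s0 s1] /andP[t0 t1] E.
  rewrite -addrA opprD addrA subrr sub0r normrN.
  apply: le_lt_trans hr; rewrite -E.
  have hn (u : V) : `|h *: u| = h * `|u| by rewrite normrZ ger0_norm // ltW.
  apply: (le_trans (ler_normD _ _)); rewrite [X in X + _]normrZ [X in _ + X]normrZ !hn mulrDr.
  by rewrite lerD // ger0_norm // ler_piMl // mulr_ge0 // ltW.
have [s [t [s01 t01 E1]]] := second_difference x (h *: v) (h *: w) sg.
have [s' [t' [s'01 t'01 E2]]] := second_difference x (h *: w) (h *: v) sg.
have {E1} E1 : g (x + h *: v + h *: w) - g (x + h *: v) - (g (x + h *: w) - g x) =
  h * (h * 'D_w (fun y => 'D_v g y) (x + s *: (h *: v) + t *: (h *: w))).
  rewrite E1 smooth_deriveZ; last exact: smoothD.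
  congr (_ * _).
  have -> : 'D_(h *: v) g = h \*: (fun y => 'D_v g y).
    by apply/funext => y; rewrite smooth_deriveZ.
  by rewrite deriveZ //; apply: smooth_derivable; exact: smoothD.
have {E2} E2 : g (x + h *: w + h *: v) - g (x + h *: w) - (g (x + h *: v) - g x) =
  h * (h * 'D_v (fun y => 'D_w g y) (x + s' *: (h *: w) + t' *: (h *: v))).
  rewrite E2 smooth_deriveZ; last exact: smoothD.
  congr (_ * _).
  have -> : 'D_(h *: w) g = h \*: (fun y => 'D_w g y).
    by apply/funext => y; rewrite smooth_deriveZ.
  by rewrite deriveZ //; apply: smooth_derivable; exact: smoothD.
have E : 'D_w (fun y => 'D_v g y) (x + s *: (h *: v) + t *: (h *: w)) =
  'D_v (fun y => 'D_w g y) (x + s' *: (h *: w) + t' *: (h *: v)).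
  apply: (mulfI (lt0r_neq0 h0)); apply: (mulfI (lt0r_neq0 h0)).
  have alg (a b c d : R) : a - b - (c - d) = a - c - (b - d) by ring.
  apply: etrans (esym E1) (etrans _ E2).
  rewrite (addrAC x (h *: w) (h *: v)); exact: alg.
have [a1 _] := rP _ (small s t v w s01 t01 erefl).
have [_ a2] := rP _ (small s' t' w v s'01 t'01 (addrC _ _)).
rewrite (splitr e).
apply: le_trans (lerD a1 a2).
rewrite -E [X in _ <= _ + X]distrC.
apply: le_trans (ler_normD _ _).
by rewrite subrKA.
Qed.

(** The head of the list is the direction of the outermost derivative. *)
Definition Dseq vs g : V -> R := foldr (fun v h => fun x => 'D_v h x) g vs.

Lemma Dseq_rcons vs v g : Dseq (rcons vs v) g = Dseq vs (fun x => 'D_v g x).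
Proof. by rewrite /Dseq foldr_rcons. Qed.

Lemma smooth_Dseq vs g : smooth g -> smooth (Dseq vs g).
Proof. by move=> sg; elim: vs => //= v vs IH; exact: smoothD. Qed.

Lemma derive_lincomb (T : Type) (s : seq T) (c : T -> R) (G : T -> V -> R) x v :
  (forall j, smooth (G j)) ->
  'D_v (fun y => \sum_(j <- s) c j * G j y) x = \sum_(j <- s) c j * 'D_v (G j) x.
Proof.
move=> sG.
suff [] : is_derive x v (fun y => \sum_(j <- s) c j * G j y)
   (\sum_(j <- s) c j * 'D_v (G j) x) by [].
elim: s => [|j s IH].
  rewrite big_nil (_ : (fun _ => _) = cst 0); first exact: is_derive_cst.
  by apply/funext => y; rewrite big_nil.
rewrite big_cons (_ : (fun _ => _) = (c j \*: G j) \+ (fun y => \sum_(j <- s) c j * G j y)).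
  apply: is_deriveD; apply: is_deriveZ; apply: derivableP.
  exact: smooth_derivable.
by apply/funext => y; rewrite big_cons.
Qed.

Lemma Dseq_lincomb vs (T : Type) (s : seq T) (c : T -> R) (G : T -> V -> R) :
  (forall j, smooth (G j)) ->
  Dseq vs (fun y => \sum_(j <- s) c j * G j y) = 
  fun y => \sum_(j <- s) c j * Dseq vs (G j) y.
Proof.
move=> sG; elim: vs => //= v vs ->.
by apply/funext => y; rewrite derive_lincomb // => j; exact: smooth_Dseq.
Qed.

Section Bound.
Variables (J : finType) (b : J -> V) (co : V -> J -> R).
Hypothesis co_sum : forall v, v = \sum_j co v j *: b j.
Hypothesis co_le : forall v j, `|co v j| <= `|v|.

(** Expanding each direction in the finite spanning family b reduces a bound
    uniform over all directions to the finitely many derivatives along members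
    of b, which are locally bounded by continuity. The recursion peels off the
    last direction, the innermost derivative, because only there does
    linearity of a single derivative apply. *)
Lemma Dseq_bounded k g x0 : smooth g -> exists2 C : R, 0 <= C &
  \forall x \near x0, forall vs, size vs = k ->
    `|Dseq vs g x| <= C * \prod_(v <- vs) `|v|.
Proof.
elim: k g => [|k IH] g sg.
  exists (`|g x0| + 1); first by rewrite addr_ge0.
  have /cvgrPdist_le /(_ _ ltr01) := smooth_continuous sg (x := x0).
  apply: filterS => x gx vs /size0nil -> /=; rewrite big_nil mulr1.
  rewrite -[g x](subrK (g x0)); apply: (le_trans (ler_normD _ _)).
  by rewrite addrC lerD2l distrC.
have {}IH j := IH _ (smoothD (b j) sg).
pose C j := sval (cid2 (IH j)).
have C0 j : 0 <= C j by rewrite /C; case: cid2.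
have CP : \forall x \near x0, forall j, forall vs, size vs = k ->
    `|Dseq vs (fun y => 'D_(b j) g y) x| <= C j * \prod_(v <- vs) `|v|.
  apply: filter_forall => j; rewrite /C; by case: cid2.
exists (\sum_j C j); first by rewrite sumr_ge0.
apply: filterS CP => x CP vs; case/lastP: vs => // vs v; rewrite size_rcons => -[sk].
rewrite Dseq_rcons.
have -> : (fun y => 'D_v g y) = (fun y => \sum_j co v j * 'D_(b j) g y).
  by apply/funext => y; rewrite {1}(co_sum v) smooth_derive_sum.
rewrite Dseq_lincomb; last by move=> j; exact: smoothD.
apply: (le_trans (ler_norm_sum _ _ _)).
rewrite mulr_suml; apply: ler_sum => j _.
rewrite normrM -cats1 big_cat /= big_seq1 mulrA mulrC.
by apply: ler_pM => //; exact: CP.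
Qed.
End Bound.

Lemma is_derive_expfact (c : nat -> R) m (s : R) :
  is_derive s (1 : R) (fun s : R => \sum_(k < m) s ^+ k.+1 / (k.+1)`!%:R * c k)
     (\sum_(k < m) s ^+ k / k`!%:R * c k).
Proof.
elim: m => [|m IH].
  rewrite big_ord0 (_ : (fun _ => _) = cst 0); first exact: is_derive_cst.
  by apply/funext => y; rewrite big_ord0.
rewrite big_ord_recr /= (_ : (fun _ => _) =
  (fun s : R => \sum_(k < m) s ^+ k.+1 / (k.+1)`!%:R * c k) \+
  ((c m / (m.+1)`!%:R) \*: (fun s : R => s ^+ m.+1))).
  apply: is_deriveD.
  have D := DeriveDef (@exprn_derivable R m.+1 s 1) (@exp_derive R m.+1 s 1).
  have D' := @is_deriveZ R _ _ _ (c m / m.+1`!%:R) _ _ _ D.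
  apply: (is_derive_eq D').
  rewrite factS natrM /= [_%:A]mulr1 -!mulrA.
  have sc (a b : R) : a *: b = a * b by [].
  have f0 : m`!%:R != 0 :> R by rewrite pnatr_eq0 -lt0n fact_gt0.
  have m0 : m.+1%:R != 0 :> R by rewrite pnatr_eq0.
  rewrite !sc; move: f0 m0; move: (m`!%:R : R) (m.+1%:R : R) => a b a0 b0.
  by field; rewrite a0 b0.
apply/funext => y; rewrite big_ord_recr /=; congr (_ + _).
by rewrite -[RHS]/(_ * _) mulrC mulrA mulrAC.
Qed.

(** The remainder of g has as its s-derivative the remainder of the
    v-derivative of g, so the mean value theorem passes the bound from one
    order to the next; as s is at most 1, the constant K is kept. The usual
    factor 1 / m! is given up, which is harmless for orders of magnitude. *)
Lemma taylor_bound m g x v (K : R) : smooth g ->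
  (forall s : R, 0 <= s <= 1 -> `|Dseq (nseq m v) g (x + s *: v)| <= K) ->
  forall s : R, 0 <= s <= 1 ->
   `|g (x + s *: v) - \sum_(k < m) s ^+ k / k`!%:R * Dseq (nseq k v) g x| <= K.
Proof.
elim: m g => [|m IH] g sg HK s s01.
  by rewrite big_ord0 subr0; exact: HK.
have rD k : Dseq (nseq k.+1 v) g = Dseq (nseq k v) (fun y => 'D_v g y).
  by rewrite -Dseq_rcons -[in LHS]addn1 nseqD cats1.
have {}IH := IH _ (smoothD v sg).
rewrite rD in HK; have {}IH := IH HK.
pose c k := Dseq (nseq k.+1 v) g x.
pose r s := g (x + s *: v) - \sum_(k < m) s ^+ k.+1 / (k.+1)`!%:R * c k.
pose r' s := 'D_v g (x + s *: v) - \sum_(k < m) s ^+ k / k`!%:R * c k.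
have dr t : is_derive t (1 : R) r (r' t).
  apply: is_deriveB; last exact: is_derive_expfact.
  by apply: line_derive; exact: smooth_derivable.
have /andP[s0 s1] := s01.
have cr : {within `[0, s], continuous r}.
  apply: continuous_subspaceT => t.
  apply: differentiable_continuous; apply/derivable1_diffP.
  by have [] := dr t.
have [t] := MVT_segment s0 (fun t _ => dr t) cr.
rewrite in_itv /= => /andP[t0 ts] E.
have r0 : r 0 = g x.
  rewrite /r scale0r addr0 big1 ?subr0 // => k _.
  by rewrite expr0n /= !mul0r.
have -> : g (x + s *: v) - \sum_(k < m.+1) s ^+ k / k`!%:R * Dseq (nseq k v) g x
  = r s - r 0.
  rewrite r0 /r big_ord_recl /= expr0 fact0 divr1 mul1r opprD addrA addrAC.
  by congr (_ - _ - _).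
rewrite E subr0 normrM (ger0_norm s0).
have t01 : 0 <= t <= 1 by rewrite t0 (le_trans ts).
have := IH t t01; rewrite /r'.
have -> : \sum_(k < m) t ^+ k / k`!%:R * Dseq (nseq k v) (fun y : V => 'D_v g y) x =
  \sum_(k < m) t ^+ k / k`!%:R * c k.
  by apply: eq_bigr => k _; rewrite /c rD.
by move=> le; apply: le_trans le; rewrite ler_piMr.
Qed.

End MultiDerivative.


(** * Modulus of complex numbers *)

Section Modulus.
Variable R : realType.
Implicit Types (z w : R[i]) (r : R).

Lemma cReD z w : Re (z + w) = Re z + Re w. Proof. by case: z; case: w. Qed.
Lemma cImD z w : Im (z + w) = Im z + Im w. Proof. by case: z; case: w. Qed.
Lemma cReN z : Re (- z) = - Re z. Proof. by case: z. Qed.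
Lemma cImN z : Im (- z) = - Im z. Proof. by case: z. Qed.
Lemma cReM z w : Re (z * w) = Re z * Re w - Im z * Im w.
Proof. by case: z; case: w. Qed.
Lemma cImM z w : Im (z * w) = Re z * Im w + Im z * Re w.
Proof. by case: z => a b; case: w => c d /=. Qed.
Lemma cReJ z : Re z^* = Re z. Proof. by case: z. Qed.
Lemma cImJ z : Im z^* = - Im z. Proof. by case: z. Qed.
Lemma complexP z w : Re z = Re w -> Im z = Im w -> z = w.
Proof. by case: z => a b; case: w => c d /= -> ->. Qed.
Lemma conjCR r : (r%:C%C : R[i])^* = r%:C%C.
Proof. by apply: complexP; rewrite ?cReJ ?cImJ //= oppr0. Qed.

Lemma cmodE z : cmod z = Num.sqrt (Re z ^+ 2 + Im z ^+ 2). Proof. by case: z. Qed.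
Lemma cmod_ge0 z : 0 <= cmod z. Proof. by rewrite cmodE sqrtr_ge0. Qed.
Lemma cmod_sqr z : cmod z ^+ 2 = Re z ^+ 2 + Im z ^+ 2.
Proof. by rewrite cmodE sqr_sqrtr // addr_ge0 ?sqr_ge0. Qed.
Lemma cmodM z w : cmod (z * w) = cmod z * cmod w. Proof. exact: Normc.normcM. Qed.
Lemma cmodV z : cmod z^-1 = (cmod z)^-1. Proof. exact: Normc.normcV. Qed.
Lemma cmodD z w : cmod (z + w) <= cmod z + cmod w. Proof. exact: le_normcD. Qed.
Lemma cmodN z : cmod (- z) = cmod z. Proof. exact: normcN. Qed.
Lemma cmod0 : cmod (0 : R[i]) = 0. Proof. exact: Normc.normc0. Qed.
Lemma cmod1 : cmod (1 : R[i]) = 1. Proof. exact: Normc.normc1. Qed.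
Lemma cmod_eq0 z : (cmod z == 0) = (z == 0).
Proof.
apply/eqP/eqP => [|->]; [exact: Normc.eq0_normc | exact: cmod0].
Qed.
Lemma cmod_gt0 z : (0 < cmod z) = (z != 0).
Proof. by rewrite lt_def cmod_ge0 andbT cmod_eq0. Qed.
Lemma cmodC r : cmod (r%:C%C : R[i]) = `|r|.
Proof. by rewrite cmodE /= expr0n /= addr0 sqrtr_sqr. Qed.
Lemma cmodJ z : cmod z^* = cmod z.
Proof. by rewrite !cmodE cReJ cImJ sqrrN. Qed.
Lemma cmod_Re z : `|Re z| <= cmod z.
Proof. by rewrite cmodE -sqrtr_sqr ler_wsqrtr // lerDl sqr_ge0. Qed.
Lemma cmod_Im z : `|Im z| <= cmod z.
Proof. by rewrite cmodE -sqrtr_sqr ler_wsqrtr // lerDr sqr_ge0. Qed.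
Lemma cmod_le z : cmod z <= `|Re z| + `|Im z|.
Proof.
rewrite -(ler_pXn2r (n := 2)) ?nnegrE ?cmod_ge0 ?addr_ge0 //.
rewrite cmod_sqr sqrrD !real_normK ?num_real // addrAC lerDl.
by rewrite mulrn_wge0 // mulr_ge0.
Qed.
Lemma cmod_sum (I : Type) (s : seq I) (h : I -> R[i]) :
  cmod (\sum_(k <- s) h k) <= \sum_(k <- s) cmod (h k).
Proof.
elim: s => [|k s IH]; first by rewrite !big_nil cmod0.
by rewrite !big_cons (le_trans (cmodD _ _)) // lerD2l.
Qed.
Lemma cmodB z w : cmod (z - w) <= cmod z + cmod w.
Proof. by rewrite -(cmodN w); exact: cmodD. Qed.
Lemma cmod_mulJ z : z * z^* = ((cmod z ^+ 2)%:C)%C.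
Proof.
apply: complexP; rewrite ?cReM ?cImM cReJ cImJ /= ?cmod_sqr; first by ring.
by rewrite mulrN mulrC addNr.
Qed.

End Modulus.

(** * Orders of magnitude along a filter *)

Section BigO.
Variables (R : realType) (F : set_system R).
Context {FF : Filter F}.
Implicit Types (g : R -> R).

(** Uniformity in the second argument is what allows time to be carried along. *)
Definition bO (S : Type) g (h : R -> S -> R[i]) : Prop :=
  exists C : R, \forall a \near F, forall s, cmod (h a s) <= C * `|g a|.

Lemma bO_pos (S : Type) g (h : R -> S -> R[i]) : bO g h ->
  exists2 C : R, 0 < C & \forall a \near F, forall s, cmod (h a s) <= C * `|g a|.
Proof.
move=> [C hC]; exists (`|C| + 1); first by rewrite ltr_wpDl.
apply: filterS hC => a ha s; apply: (le_trans (ha s)).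
by rewrite ler_wpM2r // (le_trans (ler_norm C)) // lerDl.
Qed.

Variable S : Type.
Implicit Types (h k : R -> S -> R[i]).

Lemma bO_add g h k : bO g h -> bO g k -> bO g (fun a s => h a s + k a s).
Proof.
move=> [C hC] [D kD]; exists (C + D); apply: filterS2 hC kD => a ha ka s.
by rewrite (le_trans (cmodD _ _)) // mulrDl lerD.
Qed.

Lemma bO_opp g h : bO g h -> bO g (fun a s => - h a s).
Proof. by move=> [C hC]; exists C; apply: filterS hC => a ha s; rewrite cmodN. Qed.

Lemma bO_mul g g' h k : bO g h -> bO g' k ->
  bO (fun a => g a * g' a) (fun a s => h a s * k a s).
Proof.
move=> /bO_pos[C C0 hC] /bO_pos[D D0 kD]; exists (C * D).
apply: filterS2 hC kD => a ha ka s.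
by rewrite cmodM normrM mulrACA ler_pM // cmod_ge0.
Qed.

Lemma bO_conj g h : bO g h -> bO g (fun a s => (h a s)^*).
Proof. by move=> [C hC]; exists C; apply: filterS hC => a ha s; rewrite cmodJ. Qed.

Lemma bO_0 g : bO g (fun a (s : S) => 0 : R[i]).
Proof. by exists 0; apply: nearW => a s; rewrite cmod0 mul0r. Qed.

Lemma bO_const (c : R[i]) : bO (fun=> 1) (fun a (s : S) => c).
Proof. by exists (cmod c); apply: nearW => a s; rewrite normr1 mulr1. Qed.

Lemma bO_weak g g' h (K : R) : (\forall a \near F, `|g a| <= K * `|g' a|) ->
  bO g h -> bO g' h.
Proof.
move=> gg /bO_pos[C C0 hC]; exists (C * K); apply: filterS2 gg hC => a ga ha s.
by apply: (le_trans (ha s)); rewrite -mulrA ler_pM2l.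
Qed.

Lemma bO_gauge g g' h : (\forall a \near F, `|g a| <= `|g' a|) ->
  bO g h -> bO g' h.
Proof. by move=> gg; apply: (@bO_weak _ _ _ 1); apply: filterS gg => a; rewrite mul1r. Qed.

Lemma bO_mull g h k : bO (fun=> 1) h -> bO g k -> bO g (fun a s => h a s * k a s).
Proof.
move=> h1 k1; apply: bO_gauge (bO_mul h1 k1).
by apply: nearW => a; rewrite mul1r.
Qed.

Lemma bO_mulr g h k : bO g h -> bO (fun=> 1) k -> bO g (fun a s => h a s * k a s).
Proof.
move=> h1 k1; apply: bO_gauge (bO_mul h1 k1).
by apply: nearW => a; rewrite mulr1.
Qed.

Lemma bO_scale g h (c : R[i]) : bO g h -> bO g (fun a s => c * h a s).
Proof. by apply: bO_mull; exact: bO_const. Qed.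

Lemma bO_sum (I : Type) (r : seq I) g (H : I -> R -> S -> R[i]) :
  (forall i, bO g (H i)) -> bO g (fun a s => \sum_(i <- r) H i a s).
Proof.
move=> hH; elim: r => [|i r IH].
  by exists 0; apply: nearW => a s; rewrite big_nil cmod0 mul0r.
have := bO_add (hH i) IH; congr bO.
by apply/funext => a; apply/funext => s; rewrite big_cons.
Qed.

Lemma bO_near g h k : (\forall a \near F, forall s, h a s = k a s) -> bO g h -> bO g k.
Proof.
by move=> e [C hC]; exists C; apply: filterS2 e hC => a e ha s; rewrite -e.
Qed.

Lemma bO_eq g h k : (forall a s, h a s = k a s) -> bO g h -> bO g k.
Proof. by move=> e; apply: bO_near; apply: nearW. Qed.

Lemma bO_le g h k : (\forall a \near F, forall s, cmod (k a s) <= cmod (h a s)) ->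
   bO g h -> bO g k.
Proof.
by move=> e [C hC]; exists C; apply: filterS2 e hC => a e ha s; exact: le_trans (e s) (ha s).
Qed.

End BigO.


(** * Means of real functions of time *)

Section RealMean.
Variable R : realType.
Implicit Types (phi psi Phi : R -> R) (T : R).

Definition mean T phi : R := T^-1 * \int[lebesgue_measure]_(t in `[0, T]) phi t.

Lemma derive_continuous phi (phi' : R -> R) :
  (forall t, is_derive t (1 : R) phi (phi' t)) -> continuous phi.
Proof.
by move=> d t; apply: differentiable_continuous; apply/derivable1_diffP; have [] := d t.
Qed.

Lemma cont_integrable phi (a b : R) : continuous phi ->
  lebesgue_measure.-integrable `[a, b] (EFin \o phi).
Proof.
move=> c; apply: continuous_compact_integrable; first exact: segment_compact.
exact: continuous_subspaceT.
Qed.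

(** The open interval lets the antiderivative be differentiable at the end
    points of a period placed inside it. *)
Lemma antiderivative phi (a b : R) : continuous phi ->
  exists Phi, forall t, t \in `]a, b[ -> is_derive t (1 : R) Phi (phi t).
Proof.
move=> c; pose Phi x := (\int[lebesgue_measure]_(t in `[a, x]) phi t)%R.
exists Phi => t; rewrite in_itv /= => /andP[at_ tb].
have [d e] := continuous_FTC1_closed tb (cont_integrable a b c) at_ (c t).
by move: e; rewrite derive1E => e; exact: DeriveDef d e.
Qed.

Lemma mean_antiderivative phi Phi T (a b : R) : a < 0 -> 0 < T -> T < b -> continuous phi ->
  (forall t, t \in `]a, b[ -> is_derive t (1 : R) Phi (phi t)) ->
  mean T phi = T^-1 * (Phi T - Phi 0).
Proof.
move=> a0 T0 Tb c d; rewrite /mean; congr (_ * _).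
have D t : t \in `[0, T] -> is_derive t (1 : R) Phi (phi t).
  rewrite in_itv /= => /andP[t0 tT]; apply: d.
  by rewrite in_itv /= (lt_le_trans a0) // (le_lt_trans tT).
have C t : t \in `[0, T] -> {for t, continuous Phi}.
  move=> tT; apply: differentiable_continuous; apply/derivable1_diffP.
  by have [] := D t tT.
rewrite /Rintegral (@continuous_FTC2 _ phi Phi 0 T) //.
- exact: continuous_subspaceT.
- split.
  + by move=> t tT; have [] := D t (subset_itv_oo_cc tT).
  + by apply: cvg_at_right_filter; apply: C; rewrite in_itv /= lexx ltW.
  + by apply: cvg_at_left_filter; apply: C; rewrite in_itv /= lexx ltW.
- move=> t tT; rewrite derive1E; exact: (@derive_val _ _ _ _ _ _ _ (D t (subset_itv_oo_cc tT))).
Qed.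

Lemma mean_derive T phi Phi : 0 < T -> continuous phi ->
  (forall t, is_derive t (1 : R) Phi (phi t)) -> Phi T = Phi 0 -> mean T phi = 0.
Proof.
move=> T0 c d e; rewrite (@mean_antiderivative phi Phi T (-1) (T + 1)) //.
- by rewrite e subrr mulr0.
- by rewrite ltrDl.
Qed.

Lemma continuous_comp_addr phi (s : R) : continuous phi -> continuous (fun t => phi (t + s)).
Proof.
move=> c t; apply: (@continuous_comp _ _ _ (fun t => t + s) phi); last exact: c.
by apply: cvgD; [exact: cvg_id|exact: cvg_cst].
Qed.

(** If Phi is an antiderivative of phi, the increment Phi (t + T) - Phi t has
    derivative zero by periodicity, hence is the same for the windows starting
    at 0 and at s. *)
Lemma mean_shift T phi (s : R) : 0 < T -> 0 < s -> continuous phi ->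
  (forall t, phi (t + T) = phi t) ->
  mean T (fun t => phi (t + s)) = mean T phi.
Proof.
move=> T0 s0 c per.
have [Phi d] := @antiderivative phi (-1 - T) (s + T + s + T + 1) c.
have ds (u t : R) : t + u \in `](-1 - T), (s + T + s + T + 1)[ ->
    is_derive t (1 : R) (fun t => Phi (t + u)) (phi (t + u)).
  move=> /d [d1 d2]; rewrite -d2; exact: is_derive_translate.
have a0 : -1 < 0 :> R by lra.
have b1 : T < T + s + 1 by lra.
have c1 := @continuous_comp_addr phi s c.
have d1 t : t \in `](-1), (T + s + 1)[ ->
    is_derive t (1 : R) (fun t => Phi (t + s)) (phi (t + s)).
  rewrite in_itv /= => /andP[t1 t2]; apply: ds; rewrite in_itv /=.
  by apply/andP; split; lra.
have M1 := mean_antiderivative a0 T0 b1 c1 d1.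
have d2 t : t \in `](-1), (T + s + 1)[ -> is_derive t (1 : R) Phi (phi t).
  rewrite in_itv /= => /andP[t1 t2]; apply: d; rewrite in_itv /=.
  by apply/andP; split; lra.
have M2 := mean_antiderivative a0 T0 b1 c d2.
rewrite M1 M2.
congr (_ * _); rewrite add0r.
pose G t := Phi (t + T) - Phi t.
have dG t : t \in `](-1), (s + T + 1)[ -> is_derive t (1 : R) G 0.
  rewrite in_itv /= => /andP[t1 t2].
  rewrite -(subrr (phi t)) -{1}(per t); apply: is_deriveB.
    by apply: ds; rewrite in_itv /=; apply/andP; split; lra.
  by apply: d; rewrite in_itv /=; apply/andP; split; lra.
have : G s - G 0 = 0.
  have dG' t : t \in `]0, s[ -> is_derive t (1 : R) G 0.
    move=> ts; apply: dG; move: ts; rewrite !in_itv /= => /andP[t0 ts].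
    by apply/andP; split; lra.
  have cG : {within `[0, s], continuous G}.
    apply: derivable_within_continuous => t; rewrite in_itv /= => /andP[t0 ts].
    have : is_derive t (1 : R) G 0 by apply: dG; rewrite in_itv /=; apply/andP; split; lra.
    by case.
  by have [t _ ->] := MVT_segment (ltW s0) dG' cG; rewrite mul0r.
rewrite /G add0r (addrC s T) => /eqP; rewrite subr_eq0 => /eqP e.
by lra.
Qed.

Lemma meanD T phi psi : continuous phi -> continuous psi ->
  mean T (fun t => phi t + psi t) = mean T phi + mean T psi.
Proof.
move=> c1 c2; rewrite /mean -mulrDr; congr (_ * _).
by apply: RintegralD => //; exact: cont_integrable.
Qed.

Lemma meanZ T phi (r : R) : continuous phi ->
  mean T (fun t => r * phi t) = r * mean T phi.
Proof.
move=> c1; rewrite /mean mulrCA; congr (_ * _).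
by apply: RintegralZl => //; exact: cont_integrable.
Qed.

Lemma mean_cst T (r : R) : 0 < T -> mean T (fun=> r) = r.
Proof.
move=> T0; rewrite /mean (@Rintegral_cst _ _ R (@lebesgue_measure R)) //.
rewrite /= lebesgue_measure_itv /= lte_fin T0.
by rewrite oppr0 addr0 /= mulrC -mulrA divff ?mulr1 // gt_eqF.
Qed.

Lemma mean_le T phi (B : R) : 0 < T -> continuous phi ->
  (forall t, `|phi t| <= B) -> `|mean T phi| <= B.
Proof.
move=> T0 c h.
have i := cont_integrable 0 T c.
have cB : continuous (fun _ : R => B) 
  by apply: (@derive_continuous _ (fun=> 0)) => t; exact: is_derive_cst.
have Ti : 0 < T^-1 by rewrite invr_gt0.
rewrite -(mean_cst B T0) /mean normrM (gtr0_norm Ti) ler_pM2l //.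
apply: (le_trans (le_normr_Rintegral _ i)) => //.
apply: le_Rintegral => //.
- by apply: (cont_integrable 0 T (phi := fun t => `|phi t|)) => t; exact: continuous_comp (c t) (@norm_continuous _ _ _).
- exact: cont_integrable.
Qed.

End RealMean.

(** * Complex functions of time and their means *)

Section ComplexMean.
Variable R : realType.
Implicit Types (z w : R -> R[i]) (c : R[i]) (T : R).

Definition ccont z := continuous (fun t : R => Re (z t)) /\ continuous (fun t : R => Im (z t)).

Definition cder z (z' : R -> R[i]) := forall t : R,
  is_derive t (1 : R) (fun t : R => Re (z t)) (Re (z' t)) /\
  is_derive t (1 : R) (fun t : R => Im (z t)) (Im (z' t)).

Lemma cder_cont z z' : cder z z' -> ccont z.
Proof.
by move=> d; split; [apply: (@derive_continuous _ _ (fun t => Re (z' t))) => t; have [] := d t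
  | apply: (@derive_continuous _ _ (fun t => Im (z' t))) => t; have [] := d t].
Qed.

Lemma cder_ext z w z' w' : cder z z' -> (forall t, z t = w t) -> (forall t, z' t = w' t) ->
  cder w w'.
Proof. by move=> d /funext <- /funext <-. Qed.

Lemma ccont_ext z w : ccont z -> (forall t, z t = w t) -> ccont w.
Proof. by move=> d /funext <-. Qed.

Lemma cder_cst c : cder (fun=> c) (fun=> 0).
Proof. by move=> t; split; exact: is_derive_cst. Qed.

Lemma cderD z w z' w' : cder z z' -> cder w w' ->
  cder (fun t => z t + w t) (fun t => z' t + w' t).
Proof.
move=> dz dw t; have [z1 z2] := dz t; have [w1 w2] := dw t; split.
  rewrite cReD (_ : (fun _ => _) = (fun t => Re (z t)) \+ (fun t => Re (w t))).
    exact: is_deriveD.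
  by apply/funext => s; rewrite cReD.
rewrite cImD (_ : (fun _ => _) = (fun t => Im (z t)) \+ (fun t => Im (w t))).
  exact: is_deriveD.
by apply/funext => s; rewrite cImD.
Qed.

Lemma cderM z w z' w' : cder z z' -> cder w w' ->
  cder (fun t => z t * w t) (fun t => z' t * w t + z t * w' t).
Proof.
move=> dz dw t; have [z1 z2] := dz t; have [w1 w2] := dw t; split.
  rewrite (_ : (fun _ => _) = (fun t => Re (z t)) \* (fun t => Re (w t)) \-
     (fun t => Im (z t)) \* (fun t => Im (w t))).
    apply: (is_derive_eq (is_deriveB (is_deriveM z1 w1) (is_deriveM z2 w2))).
    have sc (a b : R) : a *: b = a * b by [].
    rewrite cReD !cReM !sc; ring.
  by apply/funext => s; rewrite cReM.
rewrite (_ : (fun _ => _) = (fun t => Re (z t)) \* (fun t => Im (w t)) \+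
   (fun t => Im (z t)) \* (fun t => Re (w t))).
  apply: (is_derive_eq (is_deriveD (is_deriveM z1 w2) (is_deriveM z2 w1))).
  have sc (a b : R) : a *: b = a * b by [].
  rewrite cImD !cImM !sc; ring.
by apply/funext => s; rewrite cImM.
Qed.

Lemma cderZ c z z' : cder z z' -> cder (fun t => c * z t) (fun t => c * z' t).
Proof.
move=> d; apply: (cder_ext (cderM (cder_cst c) d)) => // t.
by rewrite mul0r add0r.
Qed.

Lemma cderN z z' : cder z z' -> cder (fun t => - z t) (fun t => - z' t).
Proof.
by move=> d; apply: (cder_ext (cderZ (-1) d)) => // t; rewrite mulN1r.
Qed.

Lemma cderB z w z' w' : cder z z' -> cder w w' ->
  cder (fun t => z t - w t) (fun t => z' t - w' t).
Proof. by move=> d1 d2; apply: cderD => //; apply: cderN. Qed.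

Lemma cderJ z z' : cder z z' -> cder (fun t => (z t)^*) (fun t => (z' t)^*).
Proof.
move=> d t; have [z1 z2] := d t; split.
  rewrite cReJ (_ : (fun _ => _) = (fun t => Re (z t))) //.
  by apply/funext => s; rewrite cReJ.
rewrite cImJ (_ : (fun _ => _) = \- (fun t => Im (z t))); first exact: is_deriveN.
by apply/funext => s; rewrite cImJ.
Qed.

Lemma cder_sum (I : Type) (r : seq I) (Z Z' : I -> R -> R[i]) :
  (forall i, cder (Z i) (Z' i)) ->
  cder (fun t => \sum_(i <- r) Z i t) (fun t => \sum_(i <- r) Z' i t).
Proof.
move=> d; elim: r => [|i r IH].
  by apply: (cder_ext (cder_cst 0)) => t; rewrite big_nil.
by apply: (cder_ext (cderD (d i) IH)) => t; rewrite big_cons.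
Qed.

Lemma continuous_cst (r : R) : continuous (fun _ : R => r).
Proof. by apply: (@derive_continuous _ _ (fun=> 0)) => t; exact: is_derive_cst. Qed.

Lemma ccont_cst c : ccont (fun=> c).
Proof. by split; exact: continuous_cst. Qed.

Lemma ccontD z w : ccont z -> ccont w -> ccont (fun t => z t + w t).
Proof.
move=> [z1 z2] [w1 w2]; split => t.
  rewrite (_ : (fun _ => _) = (fun t => Re (z t)) \+ (fun t => Re (w t))).
    by apply: cvgD; [exact: z1|exact: w1].
  by apply/funext => s; rewrite cReD.
rewrite (_ : (fun _ => _) = (fun t => Im (z t)) \+ (fun t => Im (w t))).
  by apply: cvgD; [exact: z2|exact: w2].
by apply/funext => s; rewrite cImD.
Qed.

Lemma ccontM z w : ccont z -> ccont w -> ccont (fun t => z t * w t).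
Proof.
move=> [z1 z2] [w1 w2]; split => t.
  rewrite (_ : (fun _ => _) = (fun t => Re (z t)) \* (fun t => Re (w t)) \-
     (fun t => Im (z t)) \* (fun t => Im (w t))).
    by apply: cvgB; apply: cvgM; [exact: z1|exact: w1|exact: z2|exact: w2].
  by apply/funext => s; rewrite cReM.
rewrite (_ : (fun _ => _) = (fun t => Re (z t)) \* (fun t => Im (w t)) \+
   (fun t => Im (z t)) \* (fun t => Re (w t))).
  by apply: cvgD; apply: cvgM; [exact: z1|exact: w2|exact: z2|exact: w1].
by apply/funext => s; rewrite cImM.
Qed.

Lemma ccontZ c z : ccont z -> ccont (fun t => c * z t).
Proof. by move=> h; apply: ccontM => //; exact: ccont_cst. Qed.

Lemma ccontN z : ccont z -> ccont (fun t => - z t).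
Proof. by move=> h; apply: (ccont_ext (ccontZ (-1) h)) => t; rewrite mulN1r. Qed.

Lemma ccontB z w : ccont z -> ccont w -> ccont (fun t => z t - w t).
Proof. by move=> h1 h2; apply: ccontD => //; exact: ccontN. Qed.

Lemma ccontJ z : ccont z -> ccont (fun t => (z t)^*).
Proof.
move=> [z1 z2]; split => t.
  by rewrite (_ : (fun _ => _) = (fun t => Re (z t))); [exact: z1|apply/funext => s; rewrite cReJ].
rewrite (_ : (fun _ => _) = \- (fun t => Im (z t))); first by apply: cvgN; exact: z2.
by apply/funext => s; rewrite cImJ.
Qed.

Lemma ccont_sum (I : Type) (r : seq I) (Z : I -> R -> R[i]) :
  (forall i, ccont (Z i)) -> ccont (fun t => \sum_(i <- r) Z i t).
Proof.
move=> d; elim: r => [|i r IH].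
  by apply: (ccont_ext (ccont_cst 0)) => t; rewrite big_nil.
by apply: (ccont_ext (ccontD (d i) IH)) => t; rewrite big_cons.
Qed.

Definition cmean T z : R[i] :=
  (mean T (fun t => Re (z t)) +i* mean T (fun t => Im (z t)))%C.

Lemma cmean_ext T z w : (forall t, z t = w t) -> cmean T z = cmean T w.
Proof. by move=> /funext ->. Qed.

Lemma cmeanD T z w : ccont z -> ccont w ->
  cmean T (fun t => z t + w t) = cmean T z + cmean T w.
Proof.
move=> [z1 z2] [w1 w2]; apply: complexP; rewrite ?cReD ?cImD /= -meanD //.
  by congr mean; apply/funext => t; rewrite cReD.
by congr mean; apply/funext => t; rewrite cImD.
Qed.

Lemma cmeanZ T c z : ccont z -> cmean T (fun t => c * z t) = c * cmean T z.
Proof.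
move=> [z1 z2].
have cZ (r : R) (phi : R -> R) : continuous phi -> continuous (fun t => r * phi t).
  by move=> h t; apply: cvgM; [exact: continuous_cst|exact: h].
apply: complexP; rewrite ?cReM ?cImM /=.
  rewrite -!meanZ // -mulN1r -meanZ; last exact: cZ.
  rewrite -meanD; [|exact: cZ|exact/cZ/cZ].
  by congr mean; apply/funext => t; rewrite cReM mulN1r.
rewrite -!meanZ // -meanD; [|exact: cZ|exact: cZ].
by congr mean; apply/funext => t; rewrite cImM.
Qed.

Lemma cmeanN T z : ccont z -> cmean T (fun t => - z t) = - cmean T z.
Proof.
move=> h; rewrite -mulN1r -cmeanZ //; apply: cmean_ext => t; by rewrite mulN1r.
Qed.

Lemma cmeanB T z w : ccont z -> ccont w ->
  cmean T (fun t => z t - w t) = cmean T z - cmean T w.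
Proof. by move=> h1 h2; rewrite cmeanD ?cmeanN //; exact: ccontN. Qed.

Lemma cmean_sum T (I : Type) (r : seq I) (Z : I -> R -> R[i]) :
  (forall i, ccont (Z i)) ->
  cmean T (fun t => \sum_(i <- r) Z i t) = \sum_(i <- r) cmean T (Z i).
Proof.
move=> d; elim: r => [|i r IH].
  rewrite big_nil -[RHS](mul0r (cmean T (fun=> 0))) -cmeanZ; last exact: ccont_cst.
  by apply: cmean_ext => t; rewrite big_nil mul0r.
rewrite big_cons -IH -cmeanD //; last exact: ccont_sum.
by apply: cmean_ext => t; rewrite big_cons.
Qed.

Lemma cmeanJ T z : ccont z -> cmean T (fun t => (z t)^*) = (cmean T z)^*.
Proof.
move=> [z1 z2]; apply: complexP; rewrite ?cReJ ?cImJ /=.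
  by congr mean; apply/funext => t; rewrite cReJ.
by rewrite -mulN1r -meanZ //; congr mean; apply/funext => t; rewrite cImJ mulN1r.
Qed.

Lemma cmean_cst T c : 0 < T -> cmean T (fun=> c) = c.
Proof. by move=> T0; rewrite /cmean !mean_cst //; case: c. Qed.

(** The factor 2 comes from bounding the real and imaginary parts
    separately. *)
Lemma cmean_le T z (B : R) : 0 < T -> ccont z -> (forall t, cmod (z t) <= B) ->
  cmod (cmean T z) <= 2 * B.
Proof.
move=> T0 [z1 z2] h; apply: (le_trans (cmod_le _)) => /=.
have h1 := mean_le T0 z1 (fun t => le_trans (cmod_Re (z t)) (h t)).
have h2 := mean_le T0 z2 (fun t => le_trans (cmod_Im (z t)) (h t)).
by rewrite mulr_natl mulr2n lerD.
Qed.

Lemma cmean_der T z z' : 0 < T -> cder z z' -> ccont z' -> z T = z 0 -> cmean T z' = 0.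
Proof.
move=> T0 d [c1 c2] e; apply: complexP => /=.
  by apply: (mean_derive T0 c1 (fun t => (d t).1)); rewrite e.
by apply: (mean_derive T0 c2 (fun t => (d t).2)); rewrite e.
Qed.

(** Shifting by half a period changes the sign of z and leaves its mean
    unchanged. *)
Lemma cmean_antiperiodic T z : 0 < T -> ccont z -> (forall t, z (t + T / 2) = - z t) ->
  cmean T z = 0.
Proof.
move=> T0 c h.
have per t : z (t + T) = z t by rewrite [T]splitr addrA !h opprK.
have T2 : 0 < T / 2 by rewrite divr_gt0.
have E : cmean T (fun t => z (t + T / 2)) = cmean T z.
  by apply: complexP => /=; apply: mean_shift => //; case: c => // c1 c2 t; rewrite per.
have : cmean T z = - cmean T z.
  by rewrite -{1}E -cmeanN //; apply: cmean_ext.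
move/eqP; rewrite -addr_eq0 -mulr2n mulrn_eq0 /= => /eqP //.
Qed.

(** The complex exponential of i x. *)
Definition cis (x : R) : R[i] := (cos x +i* sin x)%C.

Lemma cisD x y : cis (x + y) = cis x * cis y.
Proof. by apply: complexP; rewrite ?cReM ?cImM /= ?cosD ?sinD //; ring. Qed.

Lemma cis0 : cis 0 = 1. Proof. by rewrite /cis cos0 sin0. Qed.
Lemma cispi : cis pi = -1.
Proof. by apply: complexP; rewrite ?cReN ?cImN /= ?cospi ?sinpi ?oppr0. Qed.

Lemma cisJ x : cis x * (cis x)^* = 1.
Proof.
rewrite cmod_mulJ cmod_sqr /= cos2Dsin2; by apply: complexP.
Qed.

Lemma cmod_cis x : cmod (cis x) = 1.
Proof.
by rewrite cmodE /= cos2Dsin2 sqrtr1.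
Qed.

Lemma cder_cis (W : R) : cder (fun t => cis (W * t)) (fun t => 'i%C * W%:C%C * cis (W * t)).
Proof.
have dW (t : R) : is_derive t (1 : R) (fun t : R => W * t) W.
  have D := is_deriveZ W (@is_derive_id R R t 1).
  by apply: (is_derive_eq D); rewrite [LHS]mulr1.
move=> t; split => /=.
  have D := @is_derive1_comp _ _ _ t _ _ (is_derive_cos (W * t)) (dW t).
  apply: (is_derive_eq D); ring.
have D := @is_derive1_comp _ _ _ t _ _ (is_derive_sin (W * t)) (dW t).
apply: (is_derive_eq D); ring.
Qed.

End ComplexMean.

(** * Periodic solutions of a scalar linear equation *)

Section ScalarEstimate.
Variable R : realType.
Implicit Types (z h : R -> R[i]) (T H : R).

Lemma periodic_window (T : R) (phi : R -> R) (s t : R) : 0 < T ->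
  (forall t, phi (t + T) = phi t) -> exists2 t', 0 <= t' - s <= T & phi t' = phi t.
Proof.
move=> T0 per.
have perN u (k : nat) : phi (u + T *+ k) = phi u.
  by elim: k => [|k IH]; rewrite ?mulr0n ?addr0 // mulrSr addrA per.
have perZ u (k : int) : phi (u + T *~ k) = phi u.
  case: k => k; first exact: perN.
  by rewrite NegzE mulrNz -(perN (u - _) k.+1) subrK.
pose k := Num.floor ((t - s) / T).
have k1 : k%:~R <= (t - s) / T by exact: floor_le.
have k2 : (t - s) / T < (k + 1)%:~R by exact: floorD1_gt.
exists (t + T *~ (- k)); last exact: perZ.
move: k1 k2; rewrite mulrNz -mulrzr ler_pdivlMr // ltr_pdivrMr // intrD mulrDl mul1r.
by rewrite [_ * T]mulrC => k1 k2; apply/andP; split; lra.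
Qed.

Lemma periodic_bounded (T : R) (phi : R -> R) : 0 < T -> continuous phi ->
  (forall t, phi (t + T) = phi t) -> exists t0, forall t, phi t <= phi t0.
Proof.
move=> T0 c per.
have [t0 _ h] := EVT_max (ltW T0) (@continuous_subspaceT _ _ `[0, T]%classic _ c).
exists t0 => t; have [t' ht' <-] := periodic_window 0 t T0 per.
by apply: h; rewrite in_itv /= -(subr0 t').
Qed.

(** The supremum S of phi satisfies S <= S / 2 + H; the bound B makes this
    supremum finite. *)
Lemma absorption (X : Type) (phi : X -> R) (H B : R) : (forall x, phi x <= B) ->
  (forall S, (forall x, phi x <= S) -> forall x, phi x <= S / 2 + H) ->
  forall x, phi x <= 2 * H.
Proof.
move=> hB hS x0.
have ne : range phi !=set0 by exists (phi x0), x0.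
have S0 : has_sup (range phi).
  by split=> //; exists B => _ [x _ <-]; exact: hB.
have hs x : phi x <= sup (range phi).
  by apply: sup_upper_bound => //; exists x.
have : sup (range phi) <= sup (range phi) / 2 + H.
  by apply: ge_sup => // _ [x _ <-]; apply: hS.
move=> h; apply: (le_trans (hs x0)); lra.
Qed.

Lemma cder_sqr_mod z z' : cder z z' -> forall t : R,
  is_derive t (1 : R) (fun t => Re (z t) ^+ 2 + Im (z t) ^+ 2)
     (2 * (Re (z t) * Re (z' t) + Im (z t) * Im (z' t))).
Proof.
move=> d t; have [d1 d2] := d t.
have D := is_deriveD (is_deriveM d1 d1) (is_deriveM d2 d2).
have sc (a b : R) : a *: b = a * b by [].
rewrite !sc in D.
by rewrite (_ : (fun _ => _) = (fun t => Re (z t)) * (fun t => Re (z t)) +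
  (fun t => Im (z t)) * (fun t => Im (z t))) //; apply: (is_derive_eq D); ring.
Qed.

(** At a maximum of |z|^2 the derivative of |z|^2 vanishes, so that Re kap *
    |z|^2 equals minus the real part of the product of h with the conjugate of
    z, at most 2 |z| H in modulus. *)
Lemma periodic_estimate_re (kap : R[i]) T z h H : 0 < T -> 0 < `|Re kap| ->
  cder z (fun t => kap * z t + h t) -> (forall t, z (t + T) = z t) ->
  (forall t, cmod (h t) <= H) -> forall t, cmod (z t) <= 2 / `|Re kap| * H.
Proof.
move=> T0 k0 d per hH.
pose N t := Re (z t) ^+ 2 + Im (z t) ^+ 2.
have dN := cder_sqr_mod d.
have cN : continuous N by exact: derive_continuous dN.
have perN t : N (t + T) = N t by rewrite /N per.
have [t0 max] := periodic_bounded T0 cN perN.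
have e : 2 * (Re (z t0) * Re (kap * z t0 + h t0) + Im (z t0) * Im (kap * z t0 + h t0)) = 0.
  have D : is_derive t0 (1 : R) N 0.
    apply: (@derive1_at_max _ N (t0 - 1) (t0 + 1)).
    - lra.
    - by move=> t _; have [] := dN t.
    - by rewrite in_itv /=; apply/andP; split; lra.
    - by move=> t _; exact: max.
  by rewrite -(@derive_val _ _ _ _ _ _ _ (dN t0)) (@derive_val _ _ _ _ _ _ _ D).
have H0 : 0 <= H by apply: le_trans (cmod_ge0 _) (hH 0).
have key : `|Re kap| * N t0 <= 2 * (cmod (z t0) * H).
  have -> : `|Re kap| * N t0 = `|Re kap * N t0|.
    by rewrite normrM [in RHS](ger0_norm (x := N t0)) // /N addr_ge0 ?sqr_ge0.
  have -> : Re kap * N t0 = - (Re (z t0) * Re (h t0) + Im (z t0) * Im (h t0)).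
    move: e; rewrite cReD cImD cReM cImM /N => e; lra.
  rewrite normrN (le_trans (ler_normD _ _)) // !normrM mulrDl mul1r.
  rewrite lerD // ler_pM ?normr_ge0 ?cmod_Re ?cmod_Im //.
    exact: le_trans (cmod_Re _) (hH _).
  exact: le_trans (cmod_Im _) (hH _).
have m2 : cmod (z t0) <= 2 / `|Re kap| * H.
  have [z0|z0] := ltrP 0 (cmod (z t0)); last first.
    by apply: (le_trans z0); rewrite mulr_ge0 // divr_ge0.
  move: key; rewrite /N -cmod_sqr expr2 mulrCA (mulrCA 2) ler_pM2l // => key.
  by rewrite mulrAC ler_pdivlMr // mulrC.
move=> t; apply: le_trans m2.
rewrite -(ler_pXn2r (n := 2)) ?nnegrE ?cmod_ge0 // !cmod_sqr.
exact: max.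
Qed.

(** A mean of zero forces the minimum to be nonpositive and the maximum
    nonnegative, so |phi| is at most the oscillation of phi over one period,
    which is at most T B. *)
Lemma mean0_bound T (phi phi' : R -> R) (B : R) : 0 < T ->
  (forall t, is_derive t (1 : R) phi (phi' t)) -> (forall t, phi (t + T) = phi t) ->
  mean T phi = 0 -> (forall t, `|phi' t| <= B) -> forall t, `|phi t| <= 2 * T * B.
Proof.
move=> T0 d per m0 hB.
have c := derive_continuous d.
have B0 : 0 <= B by apply: le_trans (normr_ge0 _) (hB 0).
have close s t : 0 <= t - s <= T -> `|phi t - phi s| <= T * B.
  move=> /andP[]; rewrite subr_ge0 => st tT.
  have cc := @continuous_subspaceT _ _ `[s, t]%classic _ c.
  have [x _ ->] := MVT_segment st (fun x _ => d x) cc.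
  by rewrite normrM mulrC [`|t - s|]ger0_norm ?subr_ge0 // ler_pM // subr_ge0.
have [tm hm] := periodic_bounded T0 c per.
have cN : continuous (fun t => - phi t).
  by move=> t; apply: cvgN; exact: c.
have perN t : - phi (t + T) = - phi t by rewrite per.
have [tl hl] := periodic_bounded T0 cN perN.
have mle (u v : R) : (forall t, u <= phi t) -> (forall t, phi t <= v) -> u <= 0 <= v.
  move=> hu hv; pose w := (v - u) / 2; pose m := (u + v) / 2.
  have cm : continuous (fun t => phi t + - m).
    by move=> t; apply: cvgD; [exact: c|exact: continuous_cst].
  have : `|mean T (fun t => phi t + - m)| <= w.
    apply: mean_le => // t; rewrite ler_norml; apply/andP.
    by have := hu t; have := hv t; rewrite /w /m; split; lra.
  rewrite meanD //; last exact: continuous_cst.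
  rewrite m0 mean_cst // ler_norml /w /m => /andP[h1 h2].
  by apply/andP; split; lra.
have osc : phi tm - phi tl <= T * B.
  have [t' ht' <-] := periodic_window tl tm T0 per.
  exact: le_trans (ler_norm _) (close _ _ ht').
have hl' t : phi tl <= phi t by rewrite -lerN2.
have /andP[l0 u0] := mle (phi tl) (phi tm) hl' hm.
move=> t; have := hm t; have := hl t; rewrite lerN2 => h1 h2.
have TB : 0 <= T * B by rewrite mulr_ge0 // ltW.
by rewrite -mulrA ler_norml; apply/andP; split; lra.
Qed.

(** Near resonance the equation itself gives no control, and the missing
    information is the vanishing of the first Fourier mode. The demodulated s
    = z e^(-iWt) then has mean zero, and its derivative is the forcing plus
    the detuning term i (w - W) s; the bound 16^-1 leaves that term a
    coefficient at most 1/4 in the estimate, so that it can be absorbed. *)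
Lemma periodic_estimate_im (w W : R) T z h H : 0 < T -> W * T = 2 * pi ->
  `|w - W| * T <= 16^-1 ->
  cder z (fun t => 'i%C * w%:C%C * z t + h t) -> (forall t, z (t + T) = z t) ->
  cmean T (fun t => z t * (cis (W * t))^*) = 0 ->
  (forall t, cmod (h t) <= H) -> forall t, cmod (z t) <= 8 * T * H.
Proof.
move=> T0 WT sm d per m0 hH.
pose s t := z t * (cis (W * t))^*.
have ds : cder s (fun t => 'i%C * (w - W)%:C%C * s t + h t * (cis (W * t))^*).
  apply: (cder_ext (cderM d (cderJ (cder_cis W)))) => // t.
  rewrite /s rmorphM rmorphM /= conjCR.
  have -> : ('i%C : R[i])^* = - 'i%C by apply: complexP; rewrite ?cReJ ?cImJ /= ?oppr0.
  rewrite rmorphB /=; move: (cis _)^* => c; ring.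
have smod t : cmod (s t) = cmod (z t) by rewrite cmodM cmodJ cmod_cis mulr1.
have pers t : s (t + T) = s t.
  rewrite /s per mulrDr WT cisD mulr_natl mulr2n cisD cispi mulrNN mulr1.
  by rewrite mulr1.
have cs := cder_cont ds.
have cN : continuous (fun t => cmod (s t)).
  move=> t; rewrite (_ : (fun t => cmod (s t)) = (fun t => Num.sqrt (Re (s t) ^+ 2 + Im (s t) ^+ 2))).
    apply: (continuous_comp (f := fun t => Re (s t) ^+ 2 + Im (s t) ^+ 2)).
      exact: derive_continuous (cder_sqr_mod ds) t.
    exact: sqrt_continuous.
  by apply/funext => u; rewrite cmodE.
have [t0 hB] := periodic_bounded T0 cN (fun t => congr1 (fun z : R[i] => cmod z) (pers t)).
have H0 : 0 <= H by apply: le_trans (cmod_ge0 _) (hH 0).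
move=> t; rewrite -smod; move: t.
have -> : 8 * T * H = 2 * (4 * T * H) by ring.
apply: absorption hB _ => S hS t.
have S0 : 0 <= S by apply: le_trans (cmod_ge0 _) (hS 0).
have ds' u : cmod ('i%C * (w - W)%:C%C * s u + h u * (cis (W * u))^*) <= `|w - W| * S + H.
  rewrite (le_trans (cmodD _ _)) // !cmodM cmodJ cmod_cis cmodC.
  have -> : cmod ('i%C : R[i]) = 1 by rewrite cmodE /= expr0n expr1n add0r sqrtr1.
  by rewrite mul1r !mulr1 -smod; apply: lerD => //; apply: ler_wpM2l.
have [mr mi] : mean T (fun t => Re (s t)) = 0 /\ mean T (fun t => Im (s t)) = 0.
  by have := m0; rewrite /cmean => -[-> ->].
have b1 := mean0_bound T0 (fun t => (ds t).1) (fun t => congr1 (fun z : R[i] => Re z) (pers t)) mr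
   (fun u => le_trans (cmod_Re _) (ds' u)) t.
have b2 := mean0_bound T0 (fun t => (ds t).2) (fun t => congr1 (fun z : R[i] => Im z) (pers t)) mi
   (fun u => le_trans (cmod_Im _) (ds' u)) t.
apply: (le_trans (cmod_le _)); apply: (le_trans (lerD b1 b2)).
have : `|w - W| * T * S <= 16^-1 * S by rewrite ler_wpM2r.
move: (`|w - W|) => x hx.
have -> : 2 * T * (x * S + H) + 2 * T * (x * S + H) = 4 * (x * T * S) + 4 * T * H by ring.
lra.
Qed.

End ScalarEstimate.

(** * Periodic solutions of a linear system near resonance *)

Section LinearEstimate.
Variables (R : realType) (n : nat).
Local Notation vec := ('cV[R[i]]_n.+1).
Implicit Types (A : 'M[R[i]]_n.+1) (r h : R -> vec) (T H W w : R).

Definition vder r (r' : R -> vec) := forall i, cder (fun t => r t i 0) (fun t => r' t i 0).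

Definition mxbound A : R := \sum_i \sum_j cmod (A i j).

Lemma mxbound_ge0 A : 0 <= mxbound A.
Proof. by apply: sumr_ge0 => i _; apply: sumr_ge0 => j _; exact: cmod_ge0. Qed.

Lemma mxbound_mul A (v : vec) H : (forall i, cmod (v i 0) <= H) ->
  forall i, cmod ((A *m v) i 0) <= mxbound A * H.
Proof.
move=> hv i; rewrite mxE (le_trans (cmod_sum _ _)) //.
have H0 : 0 <= H by apply: le_trans (cmod_ge0 _) (hv i).
apply: (@le_trans _ _ ((\sum_j cmod (A i j)) * H)).
  by rewrite mulr_suml; apply: ler_sum => j _; rewrite cmodM ler_wpM2l ?cmod_ge0.
rewrite ler_wpM2r // /mxbound [leRHS](bigD1 i) //= lerDl.
by apply: sumr_ge0 => k _; apply: sumr_ge0 => j _; exact: cmod_ge0.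
Qed.

Lemma vder_mul A r r' : vder r r' -> vder (fun t => A *m r t) (fun t => A *m r' t).
Proof.
move=> d i; apply: (cder_ext (cder_sum (index_enum _) (fun j => cderZ (A i j) (d j)))) => t.
  by rewrite mxE.
by rewrite mxE.
Qed.

Lemma vder_ext r r' s s' : vder r r' -> (forall t, r t = s t) -> (forall t, r' t = s' t) ->
  vder s s'.
Proof. by move=> d /funext <- /funext <-. Qed.

(** Both conditions are imposed because both i w and - i w are eigenvalues:
    these are the two modes that a nearly resonant system amplifies without
    bound. *)
Definition no_first_mode T W r := forall i,
  cmean T (fun t => r t i 0 * (cis (W * t))^*) = 0 /\
  cmean T (fun t => r t i 0 * cis (W * t)) = 0.

Lemma no_first_mode_mul A T W r r' : vder r r' -> no_first_mode T W r ->
  no_first_mode T W (fun t => A *m r t).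
Proof.
move=> d m i.
have c j : ccont (fun t => r t j 0) := cder_cont (d j).
have cc := cder_cont (cder_cis W).
split.
  rewrite (@cmean_ext _ _ _ (fun t => \sum_j A i j * (r t j 0 * (cis (W * t))^*))); last first.
    by move=> t; rewrite mxE mulr_suml; apply: eq_bigr => j _; rewrite mulrA.
  rewrite cmean_sum; last by move=> j; apply/ccontZ/ccontM => //; exact: ccontJ.
  rewrite big1 // => j _; rewrite cmeanZ; last by apply: ccontM => //; exact: ccontJ.
  by rewrite (m j).1 mulr0.
rewrite (@cmean_ext _ _ _ (fun t => \sum_j A i j * (r t j 0 * cis (W * t)))); last first.
  by move=> t; rewrite mxE mulr_suml; apply: eq_bigr => j _; rewrite mulrA.
rewrite cmean_sum; last by move=> j; apply/ccontZ/ccontM.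
rewrite big1 // => j _; rewrite cmeanZ; last exact: ccontM.
by rewrite (m j).2 mulr0.
Qed.

Lemma periodic_estimate_imN w W T (z h : R -> R[i]) H : 0 < T -> W * T = 2 * pi ->
  `|w - W| * T <= 16^-1 ->
  cder z (fun t => - ('i%C * w%:C%C) * z t + h t) -> (forall t, z (t + T) = z t) ->
  cmean T (fun t => z t * cis (W * t)) = 0 ->
  (forall t, cmod (h t) <= H) -> forall t, cmod (z t) <= 8 * T * H.
Proof.
move=> T0 WT sm d per m0 hH t; rewrite -cmodJ.
apply: (@periodic_estimate_im _ w W T (fun t => (z t)^*) (fun t => (h t)^*)) => //.
- apply: (cder_ext (cderJ d)) => // u; rewrite rmorphD rmorphM rmorphN rmorphM /= conjCR.
  have -> : ('i%C : R[i])^* = - 'i%C by apply: complexP; rewrite ?cReJ ?cImJ /= ?oppr0.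
  by rewrite !mulNr opprK.
- by move=> u; rewrite per.
- rewrite (@cmean_ext _ _ _ (fun t => (z t * cis (W * t))^*)); last by move=> u; rewrite rmorphM.
  rewrite cmeanJ; last by apply: ccontM; [exact: cder_cont d|exact: cder_cont (cder_cis W)].
  by rewrite m0 rmorph0.
- by move=> u; rewrite cmodJ.
Qed.

Definition annihilator A (s : seq R[i]) : 'M[R[i]]_n.+1 :=
  foldr (fun k M => M *m (A - k%:M)) 1%:M s.

Lemma annihilatorE A s : annihilator A s = horner_mx A (\prod_(k <- s) ('X - k%:P)).
Proof.
elim: s => [|k s IH]; first by rewrite big_nil rmorph1.
by rewrite big_cons mulrC rmorphM /= IH rmorphB /= horner_mx_X horner_mx_C.
Qed.

Definition stable_or_critical w (k : R[i]) :=
  Re k < 0 \/ k = 'i%C * w%:C%C \/ k = - ('i%C * w%:C%C).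

(** The linear factors of the annihilating polynomial are removed one at a
    time. The vector (A - k) r solves the same system with forcing (A - k) h
    and is annihilated by the remaining factors, hence is already bounded by
    H; each entry of r then solves a scalar equation with coefficient k and a
    forcing of order H. *)
Lemma linear_estimate_ann A w (T1 : R) (s : seq R[i]) : 
  (forall k, k \in s -> stable_or_critical w k) -> exists2 L : R, 0 <= L &
  forall T W r h H, 0 < T -> T <= T1 -> W * T = 2 * pi -> `|w - W| * T <= 16^-1 ->
   vder r (fun t => A *m r t + h t) -> (forall t, r (t + T) = r t) ->
   no_first_mode T W r -> (forall t i, cmod (h t i 0) <= H) ->
   (forall t, annihilator A s *m r t = 0) ->
   forall t i, cmod (r t i 0) <= L * H.
Proof.
elim: s => [|k s IH] hs.
  exists 0 => // T W r h H _ _ _ _ _ _ _ _ r0 t i.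
  by have := r0 t; rewrite mul1mx mul0r => ->; rewrite mxE cmod0.
have [L L0 hL] := IH (fun k' ks => hs k' (mem_behead (s := k :: s) ks)).
(* K dominates the constants of the stable and of the critical scalar
    estimate. *)
pose K := 2 / `|Re k| + 8 * `|T1|.
have K0 : 0 <= K by rewrite addr_ge0 // ?mulr_ge0 // divr_ge0.
exists (K * (L * mxbound (A - k%:M) + 1)).
  by rewrite mulr_ge0 // addr_ge0 // mulr_ge0 // mxbound_ge0.
move=> T W r h H T0 TT1 WT sm d per m hH ann t i.
have H0 : 0 <= H by apply: le_trans (cmod_ge0 _) (hH 0 i).
have hv1 : forall t i, cmod (((A - k%:M) *m r t) i 0) <= L * (mxbound (A - k%:M) * H).
  apply: (hL T W _ (fun t => (A - k%:M) *m h t)) => //.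
  - apply: (vder_ext (vder_mul (A - k%:M) d)) => // u.
    by rewrite mulmxDr !mulmxA mulmxBl mulmxBr scalar_mxC.
  - by move=> u; rewrite per.
  - exact: no_first_mode_mul d m.
  - by move=> u; exact: mxbound_mul.
  - by move=> u; rewrite mulmxA; exact: ann.
pose g t := ((A - k%:M) *m r t) i 0 + h t i 0.
have hg u : cmod (g u) <= (L * mxbound (A - k%:M) + 1) * H.
  rewrite /g (le_trans (cmodD _ _)) // mulrDl mul1r lerD //.
  by rewrite -mulrA.
have dz : cder (fun t => r t i 0) (fun t => k * r t i 0 + g t).
  apply: (cder_ext (d i)) => // u.
  by rewrite /g mulmxBl mul_scalar_mx !mxE -addrA addrCA addrA [in LHS]addrC; ring.
have perz u : r (u + T) i 0 = r u i 0 by rewrite per.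
have big : forall X, X <= K -> X * ((L * mxbound (A - k%:M) + 1) * H) <=
    K * (L * mxbound (A - k%:M) + 1) * H.
  move=> X XK; rewrite -mulrA ler_wpM2r // mulr_ge0 // addr_ge0 // mulr_ge0 //.
  exact: mxbound_ge0.
have T8 : 8 * T <= K.
  have : 8 * T <= 8 * `|T1| by rewrite ler_pM2l // (le_trans TT1) // ler_norm.
  by move=> /le_trans; apply; rewrite lerDr divr_ge0.
case: (hs k (mem_head _ _)) => [rk|[kE|kE]].
- apply: le_trans (big (2 / `|Re k|) _); last by rewrite lerDl mulr_ge0.
  apply: (periodic_estimate_re T0 _ dz) => //.
  by rewrite normr_gt0 lt_eqF.
- apply: le_trans (big _ T8).
  rewrite kE in dz; exact: (periodic_estimate_im T0 WT sm dz perz (m i).1 hg).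
- apply: le_trans (big _ T8).
  rewrite kE in dz; exact: (periodic_estimate_imN T0 WT sm dz perz (m i).2 hg).
Qed.

(** By the Cayley-Hamilton theorem the characteristic polynomial serves as
    annihilating polynomial for every r. The perturbation D r counts as
    forcing, and is absorbed since it costs at most half of the supremum of
    r. *)
Lemma linear_estimate A w (T1 : R) :
  (forall k, root (char_poly A) k -> stable_or_critical w k) -> exists2 L : R, 0 < L &
  forall T W (D : 'M[R[i]]_n.+1) r h H, 0 < T -> T <= T1 -> W * T = 2 * pi ->
   `|w - W| * T <= 16^-1 -> L * mxbound D <= 2^-1 ->
   vder r (fun t => A *m r t + (D *m r t + h t)) -> (forall t, r (t + T) = r t) ->
   no_first_mode T W r -> (forall t i, cmod (h t i 0) <= H) ->
   forall t i, cmod (r t i 0) <= 2 * (L * H).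
Proof.
move=> hk.
have [s sE] := closed_field_poly_normal (char_poly A).
rewrite (monicP (char_poly_monic A)) scale1r in sE.
have ann : annihilator A s = 0 by rewrite annihilatorE -sE Cayley_Hamilton.
have hs k : k \in s -> stable_or_critical w k.
  by move=> ks; apply: hk; rewrite sE root_prod_XsubC.
have [L L0 hL] := @linear_estimate_ann A w T1 s hs.
exists (L + 1); first by rewrite ltr_wpDl.
move=> T W D r h H T0 TT1 WT sm LD d per m hH.
have H0 : 0 <= H by apply: le_trans (cmod_ge0 _) (hH 0 0).
have bnd : exists B, forall x : R * 'I_n.+1, cmod (r x.1 x.2 0) <= B.
  have one i : exists B, forall t, cmod (r t i 0) <= B.
    have c : continuous (fun t => Re (r t i 0) ^+ 2 + Im (r t i 0) ^+ 2).
      exact: derive_continuous (cder_sqr_mod (d i)).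
    have [t0 ht0] := periodic_bounded T0 c (fun t => congr1
      (fun v : vec => Re (v i 0) ^+ 2 + Im (v i 0) ^+ 2) (per t)).
    by exists (cmod (r t0 i 0)) => t; rewrite !cmodE ler_wsqrtr.
  pose B i := sval (cid (one i)).
  have hB i t : cmod (r t i 0) <= B i by rewrite /B; case: cid.
  exists (\sum_i B i) => -[t i] /=; apply: (le_trans (hB i t)).
  rewrite (bigD1 i) //= lerDl; apply: sumr_ge0 => j _.
  exact: le_trans (cmod_ge0 _) (hB j 0).
have [B hB] := bnd.
suff main : forall x : R * 'I_n.+1, cmod (r x.1 x.2 0) <= 2 * ((L + 1) * H).
  by move=> t i; exact: (main (t, i)).
apply: absorption hB _ => S hS [t i] /=.
have S0 : 0 <= S by apply: le_trans (cmod_ge0 _) (hS (0, 0)).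
have hS' u j : cmod ((D *m r u + h u) j 0) <= mxbound D * S + H.
  rewrite mxE (le_trans (cmodD _ _)) // lerD //.
  by apply: mxbound_mul => k; exact: (hS (u, k)).
have ann' u : annihilator A s *m r u = 0 by rewrite ann mul0mx.
apply: (le_trans (hL T W r _ _ T0 TT1 WT sm d per m hS' ann' t i)).
rewrite mulrDr lerD //; last by rewrite ler_wpM2r // lerDl.
rewrite mulrA mulrC ler_wpM2l //; apply: le_trans LD.
by rewrite ler_wpM2r ?mxbound_ge0 // lerDl.
Qed.

End LinearEstimate.

(** * Fourier modes *)

Section FourierModes.
Variables (R : realType) (n : nat).
Local Notation vec := ('cV[R[i]]_n.+1).

Lemma cmean_cis (T V : R) : 0 < T -> V != 0 -> cis (V * T) = 1 ->
  cmean T (fun t => cis (V * t)) = 0.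
Proof.
move=> T0 V0 e.
have d := cder_cis V.
have c := cder_cont d.
have : cmean T (fun t => 'i%C * V%:C%C * cis (V * t)) = 0.
  by apply: (cmean_der T0 d); [exact: ccontZ|rewrite mulr0 cis0].
rewrite cmeanZ // => /eqP; rewrite mulf_eq0 => /orP[|/eqP //].
rewrite mulf_eq0 !eq_complex /= eqxx oner_eq0 /= andbT => /eqP V0'.
by rewrite V0' eqxx in V0.
Qed.

Lemma cis_nat (T W : R) (m : nat) : W * T = 2 * pi -> cis (m%:R * W * T) = 1.
Proof.
move=> WT; elim: m => [|m IH]; first by rewrite !mul0r cis0.
rewrite -mulrA -natr1 mulrDl cisD mulrA IH !mul1r WT mulr_natl mulr2n cisD cispi.
by rewrite mulrNN mulr1.
Qed.

(** The frequencies 2, 0, -2 and -4 are those produced by products of two or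
    three first modes in the balances of the modes 0, 1 and 2. *)
Lemma cmean_trig (T W : R) (c2 c0 d2 d4 : R[i]) : 0 < T -> W * T = 2 * pi ->
  cmean T (fun t => c2 * cis (W * t) ^+ 2 + c0 + d2 * (cis (W * t))^* ^+ 2
     + d4 * (cis (W * t))^* ^+ 4) = c0.
Proof.
move=> T0 WT.
have W0 : W != 0.
  apply/eqP => W0; move: WT; rewrite W0 mul0r => /eqP; rewrite eq_sym mulf_eq0.
  by rewrite pnatr_eq0 /= gt_eqF // pi_gt0.
have ck m : ccont (fun t => cis (m * W * t)) by exact: cder_cont (cder_cis _).
have e2 t : cis (W * t) ^+ 2 = cis (2%:R * W * t).
  by rewrite -mulrA mulr_natl mulr2n cisD expr2.
have e4 t : cis (W * t) ^+ 4 = cis (4%:R * W * t).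
  have -> : 4%:R * W * t = 2%:R * W * t + 2%:R * W * t by ring.
  by rewrite cisD -e2 -exprD.
rewrite (@cmean_ext _ _ _ (fun t => c2 * cis (2%:R * W * t) + c0 +
   d2 * (cis (2%:R * W * t))^* + d4 * (cis (4%:R * W * t))^*)); last first.
  by move=> t; rewrite -!rmorphXn /= e2 e4.
have z m : m%:R != 0 :> R -> cmean T (fun t => cis (m%:R * W * t)) = 0.
  by move=> m0; apply: cmean_cis => //; [rewrite mulf_neq0|exact: cis_nat].
have c1 := ccontZ c2 (ck 2%:R); have c3 := ccont_cst c0.
have c4 := ccontZ d2 (ccontJ (ck 2%:R)); have c5 := ccontZ d4 (ccontJ (ck 4%:R)).
rewrite cmeanD ?cmeanD ?cmeanZ ?cmeanJ ?cmean_cst // ?z ?pnatr_eq0 //;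
  do ?[exact: ccontJ|exact: ccontD|apply: ccontD => //; exact: ccontD].
by rewrite rmorph0 !mulr0 add0r !addr0.
Qed.

Definition vmode (T : R) (chi : R -> R[i]) (r : R -> vec) : vec :=
  \col_i cmean T (fun t => r t i 0 * chi t).

(** The derivative of r chi has mean zero over a period. For chi a power of
    e^(-iWt) this is the balance of one harmonic. *)
Lemma vmode_eq (A D : 'M[R[i]]_n.+1) (T : R) (s : R[i]) chi r (h : R -> vec) : 0 < T ->
  vder r (fun t => A *m r t + (D *m r t + h t)) -> (forall i, ccont (fun t => h t i 0)) ->
  (forall t, r (t + T) = r t) ->
  cder chi (fun t => s * chi t) -> chi T = chi 0 ->
  A *m vmode T chi r + (D *m vmode T chi r + vmode T chi h) + s *: vmode T chi r = 0.
Proof.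
move=> T0 d ch per dchi echi; apply/colP => i.
have cr j := cder_cont (d j); have cc := cder_cont dchi.
have crc j : ccont (fun t => r t j 0 * chi t) by exact: ccontM.
have cmx (B : 'M[R[i]]_n.+1) : ccont (fun t => (B *m r t) i 0 * chi t) /\
    cmean T (fun t => (B *m r t) i 0 * chi t) = (B *m vmode T chi r) i 0.
  have E t : \sum_j B i j * (r t j 0 * chi t) = (B *m r t) i 0 * chi t.
    by rewrite mxE mulr_suml; apply: eq_bigr => j _; rewrite mulrA.
  have c : ccont (fun t => \sum_j B i j * (r t j 0 * chi t)).
    by apply: ccont_sum => j; exact: ccontZ.
  split; first exact: ccont_ext c E.
  rewrite -(cmean_ext T E) cmean_sum; last by move=> j; exact: ccontZ.
  by rewrite mxE; apply: eq_bigr => j _; rewrite cmeanZ // mxE.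
have [cA eA] := cmx A; have [cD eD] := cmx D.
have chc : ccont (fun t => h t i 0 * chi t) by exact: ccontM.
have dd := cderM (d i) dchi.
have m0 : cmean T (fun t => ((A *m r t) i 0 * chi t + ((D *m r t) i 0 * chi t + h t i 0 * chi t))
    + s * (r t i 0 * chi t)) = 0.
  apply: (@cmean_der _ T (fun t => r t i 0 * chi t)) => //.
  - apply: (cder_ext dd) => // t; rewrite !mxE; ring.
  - by apply: ccontD; [apply: ccontD => //; exact: ccontD|exact: ccontZ].
  - by rewrite -[T]add0r per add0r echi.
rewrite !mxE -[RHS]m0 cmeanD; [|by apply: ccontD => //; exact: ccontD|exact: ccontZ].
rewrite cmeanD //; last exact: ccontD.
rewrite [cmean T (fun t => _ + h t i 0 * chi t)]cmeanD // cmeanZ //.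
by rewrite eA eD !mxE.
Qed.

End FourierModes.

(** * Families of vectors, inner product and multilinear forms *)

Section VectorFamilies.
Variables (R : realType) (n : nat) (F : set_system R).
Context {FF : Filter F}.
Local Notation vec := ('cV[R[i]]_n.+1).
Implicit Types (v : R -> R -> vec) (g : R -> R).

Definition vbO g v := forall i, bO F g (fun a t => v a t i 0).

Lemma vbO_unif g v : vbO g v -> exists2 C : R, 0 < C &
  \forall a \near F, forall t i, cmod (v a t i 0) <= C * `|g a|.
Proof.
move=> hv.
have H i : exists2 C : R, 0 < C & \forall a \near F, forall t,
    cmod (v a t i 0) <= C * `|g a| by exact: bO_pos.
pose C i := sval (cid2 (H i)).
have C0 i : 0 < C i by rewrite /C; case: cid2.
have hC : \forall a \near F, forall i t, cmod (v a t i 0) <= C i * `|g a|.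
  by apply: filter_forall => i; rewrite /C; case: cid2.
exists (\sum_i C i).
  rewrite (bigD1 ord0) //= ltr_pwDl // sumr_ge0 // => j _; exact: ltW.
apply: filterS hC => a h t i; apply: (le_trans (h i t)).
rewrite ler_wpM2r // (bigD1 i) //= lerDl sumr_ge0 // => j _; exact: ltW.
Qed.

Lemma vbO_of_unif g v (C : R) :
  (\forall a \near F, forall t i, cmod (v a t i 0) <= C * `|g a|) -> vbO g v.
Proof. by move=> h i; exists C; apply: filterS h. Qed.

Lemma vbO_mul g (B : 'M[R[i]]_n.+1) v : vbO g v -> vbO g (fun a t => B *m v a t).
Proof.
move=> hv i; apply: (@bO_eq _ _ _ _ _ (fun a t => \sum_j B i j * v a t j 0)).
  by move=> a t; rewrite mxE.
by apply: bO_sum => j; apply: bO_scale; exact: hv.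
Qed.

Lemma vbO_mulf g g' (D : R -> 'M[R[i]]_n.+1) v :
  (forall i j, bO F g' (fun a (_ : R) => D a i j)) -> vbO g v ->
  vbO (fun a => g' a * g a) (fun a t => D a *m v a t).
Proof.
move=> hD hv i; apply: (@bO_eq _ _ _ _ _ (fun a t => \sum_j D a i j * v a t j 0)).
  by move=> a t; rewrite mxE.
by apply: bO_sum => j; apply: bO_mul; [exact: hD|exact: hv].
Qed.

Lemma vbO_add g v v' : vbO g v -> vbO g v' -> vbO g (fun a t => v a t + v' a t).
Proof.
move=> h h' i; apply: (@bO_eq _ _ _ _ _ (fun a t => v a t i 0 + v' a t i 0)).
  by move=> a t; rewrite mxE.
exact: bO_add (h i) (h' i).
Qed.

Lemma vbO_opp g v : vbO g v -> vbO g (fun a t => - v a t).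
Proof.
move=> h i; apply: (@bO_eq _ _ _ _ _ (fun a t => - v a t i 0)).
  by move=> a t; rewrite mxE.
exact: bO_opp.
Qed.

Lemma vbO_scale g g' (c : R -> R -> R[i]) v : bO F g' c -> vbO g v ->
  vbO (fun a => g' a * g a) (fun a t => c a t *: v a t).
Proof.
move=> hc h i; apply: (@bO_eq _ _ _ _ _ (fun a t => c a t * v a t i 0)).
  by move=> a t; rewrite mxE.
exact: bO_mul.
Qed.

Lemma vbO_gauge g g' v : (\forall a \near F, `|g a| <= `|g' a|) -> vbO g v -> vbO g' v.
Proof. by move=> gg h i; exact: bO_gauge gg (h i). Qed.

Lemma vbO_near g v v' : (\forall a \near F, forall t, v a t = v' a t) -> vbO g v -> vbO g v'.
Proof. by move=> e h i; apply: bO_near (h i); apply: filterS e => a e t; rewrite e. Qed.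

Lemma bO_inner g (p : vec) v : vbO g v -> bO F g (fun a t => inner p (v a t)).
Proof.
by move=> h; apply: bO_sum => j; apply: bO_scale; exact: h.
Qed.

Lemma bO_cmean (T : R -> R) g (h : R -> R -> R[i]) : (\forall a \near F, 0 < T a) ->
  (\forall a \near F, ccont (h a)) -> bO F g h ->
  bO F g (fun a (_ : R) => cmean (T a) (h a)).
Proof.
move=> hT hc [C hC]; exists (2 * C).
apply: filterS3 hT hc hC => a T0 c b _; rewrite -mulrA; exact: cmean_le.
Qed.

Lemma vder_modes (r r' : R -> vec) (x x' y y' : R -> R[i]) (u v : vec) :
  vder r r' -> cder x x' -> cder y y' ->
  vder (fun t => r t - (x t *: u + y t *: v)) (fun t => r' t - (x' t *: u + y' t *: v)).
Proof.
move=> dr dx dy i.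
have d1 := cderM dx (cder_cst (u i 0)).
have d2 := cderM dy (cder_cst (v i 0)).
apply: (cder_ext (cderB (dr i) (cderD d1 d2))) => t; rewrite !mxE //.
by rewrite !mulr0 !addr0.
Qed.

End VectorFamilies.

Section InnerProduct.
Variables (R : realType) (n : nat).
Implicit Types (p u v : 'cV[R[i]]_n).

Lemma innerD p u v : inner p (u + v) = inner p u + inner p v.
Proof. by rewrite /inner -big_split; apply: eq_bigr => j _; rewrite mxE mulrDr. Qed.

Lemma innerZ p u (c : R[i]) : inner p (c *: u) = c * inner p u.
Proof. by rewrite /inner mulr_sumr; apply: eq_bigr => j _; rewrite mxE mulrCA. Qed.

Lemma innerN p u : inner p (- u) = - inner p u.
Proof. by rewrite -scaleN1r innerZ mulN1r. Qed.

Lemma innerB p u v : inner p (u - v) = inner p u - inner p v.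
Proof. by rewrite innerD innerN. Qed.

Lemma innerE p u : (map_mx (fun z : R[i] => z^*) p)^T *m u = (inner p u)%:M.
Proof.
apply/matrixP => i j; rewrite !ord1 !mxE mulr1n.
by apply: eq_bigr => k _; rewrite !mxE.
Qed.

Lemma inner_left_eigen (A : 'M[R[i]]_n) p (l : R[i]) u :
  map_mx (fun z : R[i] => z^*) A = A -> p^T *m A = l^* *: p^T ->
  inner p (A *m u) = l * inner p u.
Proof.
move=> Aj h.
have h' : (map_mx (fun z : R[i] => z^*) p)^T *m A = l *: (map_mx (fun z : R[i] => z^*) p)^T.
  have := congr1 (map_mx (fun z : R[i] => z^*)) h.
  by rewrite map_mxM Aj map_mxZ /= conjCK map_trmx.
have /matrixP/(_ 0 0) : (inner p (A *m u))%:M = (l * inner p u)%:M :> 'M[R[i]]_1.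
  by rewrite -!innerE mulmxA h' -scalemxAl innerE scale_scalar_mx.
by rewrite !mxE !mulr1n.
Qed.

End InnerProduct.

Section Forms.
Variables (R : realType) (n : nat).
Local Notation vec := ('cV[R[i]]_n).

(** The contraction of [Btensor], for an arbitrary array of coefficients. *)
Definition Bform (b : 'I_n -> 'I_n -> 'I_n -> R[i]) (x y : vec) : vec :=
  \col_m \sum_j \sum_k b m j k * x k 0 * y j 0.

Definition Cform (c : 'I_n -> 'I_n -> 'I_n -> 'I_n -> R[i]) (x y u : vec) : vec :=
  \col_m \sum_j \sum_k \sum_l c m j k l * x k 0 * y j 0 * u l 0.

Lemma cmean_Bform b T (x y : R -> vec) (chi : R -> R[i]) m :
  (forall i, ccont (fun t => x t i 0)) -> (forall i, ccont (fun t => y t i 0)) ->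
  ccont chi -> cmean T (fun t => Bform b (x t) (y t) m 0 * chi t) =
  \sum_j \sum_k b m j k * cmean T (fun t => x t k 0 * y t j 0 * chi t).
Proof.
move=> cx cy cc.
have c1 j k : ccont (fun t => x t k 0 * y t j 0 * chi t) by do 2?[apply: ccontM].
rewrite (@cmean_ext _ _ _ (fun t => \sum_j \sum_k b m j k * (x t k 0 * y t j 0 * chi t))).
  rewrite cmean_sum; last by move=> j; apply: ccont_sum => k; exact: ccontZ.
  apply: eq_bigr => j _; rewrite cmean_sum; last by move=> k; exact: ccontZ.
  by apply: eq_bigr => k _; rewrite cmeanZ.
move=> t; rewrite mxE mulr_suml; apply: eq_bigr => j _; rewrite mulr_suml.
by apply: eq_bigr => k _; rewrite !mulrA.
Qed.

Lemma cmean_Cform c T (x y u : R -> vec) (chi : R -> R[i]) m :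
  (forall i, ccont (fun t => x t i 0)) -> (forall i, ccont (fun t => y t i 0)) ->
  (forall i, ccont (fun t => u t i 0)) ->
  ccont chi -> cmean T (fun t => Cform c (x t) (y t) (u t) m 0 * chi t) =
  \sum_j \sum_k \sum_l c m j k l * cmean T (fun t => x t k 0 * y t j 0 * u t l 0 * chi t).
Proof.
move=> cx cy cu cc.
have c1 j k l : ccont (fun t => x t k 0 * y t j 0 * u t l 0 * chi t) by do 3?[apply: ccontM].
rewrite (@cmean_ext _ _ _ (fun t => \sum_j \sum_k \sum_l
    c m j k l * (x t k 0 * y t j 0 * u t l 0 * chi t))).
  rewrite cmean_sum; last by move=> j; do 2!apply: ccont_sum => ?; exact: ccontZ.
  apply: eq_bigr => j _; rewrite cmean_sum; last by move=> k; apply: ccont_sum => l; exact: ccontZ.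
  apply: eq_bigr => k _; rewrite cmean_sum; last by move=> l; exact: ccontZ.
  by apply: eq_bigr => l _; rewrite cmeanZ.
move=> t; rewrite mxE mulr_suml; apply: eq_bigr => j _; rewrite mulr_suml.
apply: eq_bigr => k _; rewrite mulr_suml.
by apply: eq_bigr => l _; rewrite !mulrA.
Qed.

Lemma Bform_cont b (x y : R -> vec) m :
  (forall i, ccont (fun t => x t i 0)) -> (forall i, ccont (fun t => y t i 0)) ->
  ccont (fun t => Bform b (x t) (y t) m 0).
Proof.
move=> cx cy; apply: (@ccont_ext _ (fun t => \sum_j \sum_k b m j k * (x t k 0 * y t j 0))).
  by do 2!apply: ccont_sum => ?; apply: ccontZ; exact: ccontM.
by move=> t; rewrite mxE; do 2!apply: eq_bigr => ? _; rewrite mulrA.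
Qed.

Lemma Cform_cont c (x y u : R -> vec) m :
  (forall i, ccont (fun t => x t i 0)) -> (forall i, ccont (fun t => y t i 0)) ->
  (forall i, ccont (fun t => u t i 0)) ->
  ccont (fun t => Cform c (x t) (y t) (u t) m 0).
Proof.
move=> cx cy cu; apply: (@ccont_ext _ (fun t => \sum_j \sum_k \sum_l c m j k l *
   (x t k 0 * y t j 0 * u t l 0))).
  by do 3!apply: ccont_sum => ?; apply: ccontZ; do 2?[apply: ccontM].
by move=> t; rewrite mxE; do 3!apply: eq_bigr => ? _; rewrite !mulrA.
Qed.

End Forms.

Section FormFamilies.
Variables (R : realType) (n : nat) (F : set_system R).
Context {FF : Filter F}.
Implicit Types (v x y u : R -> R -> 'cV[R[i]]_n.+1) (g : R -> R).

Lemma vbO_Bform b g g' x y : vbO F g x -> vbO F g' y ->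
  vbO F (fun a => g a * g' a) (fun a t => Bform b (x a t) (y a t)).
Proof.
move=> hx hy m; apply: (@bO_eq _ _ _ _ _ (fun a t => \sum_j \sum_k b m j k * (x a t k 0 * y a t j 0))).
  by move=> a t; rewrite mxE; do 2!apply: eq_bigr => ? _; rewrite mulrA.
by do 2!apply: bO_sum => ?; apply: bO_scale; exact: bO_mul.
Qed.

Lemma vbO_Cform c g g' g'' x y u : vbO F g x -> vbO F g' y -> vbO F g'' u ->
  vbO F (fun a => g a * g' a * g'' a) (fun a t => Cform c (x a t) (y a t) (u a t)).
Proof.
move=> hx hy hu m; apply: (@bO_eq _ _ _ _ _ (fun a t => \sum_j \sum_k \sum_l
   c m j k l * (x a t k 0 * y a t j 0 * u a t l 0))).
  by move=> a t; rewrite mxE; do 3!apply: eq_bigr => ? _; rewrite !mulrA.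
by do 3!apply: bO_sum => ?; apply: bO_scale; apply: bO_mul => //; exact: bO_mul.
Qed.

End FormFamilies.

(** * Harmonic balance of a small oscillation *)

(** An oscillation splits into a part o that changes sign and a part e that is
    unchanged when time is shifted by half a period; Fo and Fe are the
    nonlinear terms of the corresponding parity, and D is the deviation of the
    matrix from a fixed A. The last field says that M is no larger than the
    actual size of the oscillation. *)
Record oscillation (R : realType) (n : nat) (A D : 'M[R[i]]_n.+1) (T W M : R)
    (o e Fo Fe : R -> 'cV[R[i]]_n.+1) : Prop := Oscillation {
  osc_T : 0 < T;
  osc_W : W * T = 2 * pi;
  osc_M : 0 < M;
  osc_o : vder o (fun t => A *m o t + (D *m o t + Fo t));
  osc_e : vder e (fun t => A *m e t + (D *m e t + Fe t));
  osc_odd : forall t, o (t + T / 2) = - o t;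
  osc_even : forall t, e (t + T / 2) = e t;
  osc_real : forall t i, (o t i 0)^* = o t i 0;
  osc_cFo : forall i, ccont (fun t => Fo t i 0);
  osc_cFe : forall i, ccont (fun t => Fe t i 0);
  osc_min : forall B, (forall t i, cmod (o t i 0) + cmod (e t i 0) <= B) -> M <= B
}.

Section HarmonicBalance.
Variables (R : realType) (n : nat) (F : set_system R).
Context {FF : Filter F}.
Local Notation vec := ('cV[R[i]]_n.+1).
Variables (A : 'M[R[i]]_n.+1) (w : R) (D : R -> 'M[R[i]]_n.+1) (T W M de : R -> R).
Variables (o e Fo Fe : R -> R -> vec).
Hypothesis w_gt0 : 0 < w.
Hypothesis spectrum : forall k, root (char_poly A) k -> stable_or_critical w k.
Hypothesis osc : \forall a \near F,
  oscillation A (D a) (T a) (W a) (M a) (o a) (e a) (Fo a) (Fe a).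
Hypothesis de_ge0 : \forall a \near F, 0 <= de a.
Hypothesis M_small : forall x : R, 0 < x -> \forall a \near F, M a < x.
Hypothesis de_small : forall x : R, 0 < x -> \forall a \near F, de a < x.
Hypothesis W_near : forall x : R, 0 < x -> \forall a \near F, `|W a - w| < x.
Hypothesis bO_D : forall i j, bO F de (fun a (_ : R) => D a i j).
Hypothesis bO_o : vbO F M o.

(** Common order of all relative corrections: M^2 from the nonlinearity, de
    from the change of the matrix. *)
Let kap a := M a ^+ 2 + de a.
Let E a t := cis (W a * t).

Lemma gauges_good : \forall a \near F, [/\ 0 < M a, M a <= 1, 0 <= de a & de a <= 1].
Proof.
near=> a; split.
- by near: a; apply: filterS osc => a; case.
- by apply: ltW; near: a; exact: M_small.
- by near: a.
- by apply: ltW; near: a; exact: de_small.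
Unshelve. all: by end_near. Qed.

Lemma gauge_le (g g' : R -> R) :
  (forall a, 0 < M a -> M a <= 1 -> 0 <= de a -> de a <= 1 -> 0 <= g a <= g' a) ->
  \forall a \near F, `|g a| <= `|g' a|.
Proof.
move=> h; apply: filterS gauges_good => a [M0 M1 d0 d1].
have /andP[g0 gg] := h a M0 M1 d0 d1.
by rewrite !ger0_norm // (le_trans g0).
Qed.

Lemma osc_periodic : \forall a \near F,
  (forall t, o a (t + T a) = o a t) /\ (forall t, e a (t + T a) = e a t).
Proof.
apply: filterS osc => a [] _ _ _ _ _ h h' _ _ _ _; split => t.
  by rewrite [T a]splitr addrA !h opprK.
by rewrite [T a]splitr addrA !h'.
Qed.

Lemma W_ok : \forall a \near F, `|w - W a| * T a <= 16^-1 /\ T a <= 4 * pi / w.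
Proof.
have pi0 := pi_gt0 R.
have p64 : 0 < 64 * pi :> R by rewrite mulr_gt0.
near=> a.
have [T0 WT _ _ _ _ _ _ _ _ _] : oscillation A (D a) (T a) (W a) (M a) (o a) (e a) (Fo a) (Fe a).
  by near: a.
have w2 : `|W a - w| < w / 2 by near: a; apply: W_near; rewrite divr_gt0.
have w3 : `|W a - w| < w / (64 * pi).
  by near: a; apply: W_near; rewrite divr_gt0.
have T1 : T a <= 4 * pi / w.
  rewrite ler_pdivlMr //.
  have : w / 2 <= W a by move: w2; rewrite ltr_norml => /andP[h _]; lra.
  by move=> h; have : w / 2 * T a <= W a * T a; [rewrite ler_wpM2r // ltW|rewrite WT; lra].
split => //; rewrite distrC.
have : `|W a - w| * T a <= w / (64 * pi) * (4 * pi / w).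
  by apply: ler_pM => //; [exact: ltW|exact: ltW].
have -> : w / (64 * pi) * (4 * pi / w) = 16^-1; last by [].
have w0 : w != 0 by rewrite gt_eqF.
have p0 : pi != 0 :> R by rewrite gt_eqF.
move: p0; move: (pi : R) => P P0.
by field; rewrite w0 P0.
Unshelve. all: by end_near. Qed.

Lemma sum_ord_const (c : R) : \sum_(i < n.+1) c = c * n.+1%:R.
Proof. by rewrite sumr_const card_ord mulr_natr. Qed.

Lemma D_small (L : R) : 0 < L -> \forall a \near F, L * mxbound (D a) <= 2^-1.
Proof.
move=> L0.
have H i j : \forall a \near F, cmod (D a i j) <= (2 * L * n.+1%:R * n.+1%:R)^-1.
  have [C C0 hC] := bO_pos (bO_D i j).
  have x0 : 0 < (2 * L * n.+1%:R * n.+1%:R)^-1 / C.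
    by rewrite divr_gt0 // invr_gt0 !mulr_gt0.
  near=> a; have h : forall s : R, cmod (D a i j) <= C * `|de a| by near: a.
  apply: (le_trans (h 0)).
  have d0 : 0 <= de a by near: a.
  have d1 : de a < (2 * L * n.+1%:R * n.+1%:R)^-1 / C by near: a; exact: de_small.
  by rewrite ger0_norm // mulrC -ler_pdivlMr // ltW.
have : \forall a \near F, forall ij : 'I_n.+1 * 'I_n.+1,
    cmod (D a ij.1 ij.2) <= (2 * L * n.+1%:R * n.+1%:R)^-1.
  by apply: filter_forall => -[i j]; exact: H.
apply: filterS => a h; rewrite mulrC -ler_pdivlMr //.
have n0 : 0 < n.+1%:R :> R by [].
rewrite /mxbound.
apply: (@le_trans _ _ (\sum_(i < n.+1) \sum_(j < n.+1) (2 * L * n.+1%:R * n.+1%:R)^-1)).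
  by apply: ler_sum => i _; apply: ler_sum => j _; exact: (h (i, j)).
under eq_bigr do rewrite sum_ord_const.
rewrite sum_ord_const.
move: n0; move: (n.+1%:R : R) => N N0.
have L0' : L != 0 by rewrite gt_eqF.
have N0' : N != 0 by rewrite gt_eqF.
have -> : (2 * L * N * N)^-1 * N * N = 2^-1 / L by field; rewrite ?L0' ?N0'.
by [].
Unshelve. all: by end_near. Qed.

(** The constant of [linear_estimate] depends on A and on a bound for the
    period only, hence is uniform along the filter. *)
Lemma periodic_bO (g : R -> R) (r h : R -> R -> vec) :
  (\forall a \near F, [/\ vder (r a) (fun t => A *m r a t + (D a *m r a t + h a t)),
     forall t, r a (t + T a) = r a t & no_first_mode (T a) (W a) (r a)]) ->
  vbO F g h -> vbO F g r.
Proof.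
move=> hr /vbO_unif[C C0 hC].
have [L L0 hL] := linear_estimate (4 * pi / w) spectrum.
apply: (@vbO_of_unif _ _ _ _ _ _ (2 * (L * C))).
near=> a => t i.
have [T0 WT _ _ _ _ _ _ _ _ _] : oscillation A (D a) (T a) (W a) (M a) (o a) (e a) (Fo a) (Fe a).
  by near: a.
have [sm TT] : `|w - W a| * T a <= 16^-1 /\ T a <= 4 * pi / w by near: a; exact: W_ok.
have [d per m] : [/\ vder (r a) (fun t => A *m r a t + (D a *m r a t + h a t)),
     forall t, r a (t + T a) = r a t & no_first_mode (T a) (W a) (r a)] by near: a.
have LD : L * mxbound (D a) <= 2^-1 by near: a; exact: D_small.
have hh : forall t i, cmod (h a t i 0) <= C * `|g a| by near: a.
rewrite -!mulrA; exact: hL LD d per m hh t i.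
Unshelve. all: by end_near. Qed.

(** Over half a period e is unchanged while e^(iWt) changes sign. *)
Lemma even_no_first_mode : \forall a \near F, no_first_mode (T a) (W a) (e a).
Proof.
apply: filterS osc => a [] T0 WT _ _ de' _ ev _ _ _ _ i.
have c := cder_cont (de' i); have cc := cder_cont (cder_cis (W a)).
have h t : cis (W a * (t + T a / 2)) = - cis (W a * t).
  by rewrite mulrDr mulrA WT mulrAC mulfV // mul1r cisD cispi mulrN1.
split; apply: cmean_antiperiodic => //.
- by apply: ccontM => //; exact: ccontJ.
- by move=> t; rewrite ev h rmorphN mulrN.
- exact: ccontM.
- by move=> t; rewrite ev h mulrN.
Qed.

Lemma even_small : vbO F (fun a => M a ^+ 2) Fe -> vbO F (fun a => M a ^+ 2) e.
Proof.
apply: periodic_bO.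
near=> a; split.
- have : oscillation A (D a) (T a) (W a) (M a) (o a) (e a) (Fo a) (Fe a) by near: a.
  by case.
- have [] : (forall t, o a (t + T a) = o a t) /\ (forall t, e a (t + T a) = e a t) by near: a; exact: osc_periodic.
  by [].
- by near: a; exact: even_no_first_mode.
Unshelve. all: by end_near. Qed.

Lemma osc_cont : \forall a \near F, [/\ forall i, ccont (fun t => o a t i 0),
  forall i, ccont (fun t => e a t i 0), forall i, ccont (fun t => Fo a t i 0),
  forall i, ccont (fun t => Fe a t i 0) & ccont (E a)].
Proof.
apply: filterS osc => a [] _ _ _ do_ de_ _ _ _ cFo cFe _; split => //.
- by move=> i; exact: cder_cont (do_ i).
- by move=> i; exact: cder_cont (de_ i).
- exact: cder_cont (cder_cis (W a)).
Qed.

Lemma near_T : \forall a \near F, 0 < T a.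
Proof. by apply: filterS osc => a []. Qed.

Lemma vmode_bO (g : R -> R) (r : R -> R -> vec) (chi : R -> R -> R[i]) :
  (\forall a \near F, (forall i, ccont (fun t => r a t i 0)) /\ ccont (chi a)) ->
  (forall a t, cmod (chi a t) = 1) -> vbO F g r ->
  vbO F g (fun a _ => vmode (T a) (chi a) (r a)).
Proof.
move=> hc h1 hr i; apply: (@bO_eq _ _ _ _ _ (fun a _ => cmean (T a) (fun t => r a t i 0 * chi a t))).
  by move=> a t; rewrite mxE.
apply: bO_cmean; first exact: near_T.
  by apply: filterS hc => a [c1 c2]; exact: ccontM.
by apply: (bO_le _ (hr i)); apply: nearW => a t; rewrite cmodM h1 mulr1.
Qed.

Let Ec a t := (E a t)^*.
Let u1 a := vmode (T a) (Ec a) (o a).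
Let v1 a := vmode (T a) (E a) (o a).
Let f1 a := vmode (T a) (Ec a) (Fo a).
Let g1 a := vmode (T a) (E a) (Fo a).
Let iW a : R[i] := 'i%C * (W a)%:C%C.
Let iw : R[i] := 'i%C * w%:C%C.

Lemma EEc a t : E a t * Ec a t = 1. Proof. exact: cisJ. Qed.

Lemma cmodE1 a t : cmod (E a t) = 1. Proof. exact: cmod_cis. Qed.
Lemma cmodEc1 a t : cmod (Ec a t) = 1. Proof. by rewrite cmodJ cmod_cis. Qed.

Lemma conj_i : ('i%C : R[i])^* = - 'i%C.
Proof. by apply: complexP; rewrite ?cReJ ?cImJ /= ?oppr0. Qed.

Lemma conj_iW a : (iW a)^* = - iW a.
Proof. by rewrite /iW rmorphM /= conj_i conjCR mulNr. Qed.

Lemma cder_E a : cder (E a) (fun t => iW a * E a t).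
Proof. exact: cder_cis. Qed.

Lemma cder_Ec a : cder (Ec a) (fun t => - iW a * Ec a t).
Proof.
by apply: (cder_ext (cderJ (cder_E a))) => // t; rewrite rmorphM /= conj_iW.
Qed.

Lemma v1E : \forall a \near F, v1 a = map_mx (fun z : R[i] => z^*) (u1 a).
Proof.
near=> a; apply/colP => i; rewrite !mxE.
have [co _ _ _ cE] : [/\ forall i, ccont (fun t => o a t i 0),
  forall i, ccont (fun t => e a t i 0), forall i, ccont (fun t => Fo a t i 0),
  forall i, ccont (fun t => Fe a t i 0) & ccont (E a)] by near: a; exact: osc_cont.
have [_ _ _ _ _ _ _ re _ _ _] : oscillation A (D a) (T a) (W a) (M a) (o a) (e a) (Fo a) (Fe a).
  by near: a.
rewrite -cmeanJ; last by apply: ccontM => //; exact: ccontJ.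
by apply: cmean_ext => t; rewrite rmorphM /= re conjCK.
Unshelve. all: by end_near. Qed.

Lemma u1_bO : vbO F M (fun a _ => u1 a).
Proof.
apply: vmode_bO cmodEc1 bO_o.
by apply: filterS osc_cont => a [c _ _ _ cE]; split => //; exact: ccontJ.
Qed.

Lemma E_end : \forall a \near F, E a (T a) = E a 0.
Proof.
apply: filterS osc => a [] _ WT _ _ _ _ _ _ _ _ _.
by rewrite /E WT mulr0 cis0 mulr_natl mulr2n cisD cispi mulrNN mulr1.
Qed.

Lemma u1_eq : \forall a \near F,
  A *m u1 a + (D a *m u1 a + f1 a) = iW a *: u1 a /\
  A *m v1 a + (D a *m v1 a + g1 a) = - iW a *: v1 a.
Proof.
near=> a.
have [T0 _ _ do_ _ _ _ _ cFo _ _] : oscillation A (D a) (T a) (W a) (M a) (o a) (e a) (Fo a) (Fe a).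
  by near: a.
have [per _] : (forall t, o a (t + T a) = o a t) /\ (forall t, e a (t + T a) = e a t).
  by near: a; exact: osc_periodic.
have eE : E a (T a) = E a 0 by near: a; exact: E_end.
split.
  have := vmode_eq T0 do_ cFo per (cder_Ec a) (congr1 (fun z : R[i] => z^*) eE).
  by move/eqP; rewrite scaleNr subr_eq0 => /eqP.
have := vmode_eq T0 do_ cFo per (cder_E a) eE.
by move/eqP; rewrite scaleNr addr_eq0 => /eqP.
Unshelve. all: by end_near. Qed.

Hypothesis bO_Fo : vbO F (fun a => M a ^+ 3) Fo.

Lemma f1_bO : vbO F (fun a => M a ^+ 3) (fun a _ => f1 a).
Proof.
apply: vmode_bO cmodEc1 bO_Fo.
by apply: filterS osc_cont => a [_ _ c _ cE]; split => //; exact: ccontJ.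
Qed.

Lemma g1_bO : vbO F (fun a => M a ^+ 3) (fun a _ => g1 a).
Proof.
apply: vmode_bO cmodE1 bO_Fo.
by apply: filterS osc_cont => a [_ _ c _ cE].
Qed.

Lemma cmean_E2 a : oscillation A (D a) (T a) (W a) (M a) (o a) (e a) (Fo a) (Fe a) ->
  cmean (T a) (fun t => E a t * E a t) = 0 /\ cmean (T a) (fun t => Ec a t * Ec a t) = 0.
Proof.
case=> T0 WT _ _ _ _ _ _ _ _ _.
split.
  have := cmean_trig 1 0 0 0 T0 WT.
  rewrite (@cmean_ext _ _ _ (fun t => E a t * E a t)) // => t.
  by rewrite !mul0r !addr0 mul1r.
have := cmean_trig 0 0 1 0 T0 WT.
rewrite (@cmean_ext _ _ _ (fun t => Ec a t * Ec a t)) // => t.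
by rewrite !mul0r !addr0 add0r mul1r.
Qed.

(** Subtracting its first Fourier modes from o leaves a solution with no first
    mode, forced by the nonlinear terms from which the first modes have been
    subtracted as well; the linear estimate applies to it. *)
Lemma odd_leading : vbO F (fun a => M a ^+ 3)
  (fun a t => o a t - (E a t *: u1 a + Ec a t *: v1 a)).
Proof.
have bh : vbO F (fun a => M a ^+ 3) (fun a t => Fo a t - (E a t *: f1 a + Ec a t *: g1 a)).
  apply: vbO_add => //; apply: vbO_opp; apply: vbO_add.
    move=> i; apply: (bO_le _ (f1_bO i)); apply: nearW => a t.
    by rewrite mxE cmodM cmodE1 mul1r.
  move=> i; apply: (bO_le _ (g1_bO i)); apply: nearW => a t.
  by rewrite mxE cmodM cmodEc1 mul1r.
apply: periodic_bO bh.
near=> a.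
have hosc : oscillation A (D a) (T a) (W a) (M a) (o a) (e a) (Fo a) (Fe a) by near: a.
have [T0 WT _ do_ _ _ _ _ _ _ _] := hosc.
have [E2 Ec2] := cmean_E2 hosc.
have [per _] : (forall t, o a (t + T a) = o a t) /\ (forall t, e a (t + T a) = e a t).
  by near: a; exact: osc_periodic.
have [co _ _ _ cE] : [/\ forall i, ccont (fun t => o a t i 0),
  forall i, ccont (fun t => e a t i 0), forall i, ccont (fun t => Fo a t i 0),
  forall i, ccont (fun t => Fe a t i 0) & ccont (E a)] by near: a; exact: osc_cont.
have [eu ev] : A *m u1 a + (D a *m u1 a + f1 a) = iW a *: u1 a /\
  A *m v1 a + (D a *m v1 a + g1 a) = - iW a *: v1 a by near: a; exact: u1_eq.
have cEc : ccont (Ec a) by exact: ccontJ.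
split.
- apply: (vder_ext (vder_modes (u1 a) (v1 a) do_ (cder_E a) (cder_Ec a))) => // t.
  have -> : (iW a * E a t) *: u1 a = E a t *: (iW a *: u1 a) by rewrite scalerA mulrC.
  have -> : (- iW a * Ec a t) *: v1 a = Ec a t *: (- iW a *: v1 a) by rewrite scalerA mulrC.
  rewrite -eu -ev !mulmxBr !mulmxDr -!scalemxAr.
  move: (A *m o a t) (D a *m o a t) (A *m u1 a) (D a *m u1 a) (A *m v1 a) (D a *m v1 a).
  move: (Fo a t) (f1 a) (g1 a) (E a t) (Ec a t) => X1 X2 X3 x y Y1 Y2 Y3 Y4 Y5 Y6.
  by apply/colP => i; rewrite !mxE; ring.
- have Eper u : E a (u + T a) = E a u.
    by rewrite /E mulrDr WT cisD mulr_natl mulr2n cisD cispi mulrNN !mulr1.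
  have Ecper u : Ec a (u + T a) = Ec a u by rewrite /Ec Eper.
  by move=> t; rewrite per Eper Ecper.
- move=> i; rewrite -/(E a) -/(Ec a).
  have cc x y : ccont (fun t => E a t * x + Ec a t * y).
    by apply: ccontD; apply: ccontM => //; exact: ccont_cst.
  split.
  + rewrite (@cmean_ext _ _ _ (fun t => o a t i 0 * Ec a t -
       (u1 a i 0 + v1 a i 0 * (Ec a t * Ec a t)))); last first.
      move=> t; rewrite !mxE mulrBl mulrDl; congr (_ - (_ + _)).
        by rewrite mulrAC EEc mul1r.
      by rewrite mulrAC mulrC.
    have cEE := ccontM cEc cEc.
    rewrite cmeanB; [|exact: ccontM|by apply: ccontD; [exact: ccont_cst|exact: ccontZ]].
    rewrite cmeanD; [|exact: ccont_cst|exact: ccontZ].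
    have -> : u1 a i 0 = cmean (T a) (fun t => o a t i 0 * Ec a t) by rewrite mxE.
    by rewrite cmean_cst // cmeanZ // Ec2 mulr0 addr0 subrr.
  + rewrite (@cmean_ext _ _ _ (fun t => o a t i 0 * E a t -
       (v1 a i 0 + u1 a i 0 * (E a t * E a t)))); last first.
      move=> t; rewrite -[cis (W a * t)]/(E a t) !mxE mulrBl mulrDl; congr (_ - _).
      rewrite addrC; congr (_ + _); last by rewrite mulrAC mulrC.
      by rewrite mulrAC (mulrC (Ec a t)) EEc mul1r.
    have cEE := ccontM cE cE.
    rewrite cmeanB; [|exact: ccontM|by apply: ccontD; [exact: ccont_cst|exact: ccontZ]].
    rewrite cmeanD; [|exact: ccont_cst|exact: ccontZ].
    have -> : v1 a i 0 = cmean (T a) (fun t => o a t i 0 * E a t) by rewrite mxE.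
    by rewrite cmean_cst // cmeanZ // E2 mulr0 addr0 subrr.
Unshelve. all: by end_near. Qed.

Variables (q p : vec).
Hypothesis Aq : A *m q = iw *: q.
Hypothesis pA : forall u, inner p (A *m u) = iw * inner p u.
Hypothesis pq1 : inner p q = 1.
(** On vectors orthogonal to p this is iw - A, and the rank one term makes it
    invertible. *)
Let N := iw%:M - A + q *m (map_mx (fun z : R[i] => z^*) p)^T.
Hypothesis N_unit : N \in unitmx.
Hypothesis bO_e2 : vbO F (fun a => M a ^+ 2) e.

(** The first mode of o splits into a multiple al of the critical eigenvector
    and a transversal part w1; al is the complex amplitude of the
    oscillation. *)
Let al a := inner p (u1 a).
Let w1 a := u1 a - al a *: q.
Let qb := conjv q.

(** Pairing the balance of the first mode with p removes A up to its critical
    eigenvalue. *)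
Lemma amplitude_eq : \forall a \near F,
  (iW a - iw) * al a = inner p (D a *m u1 a) + inner p (f1 a).
Proof.
apply: filterS u1_eq => a [eu _].
have := congr1 (inner p) eu; rewrite !innerD innerZ pA mulrBl => <-.
by rewrite addrAC subrr add0r.
Qed.

Lemma w1_eq : \forall a \near F,
  w1 a = invmx N *m (D a *m u1 a + f1 a + (iw - iW a) *: u1 a).
Proof.
apply: filterS u1_eq => a [eu _].
rewrite -[LHS](mulKmx N_unit); congr (_ *m _).
have pw : inner p (w1 a) = 0 by rewrite innerB innerZ pq1 mulr1 subrr.
rewrite mulmxDl mulmxBl -mulmxA innerE pw mul_scalar_mx.
rewrite (_ : (0 : R[i])%:M = 0); last by rewrite -scalemx1 scale0r.
rewrite mulmx0 addr0 /w1 scalerBr mulmxBr -scalemxAr Aq.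
rewrite scalerBl -eu !scalerA [al a * iw]mulrC.
move: (A *m u1 a) (D a *m u1 a) (f1 a) ((iw * al a) *: q) (iw *: u1 a) => X1 X2 X3 X4 X5.
by apply/colP => i; rewrite !mxE; ring.
Qed.

Lemma al_bO : bO F M (fun a (_ : R) => al a).
Proof. by apply: (bO_inner p); exact: u1_bO. Qed.

Let th a := W a - w.

Lemma iW_th : bO F th (fun a (_ : R) => iw - iW a).
Proof.
exists 1; apply: nearW => a _; rewrite mul1r.
have -> : iw - iW a = 'i%C * (w - W a)%:C%C by rewrite /iw /iW rmorphB mulrBr.
rewrite cmodM cmodC.
have -> : cmod ('i%C : R[i]) = 1 by rewrite cmodE /= expr0n expr1n add0r sqrtr1.
by rewrite mul1r distrC.
Qed.

Lemma Du_bO : vbO F (fun a => de a * M a) (fun a _ => D a *m u1 a).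
Proof. exact: vbO_mulf bO_D u1_bO. Qed.

Lemma Du_kap : vbO F (fun a => kap a * M a) (fun a _ => D a *m u1 a + f1 a).
Proof.
apply: vbO_add.
  apply: vbO_gauge Du_bO; apply: gauge_le => a M0 M1 d0 d1.
  have := ltW M0 => M0'; rewrite mulr_ge0 //= ler_wpM2r // /kap lerDr sqr_ge0 //.
apply: vbO_gauge f1_bO; apply: gauge_le => a M0 M1 d0 d1.
have M0' := ltW M0; rewrite exprn_ge0 //= exprSr ler_wpM2r // /kap lerDl //.
Qed.

(** The bound g on the frequency shift is kept general: first it is the shift
    itself, and once the amplitude is bounded below it can be taken to be
    kap. *)
Lemma w1_bO_gen (g : R -> R) : bO F g (fun a (_ : R) => iw - iW a) ->
  (\forall a \near F, 0 <= g a) ->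
  vbO F (fun a => (kap a + g a) * M a) (fun a _ => w1 a).
Proof.
move=> hg g0.
apply: (@vbO_near _ _ _ _ _ (fun a _ => invmx N *m (D a *m u1 a + f1 a + (iw - iW a) *: u1 a))).
  by apply: filterS w1_eq => a -> .
apply: vbO_mul; apply: vbO_add.
  apply: vbO_gauge Du_kap; apply: filterS2 gauges_good g0 => a [M0 M1 d0 d1] g0.
  have k0 : 0 <= kap a by rewrite addr_ge0 // sqr_ge0.
  have M0' := ltW M0.
  have n1 : 0 <= kap a * M a by rewrite mulr_ge0.
  have n2 : 0 <= (kap a + g a) * M a by rewrite mulr_ge0 // addr_ge0.
  by rewrite (ger0_norm n1) (ger0_norm n2) ler_wpM2r // lerDl.
apply: vbO_gauge (vbO_scale hg u1_bO); apply: filterS2 gauges_good g0 => a [M0 M1 d0 d1] g0.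
have k0 : 0 <= kap a by rewrite addr_ge0 // sqr_ge0.
have M0' := ltW M0.
have n1 : 0 <= g a * M a by rewrite mulr_ge0.
have n2 : 0 <= (kap a + g a) * M a by rewrite mulr_ge0 // addr_ge0.
by rewrite (ger0_norm n1) (ger0_norm n2) ler_wpM2r // lerDr.
Qed.

Lemma th_bO : bO F (fun a => `|th a|) (fun a (_ : R) => iw - iW a).
Proof. by have [C hC] := iW_th; exists C; apply: filterS hC => a; rewrite normr_id. Qed.

Lemma lincomb_entry (c : R[i]) (x y : vec) i : (c *: x + y) i 0 = c * x i 0 + y i 0.
Proof. by rewrite !mxE. Qed.

Lemma split_entry (x u : vec) (c c' : R[i]) i : x i 0 =
  (x - (c *: u + c' *: map_mx (fun z : R[i] => z^*) u)) i 0 + (c * u i 0 + c' * (u i 0)^*).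
Proof. by rewrite !mxE; ring. Qed.

(** The transversal part w1, the higher modes of o and the whole of e are of
    smaller order than M, so their total is eventually at most M / 2; since M
    does not exceed the size of o and e, the critical mode must carry the
    rest. *)
Lemma amplitude_lower : exists2 C : R, 0 < C & \forall a \near F, M a <= C * cmod (al a).
Proof.
have th0 : \forall a \near F, 0 <= `|th a| by apply: nearW => a.
have /vbO_unif[K1 K10 h1] := w1_bO_gen th_bO th0.
have /vbO_unif[K2 K20 h2] := bO_e2.
have /vbO_unif[K3 K30 h3] := odd_leading.
pose Q := \sum_i cmod (q i 0).
have Q0 : 0 <= Q by apply: sumr_ge0 => i _; exact: cmod_ge0.
have qQ i : cmod (q i 0) <= Q.
  by rewrite /Q (bigD1 i) //= lerDl sumr_ge0 // => j _; exact: cmod_ge0.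
exists (4 * Q + 1); first by rewrite ltr_wpDl // mulr_ge0.
(* With M, de and the frequency shift below x, the three corrections add up to
    at most M / 2. *)
pose x := (2 * (6 * K1 + K3 + K2 + 1))^-1.
have x0 : 0 < x by rewrite invr_gt0 mulr_gt0 // !addr_gt0 // mulr_gt0.
have xE : (6 * K1 + K3 + K2) * x <= 2^-1.
  have P0 : 0 < 6 * K1 + K3 + K2 + 1 by rewrite !addr_gt0 // mulr_gt0.
  rewrite /x invfM mulrCA ger_pMr // ler_pdivrMr // mul1r; lra.
near=> a.
have [M0 M1 d0 d1] : [/\ 0 < M a, M a <= 1, 0 <= de a & de a <= 1] by near: a; exact: gauges_good.
have Mx : M a < x by near: a; exact: M_small.
have dx : de a < x by near: a; exact: de_small.
have tx : `|th a| < x by near: a; exact: W_near.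
have h1a : forall (t : R) i, cmod (w1 a i 0) <= K1 * `|(kap a + `|th a|) * M a| by near: a.
have h2a : forall t i, cmod (e a t i 0) <= K2 * `|M a ^+ 2| by near: a.
have h3a : forall t i, cmod ((o a t - (E a t *: u1 a + Ec a t *: v1 a)) i 0) <= K3 * `|M a ^+ 3|.
  by near: a.
have osca : oscillation A (D a) (T a) (W a) (M a) (o a) (e a) (Fo a) (Fe a) by near: a.
have vE : v1 a = map_mx (fun z : R[i] => z^*) (u1 a) by near: a; exact: v1E.
have M0' := ltW M0.
have k0 : 0 <= kap a by rewrite addr_ge0 // sqr_ge0.
have n1 : 0 <= (kap a + `|th a|) * M a by rewrite mulr_ge0 // addr_ge0.
rewrite (ger0_norm n1) in h1a.
rewrite (ger0_norm (exprn_ge0 2 M0')) in h2a.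
rewrite (ger0_norm (exprn_ge0 3 M0')) in h3a.
have u1b i : cmod (u1 a i 0) <= Q * cmod (al a) + K1 * ((kap a + `|th a|) * M a).
  have -> : u1 a i 0 = al a * q i 0 + w1 a i 0 by rewrite -lincomb_entry /w1 addrC subrK.
  rewrite (le_trans (cmodD _ _)) // lerD ?h1a // cmodM mulrC ler_wpM2r ?cmod_ge0 //.
have := osc_min osca (B := 2 * (Q * cmod (al a) + K1 * ((kap a + `|th a|) * M a))
   + K3 * M a ^+ 3 + K2 * M a ^+ 2).
move=> /(_ _) hM.
have {}hM : M a <= 2 * (Q * cmod (al a) + K1 * ((kap a + `|th a|) * M a))
   + K3 * M a ^+ 3 + K2 * M a ^+ 2.
  apply: hM => t i; rewrite lerD //.
  have -> : o a t i 0 = (o a t - (E a t *: u1 a + Ec a t *: v1 a)) i 0 +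
     (E a t * u1 a i 0 + Ec a t * (u1 a i 0)^*).
    by rewrite vE -split_entry.
  rewrite addrC (le_trans (cmodD _ _)) // lerD //.
  rewrite (le_trans (cmodD _ _)) // !cmodM cmodE1 cmodEc1 cmodJ !mul1r.
  rewrite [2 * _]mulrDl mul1r; exact: lerD.
have hk : kap a + `|th a| <= 3 * x.
  have : M a ^+ 2 <= M a by rewrite expr2 ler_piMr.
  by rewrite /kap => h; lra.
have t1 : K1 * ((kap a + `|th a|) * M a) <= 3 * K1 * x * M a.
  have -> : 3 * K1 * x * M a = K1 * ((3 * x) * M a) by ring.
  by rewrite ler_wpM2l ?(ltW K10) // ler_wpM2r.
have t3 : K3 * M a ^+ 3 <= K3 * x * M a.
  rewrite exprSr mulrA ler_wpM2r // ler_wpM2l // ?(ltW K30) //.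
  rewrite (le_trans _ (ltW Mx)) // expr2 ler_piMr //.
have t2 : K2 * M a ^+ 2 <= K2 * x * M a.
  by rewrite expr2 mulrA ler_wpM2r // ler_wpM2l // ltW.
have xM : (6 * K1 + K3 + K2) * x * M a <= 2^-1 * M a by rewrite ler_wpM2r.
have alg : (6 * K1 + K3 + K2) * x * M a = 2 * (3 * K1 * x * M a) + K3 * x * M a + K2 * x * M a by ring.
have c0 := cmod_ge0 (al a).
rewrite mulrDl mul1r -mulrA.
lra.
Unshelve. all: by end_near. Qed.

(** Division of [amplitude_eq] by al, which is of order exactly M. *)
Lemma frequency_shift : bO F kap (fun a (_ : R) => iw - iW a).
Proof.
have [C C0 hC] := amplitude_lower.
have [K K0 hK] := bO_pos (bO_inner p Du_kap).
exists (K * C).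
near=> a => s.
have hCa : M a <= C * cmod (al a) by near: a.
have hKa : forall s : R, cmod (inner p (D a *m u1 a + f1 a)) <= K * `|kap a * M a| by near: a.
have eq : (iW a - iw) * al a = inner p (D a *m u1 a) + inner p (f1 a) by near: a; exact: amplitude_eq.
have [M0 M1 d0 d1] : [/\ 0 < M a, M a <= 1, 0 <= de a & de a <= 1] by near: a; exact: gauges_good.
have k0 : 0 <= kap a by rewrite addr_ge0 // sqr_ge0.
have al0 : 0 < cmod (al a).
  by have := lt_le_trans M0 hCa; rewrite pmulr_rgt0.
rewrite -(ler_pM2r al0) -cmodM -opprB mulNr cmodN eq -innerD.
apply: (le_trans (hKa 0)).
rewrite normrM (ger0_norm (ltW M0)) -!mulrA ler_pM2l //.
by rewrite [leRHS]mulrCA ler_wpM2l ?normr_ge0.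
Unshelve. all: by end_near.
Qed.

Lemma w1_bO : vbO F (fun a => kap a * M a) (fun a _ => w1 a).
Proof.
have k0 : \forall a \near F, 0 <= kap a.
  by apply: filterS gauges_good => a [M0 M1 d0 d1]; rewrite addr_ge0 // sqr_ge0.
move=> i; apply: (bO_weak (K := 2)) (w1_bO_gen frequency_shift k0 i).
apply: nearW => a; have -> : (kap a + kap a) * M a = 2 * (kap a * M a) by ring.
by rewrite normrM (ger0_norm (ler0n _ 2)).
Qed.

(** The leading part of o: the critical mode with amplitude al, and its
    conjugate. *)
Let x a t := (al a * E a t) *: q + ((al a)^* * Ec a t) *: qb.

Lemma odd_expansion : vbO F (fun a => kap a * M a) (fun a t => o a t - x a t).
Proof.
apply: (@vbO_near _ _ _ _ _ (fun a t => (o a t - (E a t *: u1 a + Ec a t *: v1 a)) +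
   (E a t *: w1 a + Ec a t *: map_mx (fun z : R[i] => z^*) (w1 a)))).
  apply: filterS v1E => a -> t; rewrite /x /w1 /qb /conjv map_mxB map_mxZ.
  have -> : map_mx (fun z : R[i] => z^* ) q = qb by [].
  move: (u1 a) (al a) (E a t) (Ec a t) (o a t) qb => u c X Y v q'.
  by apply/colP => i; rewrite !mxE; ring.
apply: vbO_add.
  apply: vbO_gauge odd_leading; apply: gauge_le => a M0 M1 d0 d1.
  by have M0' := ltW M0; rewrite exprn_ge0 //= exprSr ler_wpM2r // lerDl.
move=> i; apply: (@bO_eq _ _ _ _ _ (fun a t => E a t * w1 a i 0 + Ec a t * (w1 a i 0)^*)).
  move=> a t; move: (w1 a) => u; by rewrite !mxE.
apply: bO_add.
  by apply: (bO_le _ (w1_bO i)); apply: nearW => a t; rewrite cmodM cmodE1 mul1r.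
by apply: (bO_le _ (w1_bO i)); apply: nearW => a t; rewrite cmodM cmodEc1 mul1r cmodJ.
Qed.

Lemma x_bO : vbO F M x.
Proof.
move=> i; apply: (@bO_eq _ _ _ _ _ (fun a t => al a * E a t * q i 0 + (al a)^* * Ec a t * qb i 0)).
  by move=> a t; rewrite /x; move: qb => q'; rewrite !mxE.
apply: bO_add; apply: bO_mulr; try exact: bO_const.
  by apply: (bO_le _ al_bO); apply: nearW => a t; rewrite cmodM cmodE1 mulr1.
by apply: (bO_le _ al_bO); apply: nearW => a t; rewrite cmodM cmodEc1 mulr1 cmodJ.
Qed.

Lemma gauge_comm (g g' : R -> R) : (forall a, g a = g' a) -> \forall a \near F, `|g a| <= `|g' a|.
Proof. by move=> h; apply: nearW => a; rewrite h. Qed.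

Lemma diff_oo k j : bO F (fun a => kap a * M a ^+ 2)
  (fun a t => o a t k 0 * o a t j 0 - x a t k 0 * x a t j 0).
Proof.
apply: (@bO_eq _ _ _ _ _ (fun a t => (o a t - x a t) k 0 * o a t j 0 + x a t k 0 * (o a t - x a t) j 0)).
  move=> a t; move: (o a t) (x a t) => u v; rewrite !mxE; ring.
apply: bO_add.
  by apply: bO_gauge (bO_mul (odd_expansion k) (bO_o j)); apply: gauge_comm => a; ring.
by apply: bO_gauge (bO_mul (x_bO k) (odd_expansion j)); apply: gauge_comm => a; ring.
Qed.

Lemma diff_ooo k j l : bO F (fun a => kap a * M a ^+ 3)
  (fun a t => o a t k 0 * o a t j 0 * o a t l 0 - x a t k 0 * x a t j 0 * x a t l 0).
Proof.
apply: (@bO_eq _ _ _ _ _ (fun a t => (o a t k 0 * o a t j 0 - x a t k 0 * x a t j 0) * o a t l 0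
   + x a t k 0 * x a t j 0 * (o a t - x a t) l 0)).
  move=> a t; move: (o a t) (x a t) => u v; rewrite !mxE; ring.
apply: bO_add.
  by apply: bO_gauge (bO_mul (diff_oo k j) (bO_o l)); apply: gauge_comm => a; ring.
apply: bO_gauge (bO_mul (bO_mul (x_bO k) (x_bO j)) (odd_expansion l)).
by apply: gauge_comm => a; ring.
Qed.

Lemma diff_eo k j : bO F (fun a => kap a * M a ^+ 3)
  (fun a t => e a t k 0 * o a t j 0 - e a t k 0 * x a t j 0).
Proof.
apply: (@bO_eq _ _ _ _ _ (fun a t => e a t k 0 * (o a t - x a t) j 0)).
  move=> a t; move: (o a t) (x a t) => u v; rewrite !mxE; ring.
by apply: bO_gauge (bO_mul (bO_e2 k) (odd_expansion j)); apply: gauge_comm => a; ring.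
Qed.

Lemma x_cont : \forall a \near F, forall i, ccont (fun t => x a t i 0).
Proof.
apply: filterS osc_cont => a [_ _ _ _ cE] i.
apply: (@ccont_ext _ (fun t => al a * q i 0 * E a t + (al a)^* * qb i 0 * Ec a t)).
  by apply: ccontD; apply: ccontZ => //; exact: ccontJ.
by move=> t; rewrite /x; move: qb => q'; rewrite !mxE; ring.
Qed.

(** Q will be a trigonometric polynomial, whose mean is explicit; replacing P
    by Q costs no more than their uniform distance. *)
Lemma mean_close (g : R -> R) (P Q : R -> R -> R[i]) (chi : R -> R -> R[i]) (c : R -> R[i]) :
  (forall a t, cmod (chi a t) = 1) -> (\forall a \near F, ccont (chi a)) ->
  (\forall a \near F, ccont (P a)) -> (\forall a \near F, ccont (Q a)) ->
  bO F g (fun a t => P a t - Q a t) ->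
  (\forall a \near F, cmean (T a) (fun t => Q a t * chi a t) = c a) ->
  bO F g (fun a (_ : R) => cmean (T a) (fun t => P a t * chi a t) - c a).
Proof.
move=> h1 cc cP cQ h e_.
apply: (@bO_near _ _ _ _ _ (fun a (_ : R) => cmean (T a) (fun t => (P a t - Q a t) * chi a t))).
  near=> a => _.
  have Qc : cmean (T a) (fun t => Q a t * chi a t) = c a by near: a.
  have c1 : ccont (P a) by near: a.
  have c2 : ccont (Q a) by near: a.
  have c3 : ccont (chi a) by near: a.
  rewrite -Qc -cmeanB; [|exact: ccontM|exact: ccontM].
  by apply: cmean_ext => t; rewrite mulrBl.
apply: bO_cmean; first exact: near_T.
  by near=> a; apply: ccontM; [apply: ccontB|]; near: a.
by apply: (bO_le _ h); apply: nearW => a t; rewrite cmodM h1 mulr1.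
Unshelve. all: by end_near. Qed.

Lemma trig2 (X Y a a' b b' : R[i]) : X * Y = 1 ->
  (a * X + b * Y) * (a' * X + b' * Y) = a * a' * X ^+ 2 + (a * b' + b * a') + b * b' * Y ^+ 2.
Proof.
move=> h.
have -> : (a * X + b * Y) * (a' * X + b' * Y) =
  a * a' * X ^+ 2 + (a * b' + b * a') * (X * Y) + b * b' * Y ^+ 2 by ring.
by rewrite h mulr1.
Qed.

Lemma x_entry a t i : x a t i 0 = al a * q i 0 * E a t + (al a)^* * qb i 0 * Ec a t.
Proof. by rewrite /x; move: qb => q'; rewrite !mxE; ring. Qed.

Lemma trig_mean c2 c0 d2 d4 : \forall a \near F, cmean (T a) (fun t => c2 a * E a t ^+ 2 + c0 a +
   d2 a * Ec a t ^+ 2 + d4 a * Ec a t ^+ 4) = c0 a.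
Proof. by apply: filterS osc => a [] T0 WT _ _ _ _ _ _ _ _ _; exact: cmean_trig. Qed.

Lemma near_cE : \forall a \near F, ccont (E a).
Proof. by apply: filterS osc_cont => a []. Qed.

Lemma near_co : \forall a \near F, forall i, ccont (fun t => o a t i 0).
Proof. by apply: filterS osc_cont => a []. Qed.

Lemma near_ce : \forall a \near F, forall i, ccont (fun t => e a t i 0).
Proof. by apply: filterS osc_cont => a []. Qed.

Lemma cmod_one (a t : R) : cmod (1 : R[i]) = 1. Proof. exact: cmod1. Qed.

Lemma mean_oo0 k j : bO F (fun a => kap a * M a ^+ 2) (fun a (_ : R) =>
  cmean (T a) (fun t => o a t k 0 * o a t j 0 * 1) -
  al a * (al a)^* * (q k 0 * qb j 0 + qb k 0 * q j 0)).
Proof.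
apply: (mean_close (chi := fun _ _ => 1)) (diff_oo k j) _; first exact: cmod_one.
- by apply: nearW => a; exact: ccont_cst.
- by apply: filterS near_co => a c; exact: ccontM.
- by apply: filterS x_cont => a c; exact: ccontM.
apply: filterS (trig_mean (fun a => (al a * q k 0) * (al a * q j 0))
  (fun a => al a * (al a)^* * (q k 0 * qb j 0 + qb k 0 * q j 0))
  (fun a => ((al a)^* * qb k 0) * ((al a)^* * qb j 0)) (fun=> 0)) => a <-.
apply: cmean_ext => t; rewrite mulr1 !x_entry trig2 ?EEc //.
by rewrite mul0r addr0; ring.
Qed.

Lemma cmod_Ec2 (a t : R) : cmod (Ec a t ^+ 2) = 1.
Proof. by rewrite expr2 cmodM cmodEc1 mulr1. Qed.

Lemma near_cEc2 : \forall a \near F, ccont (fun t => Ec a t ^+ 2).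
Proof.
by apply: filterS near_cE => a c; apply: ccontM; exact: ccontJ.
Qed.

Lemma mean_oo2 k j : bO F (fun a => kap a * M a ^+ 2) (fun a (_ : R) =>
  cmean (T a) (fun t => o a t k 0 * o a t j 0 * Ec a t ^+ 2) -
  al a ^+ 2 * (q k 0 * q j 0)).
Proof.
apply: (mean_close (chi := fun a t => Ec a t ^+ 2)) (diff_oo k j) _; first exact: cmod_Ec2.
- exact: near_cEc2.
- by apply: filterS near_co => a c; exact: ccontM.
- by apply: filterS x_cont => a c; exact: ccontM.
apply: filterS (trig_mean (fun=> 0) (fun a => al a ^+ 2 * (q k 0 * q j 0))
  (fun a => al a * (al a)^* * (q k 0 * qb j 0 + qb k 0 * q j 0))
  (fun a => ((al a)^* * qb k 0) * ((al a)^* * qb j 0))) => a <-.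
apply: cmean_ext => t; rewrite !x_entry trig2 ?EEc //.
have h := EEc a t; move: (E a t) (Ec a t) h => X Y h.
have -> : (al a * q k 0 * (al a * q j 0) * X ^+ 2 +
   (al a * q k 0 * ((al a)^* * qb j 0) + (al a)^* * qb k 0 * (al a * q j 0)) +
   (al a)^* * qb k 0 * ((al a)^* * qb j 0) * Y ^+ 2) * Y ^+ 2 =
   al a ^+ 2 * (q k 0 * q j 0) * (X * Y) ^+ 2 +
   al a * (al a)^* * (q k 0 * qb j 0 + qb k 0 * q j 0) * Y ^+ 2 +
   (al a)^* * qb k 0 * ((al a)^* * qb j 0) * Y ^+ 4 by ring.
by rewrite h expr1n mulr1 mul0r add0r.
Qed.

Lemma mean_ooo k j l : bO F (fun a => kap a * M a ^+ 3) (fun a (_ : R) =>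
  cmean (T a) (fun t => o a t k 0 * o a t j 0 * o a t l 0 * Ec a t) -
  al a ^+ 2 * (al a)^* * (q k 0 * q j 0 * qb l 0 + q k 0 * qb j 0 * q l 0 + qb k 0 * q j 0 * q l 0)).
Proof.
apply: (mean_close (chi := fun a t => Ec a t)) (diff_ooo k j l) _; first exact: cmodEc1.
- by apply: filterS near_cE => a c; exact: ccontJ.
- by apply: filterS near_co => a c; do 2?[apply: ccontM].
- by apply: filterS x_cont => a c; do 2?[apply: ccontM].
apply: filterS (trig_mean (fun a => al a ^+ 3 * (q k 0 * q j 0 * q l 0))
  (fun a => al a ^+ 2 * (al a)^* * (q k 0 * q j 0 * qb l 0 + q k 0 * qb j 0 * q l 0 + qb k 0 * q j 0 * q l 0))
  (fun a => al a * (al a)^* ^+ 2 * (q k 0 * qb j 0 * qb l 0 + qb k 0 * qb j 0 * q l 0 + qb k 0 * q j 0 * qb l 0))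
  (fun a => (al a)^* ^+ 3 * (qb k 0 * qb j 0 * qb l 0))) => a <-.
apply: cmean_ext => t; rewrite !x_entry.
have h := EEc a t; move: (E a t) (Ec a t) h => X Y h.
move: (q k 0) (q j 0) (q l 0) (qb k 0) (qb j 0) (qb l 0) (al a) (al a)^* => q1 q2 q3 p1 p2 p3 s r.
have -> : (s * q1 * X + r * p1 * Y) * (s * q2 * X + r * p2 * Y) * (s * q3 * X + r * p3 * Y) * Y =
  s ^+ 3 * (q1 * q2 * q3) * X ^+ 2 * (X * Y) +
  s ^+ 2 * r * (q1 * q2 * p3 + q1 * p2 * q3 + p1 * q2 * q3) * (X * Y) ^+ 2 +
  s * r ^+ 2 * (q1 * p2 * p3 + p1 * p2 * q3 + p1 * q2 * p3) * Y ^+ 2 * (X * Y) +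
  r ^+ 3 * (p1 * p2 * p3) * Y ^+ 4 by ring.
by rewrite h expr1n !mulr1.
Qed.

Let u0 a := vmode (T a) (fun=> 1) (e a).
Let u2 a := vmode (T a) (fun t => Ec a t ^+ 2) (e a).
Let f0 a := vmode (T a) (fun=> 1) (Fe a).
Let f2 a := vmode (T a) (fun t => Ec a t ^+ 2) (Fe a).

Lemma mean_eo k j : bO F (fun a => kap a * M a ^+ 3) (fun a (_ : R) =>
  cmean (T a) (fun t => e a t k 0 * o a t j 0 * Ec a t) -
  (al a * q j 0 * u0 a k 0 + (al a)^* * qb j 0 * u2 a k 0)).
Proof.
apply: (mean_close (chi := fun a t => Ec a t)) (diff_eo k j) _; first exact: cmodEc1.
- by apply: filterS near_cE => a c; exact: ccontJ.
- by apply: filterS2 near_ce near_co => a c1 c2; exact: ccontM.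
- by apply: filterS2 near_ce x_cont => a c1 c2; exact: ccontM.
near=> a.
have ce : forall i, ccont (fun t => e a t i 0) by near: a; exact: near_ce.
have cE2 : ccont (fun t => Ec a t ^+ 2) by near: a; exact: near_cEc2.
rewrite (@cmean_ext _ _ _ (fun t => al a * q j 0 * (e a t k 0 * 1) +
  (al a)^* * qb j 0 * (e a t k 0 * Ec a t ^+ 2))); last first.
  move=> t; rewrite x_entry; have h := EEc a t; move: (E a t) (Ec a t) h => X Y h.
  by rewrite -h; ring.
have c1 : ccont (fun t => e a t k 0 * 1) by apply: ccontM => //; exact: ccont_cst.
have c2 : ccont (fun t => e a t k 0 * Ec a t ^+ 2) by exact: ccontM.
rewrite cmeanD; [|exact: ccontZ|exact: ccontZ].
by rewrite !cmeanZ // !mxE.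
Unshelve. all: by end_near. Qed.

Variables (b : 'I_n.+1 -> 'I_n.+1 -> 'I_n.+1 -> R[i]).
Variables (c : 'I_n.+1 -> 'I_n.+1 -> 'I_n.+1 -> 'I_n.+1 -> R[i]).
Hypothesis b_sym : forall m j k, b m j k = b m k j.
Hypothesis c_sym12 : forall m j k l, c m j k l = c m k j l.
Hypothesis c_sym23 : forall m j k l, c m j k l = c m j l k.
Hypothesis Fe_taylor : vbO F (fun a => kap a * M a ^+ 2)
  (fun a t => Fe a t - 2^-1 *: Bform b (o a t) (o a t)).
Hypothesis Fo_taylor : vbO F (fun a => kap a * M a ^+ 3)
  (fun a t => Fo a t - (Bform b (e a t) (o a t) + 6^-1 *: Cform c (o a t) (o a t) (o a t))).
Variables (h0 h2 : vec).
Hypothesis A_unit : A \in unitmx.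
Hypothesis A2_unit : (2 * iw)%:M - A \in unitmx.
Hypothesis h0E : A *m h0 = - Bform b q qb.
Hypothesis h2E : ((2 * iw)%:M - A) *m h2 = Bform b q q.

(** The quadratic Taylor term of Fe turns each mode of Fe into means of
    products of two entries of o. *)
Lemma even_mode (chi : R -> R -> R[i]) (d : R -> 'I_n.+1 -> 'I_n.+1 -> R[i]) :
  (forall a t, cmod (chi a t) = 1) -> (\forall a \near F, ccont (chi a)) ->
  (forall k j, bO F (fun a => kap a * M a ^+ 2) (fun a (_ : R) =>
     cmean (T a) (fun t => o a t k 0 * o a t j 0 * chi a t) - d a k j)) ->
  vbO F (fun a => kap a * M a ^+ 2) (fun a (_ : R) => vmode (T a) (chi a) (Fe a) -
    \col_m (2^-1 * \sum_j \sum_k b m j k * d a k j)).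
Proof.
move=> h1 hc hd m.
apply: (@bO_near _ _ _ _ _ (fun a (_ : R) =>
  cmean (T a) (fun t => (Fe a t - 2^-1 *: Bform b (o a t) (o a t)) m 0 * chi a t) +
  2^-1 * \sum_j \sum_k b m j k *
     (cmean (T a) (fun t => o a t k 0 * o a t j 0 * chi a t) - d a k j))).
  near=> a => _.
  have co : forall i, ccont (fun t => o a t i 0) by near: a; exact: near_co.
  have cc : ccont (chi a) by near: a.
  have cF : forall i, ccont (fun t => Fe a t i 0).
    by near: a; apply: filterS osc_cont => a [].
  have cB := Bform_cont b m co co.
  rewrite (@cmean_ext _ _ _ (fun t => Fe a t m 0 * chi a t -
     2^-1 * (Bform b (o a t) (o a t) m 0 * chi a t))); last first.
    by move=> t; move: (Bform b _ _) => B; rewrite !mxE mulrBl mulrA.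
  rewrite cmeanB; [|exact: ccontM|by apply: ccontZ; exact: ccontM].
  rewrite cmeanZ; last exact: ccontM.
  rewrite cmean_Bform // -[LHS]addrA !mxE; congr (_ + _).
  rewrite addrC -mulrBr -mulrN; congr (_ * _).
  rewrite -sumrB -sumrN; apply: eq_bigr => j _.
  rewrite -sumrB -sumrN; apply: eq_bigr => k _.
  by rewrite mulrBr addrAC subrr add0r.
apply: bO_add; last first.
  by apply: bO_scale; do 2!apply: bO_sum => ?; apply: bO_scale; exact: hd.
apply: bO_cmean; first exact: near_T.
  near=> a; apply: ccontM; last by near: a.
  have co : forall i, ccont (fun t => o a t i 0) by near: a; exact: near_co.
  have cF : forall i, ccont (fun t => Fe a t i 0).
    by near: a; apply: filterS osc_cont => a [].
  apply: (@ccont_ext _ (fun t => Fe a t m 0 - 2^-1 * Bform b (o a t) (o a t) m 0)).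
    by apply: ccontB => //; apply: ccontZ; exact: Bform_cont.
  by move=> t; move: (Bform b _ _) => B; rewrite !mxE.
by apply: (bO_le _ (Fe_taylor m)); apply: nearW => a t; rewrite cmodM h1 mulr1.
Unshelve. all: by end_near. Qed.

(** The constant part of the square of the critical mode consists of two cross
    terms, equal by symmetry of b; together they cancel the factor 1/2. *)
Lemma f0_leading : vbO F (fun a => kap a * M a ^+ 2)
  (fun a (_ : R) => f0 a - (al a * (al a)^*) *: Bform b q qb).
Proof.
have cc1 : \forall a \near F, ccont (fun _ : R => 1 : R[i]).
  by apply: nearW => a; exact: ccont_cst.
have := even_mode (chi := fun _ _ => 1) cmod_one cc1 mean_oo0.
apply: vbO_near; apply: nearW => a _; congr (_ - _); apply/colP => m.
rewrite !mxE !mulr_sumr.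
have two : 2 != 0 :> R[i] by rewrite pnatr_eq0.
apply: (mulfI two); rewrite !mulr_sumr [2]mulr2n.
under eq_bigr => j _ do rewrite mulrA mulfV // mul1r.
have -> : \sum_j \sum_k b m j k * (al a * (al a)^* * (q k 0 * qb j 0 + qb k 0 * q j 0)) =
   al a * (al a)^* * (\sum_j \sum_k b m j k * q k 0 * qb j 0) +
   al a * (al a)^* * (\sum_j \sum_k b m j k * qb k 0 * q j 0).
  rewrite -mulrDr -big_split mulr_sumr; apply: eq_bigr => j _ /=.
  by rewrite -big_split mulr_sumr; apply: eq_bigr => k _ /=; ring.
have -> : \sum_j \sum_k b m j k * qb k 0 * q j 0 = \sum_j \sum_k b m j k * q k 0 * qb j 0.
  rewrite exchange_big; apply: eq_bigr => j _; apply: eq_bigr => k _ /=.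
  by rewrite b_sym mulrAC.
by rewrite -mulr_sumr -mulr_sumr mulrDl mul1r.
Qed.

Lemma f2_leading : vbO F (fun a => kap a * M a ^+ 2)
  (fun a (_ : R) => f2 a - (2^-1 * al a ^+ 2) *: Bform b q q).
Proof.
have := even_mode cmod_Ec2 near_cEc2 mean_oo2.
apply: vbO_near; apply: nearW => a _; congr (_ - _); apply/colP => m.
rewrite !mxE -mulrA; congr (_ * _); rewrite mulr_sumr; apply: eq_bigr => j _.
by rewrite mulr_sumr; apply: eq_bigr => k _; ring.
Qed.

Lemma even_mode_eq : \forall a \near F,
  A *m u0 a + (D a *m u0 a + f0 a) = 0 /\
  A *m u2 a + (D a *m u2 a + f2 a) = (2 * iW a) *: u2 a.
Proof.
near=> a.
have [T0 _ _ _ de_' _ _ _ _ cFe _] : oscillation A (D a) (T a) (W a) (M a) (o a) (e a) (Fo a) (Fe a).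
  by near: a.
have [_ per] : (forall t, o a (t + T a) = o a t) /\ (forall t, e a (t + T a) = e a t).
  by near: a; exact: osc_periodic.
have eE : E a (T a) = E a 0 by near: a; exact: E_end.
split.
  have d1 : cder (fun _ : R => 1 : R[i]) (fun t => 0 * 1).
    by apply: (cder_ext (cder_cst 1)) => // t; rewrite mul0r.
  by have := vmode_eq T0 de_' cFe per d1 erefl; rewrite scale0r addr0.
have d2 : cder (fun t => Ec a t ^+ 2) (fun t => - (2 * iW a) * Ec a t ^+ 2).
  by apply: (cder_ext (cderM (cder_Ec a) (cder_Ec a))) => // t; ring.
have eE2 : Ec a (T a) ^+ 2 = Ec a 0 ^+ 2 by rewrite /Ec eE.
have := vmode_eq T0 de_' cFe per d2 eE2.
by move/eqP; rewrite scaleNr subr_eq0 => /eqP.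
Unshelve. all: by end_near. Qed.

Lemma u0_bO : vbO F (fun a => M a ^+ 2) (fun a (_ : R) => u0 a).
Proof.
apply: (vmode_bO (chi := fun _ _ => 1)) cmod_one bO_e2.
by apply: filterS near_ce => a ce; split => //; exact: ccont_cst.
Qed.

Lemma u2_bO : vbO F (fun a => M a ^+ 2) (fun a (_ : R) => u2 a).
Proof.
apply: (vmode_bO (chi := fun a t => Ec a t ^+ 2)) cmod_Ec2 bO_e2.
by apply: filterS2 near_ce near_cEc2 => a ce cc; split.
Qed.

Lemma gauge_de2 : \forall a \near F, `|de a * M a ^+ 2| <= `|kap a * M a ^+ 2|.
Proof.
apply: gauge_le => a M0 M1 d0 d1.
by rewrite mulr_ge0 ?sqr_ge0 //= ler_wpM2r ?sqr_ge0 // lerDr sqr_ge0.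
Qed.

(** The zeroth harmonic solves A u0 = - f0 - D u0, in which D u0 is of higher
    order. *)
Lemma u0_leading : vbO F (fun a => kap a * M a ^+ 2)
  (fun a (_ : R) => u0 a - (al a * (al a)^*) *: h0).
Proof.
apply: (@vbO_near _ _ _ _ _ (fun a (_ : R) =>
   invmx A *m (- (D a *m u0 a) - (f0 a - (al a * (al a)^*) *: Bform b q qb)))).
  apply: filterS even_mode_eq => a [e0 _] _.
  rewrite -[RHS](mulKmx A_unit); congr (_ *m _).
  rewrite mulmxBr -scalemxAr h0E.
  have -> : A *m u0 a = - (D a *m u0 a + f0 a) by apply/eqP; rewrite -addr_eq0 e0.
  move: (D a *m u0 a) (f0 a) (Bform b q qb) => X Y Z.
  by apply/colP => i; rewrite !mxE; ring.
apply: vbO_mul; apply: vbO_add; last by apply: vbO_opp; exact: f0_leading.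
by apply: vbO_opp; apply: vbO_gauge gauge_de2 (vbO_mulf bO_D u0_bO).
Qed.

(** As for the zeroth harmonic, with 2 iW - A in place of - A; replacing W by
    w costs a relative error kap by [frequency_shift]. *)
Lemma u2_leading : vbO F (fun a => kap a * M a ^+ 2)
  (fun a (_ : R) => u2 a - (2^-1 * al a ^+ 2) *: h2).
Proof.
apply: (@vbO_near _ _ _ _ _ (fun a (_ : R) =>
   invmx ((2 * iw)%:M - A) *m (D a *m u2 a + (f2 a - (2^-1 * al a ^+ 2) *: Bform b q q)
      + (2 * (iw - iW a)) *: u2 a))).
  apply: filterS even_mode_eq => a [_ e2_] _.
  rewrite -[RHS](mulKmx A2_unit); congr (_ *m _).
  rewrite mulmxBr -scalemxAr h2E mulmxBl mul_scalar_mx.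
  have -> : A *m u2 a = (2 * iW a) *: u2 a - (D a *m u2 a + f2 a).
    by rewrite -e2_ addrK.
  move: (D a *m u2 a) (f2 a) (Bform b q q) (u2 a) (iW a) iw => X Y Z U s s'.
  by apply/colP => i; rewrite !mxE; ring.
apply: vbO_mul; apply: vbO_add.
  by apply: vbO_add f2_leading; apply: vbO_gauge gauge_de2 (vbO_mulf bO_D u2_bO).
by apply: vbO_scale u2_bO; apply: bO_scale; exact: frequency_shift.
Qed.

(** The resonant cubic terms: the critical mode interacts with the zeroth
    harmonic h0 and, conjugated, with the second harmonic h2, and enters the
    cubic form directly. Paired with p, this is the normal form
    coefficient. *)
Let G := Bform b h0 q + 2^-1 *: Bform b h2 qb + 2^-1 *: Cform c q q qb.

Lemma mean_eo_leading k j : bO F (fun a => kap a * M a ^+ 3) (fun a (_ : R) =>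
  cmean (T a) (fun t => e a t k 0 * o a t j 0 * Ec a t) -
  al a ^+ 2 * (al a)^* * (h0 k 0 * q j 0 + 2^-1 * (h2 k 0 * qb j 0))).
Proof.
apply: (@bO_eq _ _ _ _ _ (fun a (_ : R) =>
  (cmean (T a) (fun t => e a t k 0 * o a t j 0 * Ec a t) -
     (al a * q j 0 * u0 a k 0 + (al a)^* * qb j 0 * u2 a k 0)) +
  (q j 0 * (al a * (u0 a - (al a * (al a)^*) *: h0) k 0) +
   qb j 0 * ((al a)^* * (u2 a - (2^-1 * al a ^+ 2) *: h2) k 0)))).
  move=> a _; move: (u0 a) (u2 a) (cmean _ _) (al a)^* (al a) (qb j 0) => U0 U2 m r s qj.
  by rewrite !mxE; ring.
apply: bO_add (mean_eo k j) _.
have g3 : \forall a \near F, `|M a * (kap a * M a ^+ 2)| <= `|kap a * M a ^+ 3|.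
  by apply: gauge_comm => a; ring.
apply: bO_add; apply: bO_scale; apply: bO_gauge g3 _; apply: bO_mul.
- exact: al_bO.
- exact: u0_leading.
- by apply: bO_conj; exact: al_bO.
- exact: u2_leading.
Qed.

(** Of the eight products of three first modes, three have frequency 1; by
    symmetry of c they coincide, which turns the Taylor coefficient 1/6 into
    1/2. *)
Lemma f1_leading : vbO F (fun a => kap a * M a ^+ 3)
  (fun a (_ : R) => f1 a - (al a ^+ 2 * (al a)^*) *: G).
Proof.
move=> m.
pose d3 a k j l := al a ^+ 2 * (al a)^* *
  (q k 0 * q j 0 * qb l 0 + q k 0 * qb j 0 * q l 0 + qb k 0 * q j 0 * q l 0).
pose d2 a k j := al a ^+ 2 * (al a)^* * (h0 k 0 * q j 0 + 2^-1 * (h2 k 0 * qb j 0)).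
have GE a : ((al a ^+ 2 * (al a)^*) *: G) m 0 =
  \sum_j \sum_k b m j k * d2 a k j + 6^-1 * \sum_j \sum_k \sum_l c m j k l * d3 a k j l.
  have -> : \sum_j \sum_k b m j k * d2 a k j = (al a ^+ 2 * (al a)^*) *
     (\sum_j \sum_k b m j k * h0 k 0 * q j 0 + 2^-1 * \sum_j \sum_k b m j k * h2 k 0 * qb j 0).
    rewrite mulr_sumr -big_split mulr_sumr; apply: eq_bigr => j _ /=.
    rewrite mulr_sumr -big_split mulr_sumr; apply: eq_bigr => k _ /=.
    by rewrite /d2; move: (al a)^* (qb j 0) => r s; ring.
  have s1 : \sum_j \sum_k \sum_l c m j k l * qb k 0 * q j 0 * q l 0 =
      \sum_j \sum_k \sum_l c m j k l * q k 0 * qb j 0 * q l 0.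
    rewrite exchange_big; do 3!apply: eq_bigr => ? _ /=.
    by rewrite c_sym12 [_ * _ * qb _ _]mulrAC.
  have s2 : \sum_j \sum_k \sum_l c m j k l * qb k 0 * q j 0 * q l 0 =
      \sum_j \sum_k \sum_l c m j k l * q k 0 * q j 0 * qb l 0.
    apply: eq_bigr => j _; rewrite exchange_big; do 2!apply: eq_bigr => ? _ /=.
    by rewrite c_sym23; move: (qb _ _) => r; ring.
  have -> : \sum_j \sum_k \sum_l c m j k l * d3 a k j l = (al a ^+ 2 * (al a)^*) *
    (3 * \sum_j \sum_k \sum_l c m j k l * q k 0 * q j 0 * qb l 0).
    have -> : forall S : R[i], 3 * S = S + S + S by move=> S; ring.
    have three (S S' S'' : R[i]) : S'' = S' -> S'' = S -> S + S + S = S + S' + S''.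
      by move=> <- ->.
    rewrite (three _ _ _ s1 s2) -!big_split mulr_sumr; apply: eq_bigr => j _ /=.
    rewrite -!big_split mulr_sumr; apply: eq_bigr => k _ /=.
    rewrite -!big_split mulr_sumr; apply: eq_bigr => l _ /=.
    rewrite /d3; move: (al a)^* (qb _ _) (qb _ _) (qb _ _) => r s t v; ring.
  rewrite /G !mxE.
  have six : 6^-1 * 3 = 2^-1 :> R[i] by field.
  move: (\sum_j _) (\sum_j _) (\sum_j _) (al a ^+ 2 * _) => X Y Z K.
  by rewrite -six; ring.
apply: (@bO_near _ _ _ _ _ (fun a (_ : R) =>
  cmean (T a) (fun t => (Fo a t - (Bform b (e a t) (o a t) + 6^-1 *: Cform c (o a t) (o a t) (o a t))) m 0 * Ec a t) +
  (\sum_j \sum_k b m j k * (cmean (T a) (fun t => e a t k 0 * o a t j 0 * Ec a t) - d2 a k j) +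
   6^-1 * \sum_j \sum_k \sum_l c m j k l *
     (cmean (T a) (fun t => o a t k 0 * o a t j 0 * o a t l 0 * Ec a t) - d3 a k j l)))).
  near=> a => _.
  have co : forall i, ccont (fun t => o a t i 0) by near: a; exact: near_co.
  have ce : forall i, ccont (fun t => e a t i 0) by near: a; exact: near_ce.
  have cc : ccont (Ec a) by near: a; apply: filterS near_cE => a; exact: ccontJ.
  have cF : forall i, ccont (fun t => Fo a t i 0).
    by near: a; apply: filterS osc_cont => a [].
  have cB := Bform_cont b m ce co.
  have cC := Cform_cont c m co co co.
  rewrite (@cmean_ext _ _ _ (fun t => Fo a t m 0 * Ec a t -
     (Bform b (e a t) (o a t) m 0 * Ec a t + 6^-1 * (Cform c (o a t) (o a t) (o a t) m 0 * Ec a t)))); last first.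
    move=> t; move: (Bform b _ _) (Cform c _ _ _) (Ec a t) => B C' X; rewrite !mxE; ring.
  have c1 := ccontM cB cc; have c2 := ccontM cC cc.
  rewrite cmeanB; [|exact: ccontM|by apply: ccontD => //; exact: ccontZ].
  rewrite cmeanD //; last exact: ccontZ.
  rewrite cmeanZ // cmean_Bform // cmean_Cform //.
  have fE : f1 a m 0 = cmean (T a) (fun t => Fo a t m 0 * Ec a t) by rewrite mxE.
  rewrite [RHS]mxE [X in _ = _ + X]mxE GE fE.
  have -> : \sum_j \sum_k b m j k * (cmean (T a) (fun t => e a t k 0 * o a t j 0 * Ec a t) - d2 a k j) =
    \sum_j \sum_k b m j k * cmean (T a) (fun t => e a t k 0 * o a t j 0 * Ec a t) -
    \sum_j \sum_k b m j k * d2 a k j.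
    by rewrite -sumrB; apply: eq_bigr => j _; rewrite -sumrB; apply: eq_bigr => k _; rewrite mulrBr.
  have -> : \sum_j \sum_k \sum_l c m j k l *
     (cmean (T a) (fun t => o a t k 0 * o a t j 0 * o a t l 0 * Ec a t) - d3 a k j l) =
     \sum_j \sum_k \sum_l c m j k l * cmean (T a) (fun t => o a t k 0 * o a t j 0 * o a t l 0 * Ec a t)
     - \sum_j \sum_k \sum_l c m j k l * d3 a k j l.
    rewrite -sumrB; apply: eq_bigr => j _; rewrite -sumrB; apply: eq_bigr => k _.
    by rewrite -sumrB; apply: eq_bigr => l _; rewrite mulrBr.
  move: (\sum_j \sum_k b m j k * d2 a k j) (\sum_j \sum_k \sum_l c m j k l * d3 a k j l).
  move: (\sum_j _) (\sum_j _) (cmean _ _) => X1 X2 X3 X4 X5; ring.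
apply: bO_add.
  apply: bO_cmean; first exact: near_T.
    near=> a; apply: ccontM; last by near: a; apply: filterS near_cE => a; exact: ccontJ.
    have co : forall i, ccont (fun t => o a t i 0) by near: a; exact: near_co.
    have ce : forall i, ccont (fun t => e a t i 0) by near: a; exact: near_ce.
    have cF : forall i, ccont (fun t => Fo a t i 0).
      by near: a; apply: filterS osc_cont => a [].
    apply: (@ccont_ext _ (fun t => Fo a t m 0 - (Bform b (e a t) (o a t) m 0 +
       6^-1 * Cform c (o a t) (o a t) (o a t) m 0))).
      apply: ccontB => //; apply: ccontD; first exact: Bform_cont.
      by apply: ccontZ; exact: Cform_cont.
    by move=> t; move: (Bform b _ _) (Cform c _ _ _) => B C'; rewrite !mxE.
  by apply: (bO_le _ (Fo_taylor m)); apply: nearW => a t; rewrite cmodM cmodEc1 mulr1.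
apply: bO_add.
  by do 2!apply: bO_sum => ?; apply: bO_scale; exact: mean_eo_leading.
by apply: bO_scale; do 3!apply: bO_sum => ?; apply: bO_scale; exact: mean_ooo.
Unshelve. all: by end_near. Qed.

(** Here dl stands for the displacement of the critical eigenvalue, with real
    part mu, which to first order is the pairing of p with D q. *)
Variables (mu : R -> R) (dl : R -> R[i]).
Hypothesis dl_mu : \forall a \near F, Re (dl a) = mu a.
Hypothesis dl_D : bO F (fun a => de a ^+ 2) (fun a (_ : R) => inner p (D a *m q) - dl a).

(** The amplitude equation of the Hopf normal form for a periodic motion of
    frequency W: [amplitude_eq] with the first mode and its forcing replaced
    by their leading terms. *)
Lemma amplitude_balance : bO F (fun a => kap a ^+ 2 * M a) (fun a (_ : R) =>
  (iW a - iw) * al a - (dl a * al a + al a ^+ 2 * (al a)^* * inner p G)).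
Proof.
apply: (@bO_near _ _ _ _ _ (fun a (_ : R) =>
  al a * (inner p (D a *m q) - dl a) + inner p (D a *m w1 a) +
  inner p (f1 a - (al a ^+ 2 * (al a)^*) *: G))).
  apply: filterS amplitude_eq => a -> _.
  have {1}-> : u1 a = al a *: q + w1 a by rewrite /w1 addrC subrK.
  have Dw (v : vec) : D a *m (al a *: q + v) = al a *: (D a *m q) + D a *m v.
    by rewrite mulmxDr -scalemxAr.
  rewrite [inner p (f1 a - _)]innerB Dw innerD !innerZ.
  move: (inner p (f1 a)) (inner p G) (inner p _) (inner p _) (al a)^* => X1 X2 X3 X4 X5.
  ring.
have k2 : \forall a \near F, `|M a * de a ^+ 2| <= `|kap a ^+ 2 * M a|.
  apply: gauge_le => a M0 M1 d0 d1; have M0' := ltW M0.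
  rewrite mulr_ge0 ?exprn_ge0 //= mulrC ler_wpM2r // lerXn2r ?nnegrE //.
    by rewrite addr_ge0 // sqr_ge0.
  by rewrite lerDr sqr_ge0.
apply: bO_add; [apply: bO_add|].
- by apply: bO_gauge k2 (bO_mul al_bO dl_D).
- apply: bO_inner; apply: vbO_gauge (vbO_mulf bO_D w1_bO).
  apply: gauge_le => a M0 M1 d0 d1; have M0' := ltW M0.
  have k0 : 0 <= kap a by rewrite addr_ge0 // sqr_ge0.
  rewrite !mulr_ge0 //= expr2 -mulrA ler_wpM2r ?mulr_ge0 // lerDr sqr_ge0 //.
- apply: bO_inner; apply: vbO_gauge f1_leading.
  apply: gauge_le => a M0 M1 d0 d1; have M0' := ltW M0.
  have k0 : 0 <= kap a by rewrite addr_ge0 // sqr_ge0.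
  rewrite mulr_ge0 ?exprn_ge0 //= expr2 -mulrA ler_wpM2l // exprSr ler_wpM2r //.
  by rewrite lerDl.
Qed.

Let rho a := cmod (al a) ^+ 2.

Lemma al_rho a : al a * (al a)^* = (rho a)%:C%C.
Proof. exact: cmod_mulJ. Qed.

Lemma rho_lower : exists2 C : R, 0 < C & \forall a \near F, M a ^+ 2 <= C * rho a.
Proof.
have [C C0 hC] := amplitude_lower.
exists (C ^+ 2); first by rewrite exprn_gt0.
apply: filterS2 gauges_good hC => a [M0 M1 d0 d1] h.
rewrite /rho -exprMn lerXn2r ?nnegrE //; first exact: ltW.
by rewrite mulr_ge0 ?cmod_ge0 // ltW.
Qed.

(** Dividing the amplitude balance by al and taking real parts eliminates the
    unknown frequency, since i (W - w) is imaginary. *)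
Lemma amplitude_law : exists2 K : R, 0 < K &
  \forall a \near F, `|mu a + Re (inner p G) * rho a| <= K * kap a ^+ 2.
Proof.
have [K K0 hK] := bO_pos amplitude_balance.
have [C C0 hC] := amplitude_lower.
exists (K * C); first exact: mulr_gt0.
near=> a.
have [M0 M1 d0 d1] : [/\ 0 < M a, M a <= 1, 0 <= de a & de a <= 1] by near: a; exact: gauges_good.
have hCa : M a <= C * cmod (al a) by near: a.
have hKa : forall s : R, cmod ((iW a - iw) * al a -
   (dl a * al a + al a ^+ 2 * (al a)^* * inner p G)) <= K * `|kap a ^+ 2 * M a| by near: a.
have dmu : Re (dl a) = mu a by near: a.
have k0 : 0 <= kap a by rewrite addr_ge0 // sqr_ge0.
have al0 : 0 < cmod (al a).
  by have := lt_le_trans M0 hCa; rewrite pmulr_rgt0.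
have r0 : 0 < rho a by rewrite exprn_gt0.
rewrite -(ler_pM2r r0).
have E0 : ((iW a - iw) * al a - (dl a * al a + al a ^+ 2 * (al a)^* * inner p G)) * (al a)^*
  = ((iW a - iw) - (dl a + (rho a)%:C%C * inner p G)) * (rho a)%:C%C.
  by rewrite -al_rho; move: (inner p G) (al a)^* => X Y; ring.
have ReE : Re ((iW a - iw) - (dl a + (rho a)%:C%C * inner p G)) = - (mu a + Re (inner p G) * rho a).
  have Re_i (r : R) : Re ('i%C * r%:C%C) = 0.
    by rewrite cReM /= mul0r mulr0 subrr.
  have ReZ (r : R) (z : R[i]) : Re (r%:C%C * z) = r * Re z.
    by rewrite cReM /= mul0r subr0.
  by rewrite !cReD !cReN cReD ReZ dmu !Re_i subrr add0r mulrC.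
rewrite -[X in _ * X <= _](gtr0_norm r0) -normrM -normrN -mulNr -ReE.
have -> : Re ((iW a - iw) - (dl a + (rho a)%:C%C * inner p G)) * rho a =
   Re (((iW a - iw) - (dl a + (rho a)%:C%C * inner p G)) * (rho a)%:C%C).
  by rewrite cReM /= mulr0 subr0.
rewrite -E0; apply: (le_trans (cmod_Re _)); rewrite cmodM cmodJ.
apply: (@le_trans _ _ (K * `|kap a ^+ 2 * M a| * cmod (al a))).
  by rewrite ler_wpM2r ?cmod_ge0 //; exact: hKa.
rewrite normrM (ger0_norm (ltW M0)) (ger0_norm (exprn_ge0 2 k0)) /rho.
rewrite [cmod _ ^+ 2]expr2 !mulrA ler_wpM2r ?cmod_ge0 //.
rewrite -!mulrA ler_pM2l //.
have -> : C * (kap a * (kap a * cmod (al a))) = kap a * (kap a * (C * cmod (al a))) by ring.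
by do 2!rewrite ler_wpM2l //.
Unshelve. all: by end_near. Qed.

Hypothesis nondegenerate : Re (inner p G) != 0.
Hypothesis de_mu : exists2 C : R, 0 < C & \forall a \near F, de a <= C * `|mu a|.

Lemma kap_small (y : R) : 0 < y -> \forall a \near F, kap a < y.
Proof.
move=> y0; have y2 : 0 < y / 2 by rewrite divr_gt0.
apply: filterS3 (M_small y2) (de_small y2) gauges_good => a hM hd [M0 M1 d0 d1].
rewrite /kap [y]splitr ltrD // (le_lt_trans _ hM) // expr2 ler_piMr // ltW //.
Qed.

(** The amplitude law bounds |al|^2, hence M^2, by |mu| + kap^2 up to a
    constant, and de is of order mu by assumption; as kap tends to 0, the term
    kap^2 is absorbed. *)
Lemma kap_mu : exists2 C : R, 0 < C & \forall a \near F, kap a <= C * `|mu a|.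
Proof.
have [C1 C10 h1] := rho_lower.
have [K K0 hK] := amplitude_law.
have [C2 C20 hd] := de_mu.
set g := Re (inner p G) in hK.
have g0 : 0 < `|g| by rewrite normr_gt0.
pose y := `|g| / (2 * C1 * K).
have y0 : 0 < y by rewrite divr_gt0 // !mulr_gt0.
exists (2 * (C1 / `|g| + C2)); first by rewrite mulr_gt0 // addr_gt0 // divr_gt0.
apply: filterS (filterI h1 (filterI hK (filterI hd (filterI (kap_small y0) gauges_good)))).
move=> a [{}h1 [{}hK [{}hd [ky [M0 M1 d0 d1]]]]].
have k0 : 0 <= kap a by rewrite addr_ge0 // sqr_ge0.
have r0 : 0 <= rho a by rewrite exprn_ge0 // cmod_ge0.
have hr : `|g| * rho a <= `|mu a| + K * kap a ^+ 2.
  rewrite -[rho a](ger0_norm r0) -normrM.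
  have -> : g * rho a = (mu a + g * rho a) - mu a by ring.
  by rewrite (le_trans (ler_normB _ _)) // addrC lerD2l.
have hk2 : C1 / `|g| * (K * kap a ^+ 2) <= 2^-1 * kap a.
  rewrite expr2 !mulrA ler_wpM2r //.
  apply: (@le_trans _ _ (C1 / `|g| * K * y)); first by rewrite ler_wpM2l ?(ltW ky) // !mulr_ge0 ?invr_ge0 // ltW.
  have g' : `|g| != 0 by rewrite gt_eqF.
  have C1' : C1 != 0 by rewrite gt_eqF.
  have K' : K != 0 by rewrite gt_eqF.
  have -> : C1 / `|g| * K * y = 2^-1 by rewrite /y; move: `|g| g' => gg g'; field; rewrite g' C1' K'.
  by [].
have hM : M a ^+ 2 <= C1 / `|g| * `|mu a| + C1 / `|g| * (K * kap a ^+ 2).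
  apply: (le_trans h1); rewrite -mulrDr -mulrA ler_pM2l // mulrC ler_pdivlMr // mulrC //.
have : kap a <= C1 / `|g| * `|mu a| + 2^-1 * kap a + C2 * `|mu a|.
  by rewrite {1}/kap lerD // (le_trans hM) // lerD2l.
rewrite -mulrA mulrDl; lra.
Qed.

(** Up to errors kap^2, hence mu^2, the mean is |al|^2 h0 and the amplitude
    law gives |al|^2 = - mu / Re G. *)
Lemma mean_leading : vbO F (fun a => mu a ^+ 2)
  (fun a (_ : R) => u0 a + ((mu a / Re (inner p G))%:C%C) *: h0).
Proof.
have [C C0 hC] := kap_mu.
have [K K0 hK] := amplitude_law.
have gk : \forall a \near F, `|kap a ^+ 2| <= C ^+ 2 * `|mu a ^+ 2|.
  apply: filterS2 hC gauges_good => a h [M0 M1 d0 d1].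
  have k0 : 0 <= kap a by rewrite addr_ge0 // sqr_ge0.
  rewrite !normrX -exprMn lerXn2r ?nnegrE //; first by rewrite mulr_ge0 // ltW.
  by rewrite ger0_norm.
move=> i; apply: (bO_weak gk).
apply: (@bO_eq _ _ _ _ _ (fun a (_ : R) => (u0 a - (al a * (al a)^*) *: h0) i 0 +
   (rho a + mu a / Re (inner p G))%:C%C * h0 i 0)).
  move=> a _; rewrite al_rho rmorphD /=; move: (u0 a) ((rho a)%:C%C) ((mu a / _)%:C%C) => U r s.
  by rewrite !mxE; ring.
apply: bO_add.
  apply: bO_gauge (u0_leading i); apply: gauge_le => a M0 M1 d0 d1.
  have k0 : 0 <= kap a by rewrite addr_ge0 // sqr_ge0.
  rewrite mulr_ge0 ?sqr_ge0 //= [kap a ^+ 2]expr2 ler_wpM2l // lerDl //.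
apply: bO_mulr; last exact: bO_const.
exists (K / `|Re (inner p G)|).
have g0 : 0 < `|Re (inner p G)| by rewrite normr_gt0.
apply: filterS hK => a h _; rewrite cmodC mulrAC ler_pdivlMr // -normrM mulrDl mulfVK //.
rewrite addrC [rho a * _]mulrC (le_trans h) // ler_wpM2l ?ler_norm // ltW //.
Qed.

End HarmonicBalance.

(** * Even and odd combinations of Taylor expansions *)

Section CentralTaylor.
Variables (R : realType) (V : normedModType R) (g : V -> R) (cs : V) (r K : R).
Hypothesis sg : smooth g.
Hypothesis K0 : 0 <= K.
Hypothesis g_bound : forall y, `|cs - y| < r -> forall vs, (1 < size vs <= 5)%N ->
  `|Dseq vs g y| <= K * \prod_(v <- vs) `|v|.

Lemma Dseq_nseqN k (v : V) x : Dseq (nseq k (- v)) g x = (-1) ^+ k * Dseq (nseq k v) g x.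
Proof.
elim: k x => [|k IH] x; first by rewrite mul1r.
rewrite /= (_ : Dseq (nseq k (- v)) g = (-1) ^+ k \*: Dseq (nseq k v) g); last first.
  by apply/funext => y; rewrite IH.
have ds w : derivable (Dseq (nseq k v) g) x w.
  by apply: smooth_derivable; exact: smooth_Dseq.
have Nv : - v = (-1) *: v by rewrite scaleN1r.
rewrite deriveZ // Nv smooth_deriveZ; last exact: smooth_Dseq.
have sc (a b : R) : a *: b = a * b by [].
by rewrite sc mulrA exprSr.
Qed.

Lemma segment_ball (c v : V) s : 0 <= s <= 1 -> `|cs - c| + `|v| < r ->
  `|cs - (c + s *: v)| < r.
Proof.
move=> /andP[s0 s1]; apply: le_lt_trans.
rewrite opprD addrA (le_trans (ler_normB _ _)) // lerD2l normrZ ger0_norm //.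
by rewrite ler_piMl.
Qed.

Lemma Dseq_close (c v : V) vs : `|cs - c| + `|v| < r -> (0 < size vs < 5)%N ->
  `|Dseq vs g (c + v) - Dseq vs g c| <= K * (`|v| * \prod_(u <- vs) `|u|).
Proof.
move=> h sz.
have [s s01 ->] := @line_mvt _ _ (Dseq vs g) c v
  (fun y => @smooth_derivable _ _ _ y v (smooth_Dseq vs sg)).
have := g_bound (segment_ball s01 h) (vs := v :: vs).
by rewrite big_cons /=; apply.
Qed.

Lemma taylor_at (c v : V) m : `|cs - c| + `|v| < r -> (1 < m <= 5)%N ->
  `|g (c + v) - \sum_(k < m) k`!%:R^-1 * Dseq (nseq k v) g c| <= K * `|v| ^+ m.
Proof.
move=> h hm.
have := @taylor_bound R V m g c v (K * `|v| ^+ m) sg.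
have hs s : 0 <= s <= 1 -> `|Dseq (nseq m v) g (c + s *: v)| <= K * `|v| ^+ m.
  move=> s01; have := g_bound (segment_ball s01 h) (vs := nseq m v).
  by rewrite size_nseq hm big_nseq iter_mulr_1; apply.
move=> /(_ hs 1); rewrite lexx ler01 scale1r => /(_ isT).
rewrite (eq_bigr (fun k : 'I_m => k`!%:R^-1 * Dseq (nseq k v) g c)) // => k _.
by rewrite expr1n mul1r.
Qed.

Lemma ball_sub (c E O : V) : `|cs - c| + `|E| + `|O| < r ->
  `|cs - (c + E)| + `|O| < r /\ `|cs - (c + E)| + `|- O| < r.
Proof.
move=> h; rewrite normrN; suff h' : `|cs - (c + E)| + `|O| < r by [].
apply: le_lt_trans h; rewrite lerD2r opprD addrA.
exact: ler_normB.
Qed.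

Lemma exp_sum2 (a : nat -> R) : \sum_(k < 2) k`!%:R^-1 * a k = a 0%N + a 1%N.
Proof. by rewrite !big_ord_recr big_ord0 /= add0r !invr1 !mul1r. Qed.

Lemma exp_sum4 (a : nat -> R) : \sum_(k < 4) k`!%:R^-1 * a k =
  a 0%N + a 1%N + 2^-1 * a 2%N + 6^-1 * a 3%N.
Proof. by rewrite !big_ord_recr big_ord0 /= add0r !invr1 !mul1r. Qed.

Lemma exp_sum5 (a : nat -> R) : \sum_(k < 5) k`!%:R^-1 * a k =
  a 0%N + a 1%N + 2^-1 * a 2%N + 6^-1 * a 3%N + 24^-1 * a 4%N.
Proof. by rewrite !big_ord_recr big_ord0 /= add0r !invr1 !mul1r. Qed.

Lemma sign_sum m (v : V) x : \sum_(k < m) k`!%:R^-1 * Dseq (nseq k (- v)) g x =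
  \sum_(k < m) k`!%:R^-1 * ((-1) ^+ k * Dseq (nseq k v) g x).
Proof. by apply: eq_bigr => k _; rewrite Dseq_nseqN. Qed.

(** Derivatives are abstracted to variables, so that only linear arithmetic is
    left of the two expansions. *)
Lemma even_arith (gp gm gE dE d1 d2 d3 d2s k1 k2 k3 : R) :
  `|gp - (gE + d1 + 2^-1 * d2 + 6^-1 * d3)| <= k2 ->
  `|gm - ((-1) ^+ 0 * gE + (-1) ^+ 1 * d1 + 2^-1 * ((-1) ^+ 2 * d2) + 6^-1 * ((-1) ^+ 3 * d3))| <= k2 ->
  `|gE - (0 + dE)| <= k1 -> `|d2 - d2s| <= k3 ->
  `|2^-1 * (gp + gm) - dE - 2^-1 * d2s| <= k1 + k2 + k3.
Proof.
rewrite expr0 expr1 -[(-1) ^+ 2]/((-1) * (-1)) -[(-1)^+3]/((-1) * ((-1) * (-1))).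
rewrite !ler_norml => /andP[t1 t1'] /andP[t2 t2'] /andP[t3 t3'] /andP[t4a t4b].
by apply/andP; split; lra.
Qed.

Lemma odd_arith (gp gm gE d1 d2 d3 d4 d1c d2c d2s d3s k1 k2 k3 k4 : R) :
  `|gp - (gE + d1 + 2^-1 * d2 + 6^-1 * d3 + 24^-1 * d4)| <= k1 ->
  `|gm - ((-1) ^+ 0 * gE + (-1) ^+ 1 * d1 + 2^-1 * ((-1) ^+ 2 * d2) + 6^-1 * ((-1) ^+ 3 * d3)
     + 24^-1 * ((-1) ^+ 4 * d4))| <= k1 ->
  `|d1 - (d1c + d2c)| <= k2 -> `|d2c - d2s| <= k3 -> `|d3 - d3s| <= k4 ->
  `|2^-1 * (gp - gm) - d1c - (d2s + 6^-1 * d3s)| <= k1 + k2 + k3 + k4.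
Proof.
rewrite expr0 expr1 -[(-1) ^+ 2]/((-1) * (-1)) -[(-1)^+3]/((-1) * ((-1) * (-1))).
rewrite -[(-1)^+4]/((-1) * ((-1) * ((-1) * (-1)))).
rewrite !ler_norml => /andP[t1 t1'] /andP[t2 t2'] /andP[t3 t3'] /andP[t4a t4b] /andP[t5a t5b].
by apply/andP; split; lra.
Qed.

(** In the half sum of the expansions at c + E along O and - O the odd orders
    cancel; the value at c + E is expanded at c, and the second derivative is
    moved to the fixed point cs. *)
Lemma even_taylor (c E O : V) : `|cs - c| + `|E| + `|O| < r -> g c = 0 -> 
  `|2^-1 * (g (c + E + O) + g (c + E - O)) - 'D_E g c -
    2^-1 * 'D_O (fun y => 'D_O g y) cs| <=
   K * (`|E| ^+ 2 + `|O| ^+ 4 + (`|E| + `|cs - c|) * `|O| ^+ 2).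
Proof.
move=> h gc; have [h1 h2] := ball_sub h.
have t1 := taylor_at h1 (isT : (1 < 4 <= 5)%N).
have t2 := taylor_at h2 (isT : (1 < 4 <= 5)%N).
have hE : `|cs - c| + `|E| < r by apply: le_lt_trans h; rewrite lerDl.
have t3 := taylor_at hE (isT : (1 < 2 <= 5)%N).
have hc : `|cs - cs| + `|c + E - cs| < r.
  rewrite subrr normr0 add0r distrC; apply: le_lt_trans h1; by rewrite lerDl.
have t4 := Dseq_close hc (isT : (0 < size [:: O; O] < 5)%N).
rewrite (addrC cs) subrK in t4.
have ce : `|c + E - cs| <= `|E| + `|cs - c|.
  have -> : c + E - cs = E - (cs - c) by rewrite opprB addrA (addrC E).
  exact: ler_normB.
rewrite sign_sum normrN in t2.
rewrite (exp_sum4 (fun k => (-1) ^+ k * Dseq (nseq k O) g (c + E))) in t2.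
rewrite (exp_sum4 (fun k => Dseq (nseq k O) g (c + E))) in t1.
rewrite (exp_sum2 (fun k => Dseq (nseq k E) g c)) in t3.
rewrite !big_cons big_nil mulr1 in t4.
rewrite [Dseq (nseq 0 E) g c]gc in t3.
have t4' : `|Dseq [:: O; O] g (c + E) - Dseq [:: O; O] g cs| <=
    K * ((`|E| + `|cs - c|) * `|O| ^+ 2).
  by rewrite expr2; apply: (le_trans t4); rewrite ler_wpM2l // ler_wpM2r // mulr_ge0.
rewrite !(mulrDr K); exact: even_arith t1 t2 t3 t4'.
Qed.

(** In the half difference the even orders cancel. The first derivative along
    O at c + E, expanded at c, produces the mixed second derivative; second
    and third derivatives are then moved to cs. *)
Lemma odd_taylor (c E O : V) : `|cs - c| + `|E| + `|O| < r ->
  `|2^-1 * (g (c + E + O) - g (c + E - O)) - 'D_O g c -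
    ('D_O (fun y => 'D_E g y) cs + 6^-1 * 'D_O (fun y => 'D_O (fun z => 'D_O g z) y) cs)| <=
   K * (`|O| ^+ 5 + `|E| ^+ 2 * `|O| + `|cs - c| * (`|E| * `|O|) +
      (`|E| + `|cs - c|) * `|O| ^+ 3).
Proof.
move=> h; have [h1 h2] := ball_sub h.
have t1 := taylor_at h1 (isT : (1 < 5 <= 5)%N).
have t2 := taylor_at h2 (isT : (1 < 5 <= 5)%N).
have hE : `|cs - c| + `|E| < r by apply: le_lt_trans h; rewrite lerDl.
have hc : `|cs - cs| + `|c + E - cs| < r.
  rewrite subrr normr0 add0r distrC; apply: le_lt_trans h1; by rewrite lerDl.
have t4 := Dseq_close hc (isT : (0 < size [:: O; O; O] < 5)%N).
rewrite (addrC cs) subrK in t4.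
have hc' : `|cs - cs| + `|c - cs| < r.
  rewrite subrr normr0 add0r distrC; apply: le_lt_trans hE; by rewrite lerDl.
have t5 := Dseq_close hc' (isT : (0 < size [:: O; E] < 5)%N).
rewrite (addrC cs) subrK in t5.
have t3 : `|'D_O g (c + E) - ('D_O g c + 'D_O (fun y => 'D_E g y) c)| <= K * (`|E| ^+ 2 * `|O|).
  have := @taylor_bound R V 2 (fun y => 'D_O g y) c E (K * (`|E| ^+ 2 * `|O|)) (smoothD O sg).
  have hs s : 0 <= s <= 1 -> `|Dseq (nseq 2 E) (fun y => 'D_O g y) (c + s *: E)| <= K * (`|E| ^+ 2 * `|O|).
    move=> s01; have := g_bound (segment_ball s01 hE) (vs := [:: E; E; O]).
    by rewrite !big_cons big_nil mulr1 expr2 -mulrA; apply.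
  move=> /(_ hs 1); rewrite lexx ler01 scale1r => /(_ isT).
  rewrite !big_ord_recl !big_ord0 /= /bump /= !addr0.
  do 2!rewrite -[_`!]/1%N.
  by rewrite !expr1n !divr1 !mul1r (derive_comm _ _ _ sg).
have ce : `|c + E - cs| <= `|E| + `|cs - c|.
  have -> : c + E - cs = E - (cs - c) by rewrite opprB addrA (addrC E).
  exact: ler_normB.
rewrite sign_sum normrN in t2.
rewrite (exp_sum5 (fun k => (-1) ^+ k * Dseq (nseq k O) g (c + E))) in t2.
rewrite (exp_sum5 (fun k => Dseq (nseq k O) g (c + E))) in t1.
rewrite !big_cons big_nil mulr1 in t4.
rewrite !big_cons big_nil mulr1 in t5.
have t4' : `|Dseq [:: O; O; O] g (c + E) - Dseq [:: O; O; O] g cs| <=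
    K * ((`|E| + `|cs - c|) * `|O| ^+ 3).
  apply: (le_trans t4); rewrite ler_wpM2l // -[_ ^+ 3]/(`|O| * (`|O| * `|O|)).
  by rewrite ler_wpM2r // !mulr_ge0.
have t5' : `|Dseq [:: O; E] g c - Dseq [:: O; E] g cs| <= K * (`|cs - c| * (`|E| * `|O|)).
  by apply: (le_trans t5); rewrite ler_wpM2l // distrC [`|E| * _]mulrC.
rewrite !(mulrDr K); exact: odd_arith t1 t2 t3 t5' t4'.
Qed.

End CentralTaylor.

(** * Simple eigenvalues *)

Section SimpleEigenvalue.

(** The matrix determinant lemma in a form free of division, obtained by
    eliminating either block of the matrix with rows (x, - u) and (v, 1). *)
Lemma det_rank1 (K : comNzRingType) n (x : K) (u : 'cV[K]_n) (v : 'rV[K]_n) :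
  x * \det (x%:M + u *m v) = x ^+ n * (x + (v *m u) 0 0).
Proof.
pose M := block_mx (x%:M : 'M[K]_n) (- u) v (1%:M : 'M[K]_1).
have e1 : \det (x%:M + u *m v) = \det M.
  have -> : \det M = \det (M *m block_mx 1%:M 0 (- v) 1%:M).
    by rewrite det_mulmx det_lblock !det1 !mulr1.
  rewrite mulmx_block !mulmx1 !mulmx0 !mul1mx mulmxN mulNmx opprK !add0r.
  by rewrite addrN det_ublock det1 mulr1.
have e2 : x * \det M = \det (block_mx 1%:M 0 (- v) x%:M *m M).
  by rewrite det_mulmx det_lblock det1 mul1r det_scalar1.
have e3 : block_mx 1%:M 0 (- v) x%:M *m M = block_mx x%:M (- u) 0 (x%:M + v *m u).
  rewrite /M mulmx_block !mul1mx !mul0mx !addr0 mulmx1 mulNmx mul_mx_scalar mul_scalar_mx addNr.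
  by rewrite mulNmx mulmxN opprK addrC.
rewrite e1 e2 e3 det_ublock det_scalar; congr (_ * _).
by rewrite det_mx11 !mxE eqxx mulr1n.
Qed.

(** Adding q p to X - A moves the root l to l - 1: if the characteristic
    polynomial is (X - l) psi, then X - A + q p has determinant psi (X - l +
    1), whose value at l is psi(l), nonzero because l is simple. *)
Lemma simple_eigen_unit (K : fieldType) n (A : 'M[K]_n) (l : K) (q : 'cV[K]_n) (p : 'rV[K]_n) :
  A *m q = l *: q -> p *m q = 1%:M -> mup l (char_poly A) = 1%N ->
  l%:M - A + q *m p \in unitmx.
Proof.
move=> Aq pq mu1.
have chi0 : char_poly A != 0 by rewrite monic_neq0 // char_poly_monic.
have [psi psiE] : exists psi, char_poly A = psi * ('X - l%:P).
  by apply/dvdpP; rewrite -['X - _]expr1 -mup_geq // mu1.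
have psil : psi.[l] != 0.
  apply/negP => /eqP pl; have : ('X - l%:P) ^+ 2 %| char_poly A.
    rewrite psiE expr2 dvdp_mul // dvdp_XsubCl; exact/eqP.
  by rewrite -mup_geq // mu1.
pose Z := char_poly_mx A; pose Q := map_mx polyC q; pose P := map_mx polyC p.
have ZQ : Z *m Q = ('X - l%:P) *: Q.
  rewrite /Z /char_poly_mx mulmxBl mul_scalar_mx -map_mxM Aq map_mxZ /=.
  by rewrite scalerBl.
have PQ : P *m Q = 1%:M by rewrite -map_mxM pq map_mx1.
have key : Z *m (('X - l%:P)%:M + Q *m P) = ('X - l%:P) *: (Z + Q *m P).
  by rewrite mulmxDr mulmxA ZQ mul_mx_scalar -scalemxAl -scalerDr.
have x0 : 'X - l%:P != 0 :> {poly K} by rewrite polyXsubC_eq0.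
have E : psi * ('X - l%:P + 1) = \det (Z + Q *m P).
  have := congr1 determinant key; rewrite det_mulmx detZ.
  move/(congr1 (fun z => ('X - l%:P) * z)); rewrite mulrCA det_rank1 PQ mxE eqxx mulr1n.
  rewrite -/(char_poly A) psiE => h.
  apply: (mulfI x0); apply: (mulfI (expf_neq0 n x0)).
  rewrite [RHS]mulrCA -h; ring.
have : (\det (Z + Q *m P)).[l] = \det (l%:M - A + q *m p).
  rewrite -horner_evalE -det_map_mx; congr (\det _).
  rewrite map_mxD map_mxM /Z /char_poly_mx map_mxB map_scalar_mx -!map_mx_comp /=.
  have hC m k (M : 'M[K]_(m, k)) : map_mx (horner_eval l \o polyC) M = M.
    by apply/matrixP => i j; rewrite mxE /= horner_evalE hornerC.
  by rewrite !hC horner_evalE hornerX.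
rewrite -E unitmxE unitfE => <-.
by rewrite hornerM hornerD hornerXsubC subrr add0r hornerC mulr1.
Qed.

Lemma horner_char_poly (K : comNzRingType) n (A : 'M[K]_n) (z : K) :
  (char_poly A).[z] = \det (z%:M - A).
Proof.
rewrite -horner_evalE -det_map_mx; congr (\det _).
rewrite /char_poly_mx map_mxB map_scalar_mx -!map_mx_comp /=.
congr (_%:M - _); first by rewrite horner_evalE hornerX.
by apply/matrixP => i j; rewrite !mxE /= horner_evalE hornerC.
Qed.

End SimpleEigenvalue.

(** * Lipschitz dependence at a parameter value *)

Section Perturbation.
Variables (R : realType) (F : set_system R).
Context {FF : Filter F}.
Implicit Types (g : R -> R) (x y : R -> R -> R[i]).

(** Boundedness is part of the notion so that it is stable under products. *)
Definition closeO g x y := [/\ bO F (fun=> 1) x, bO F (fun=> 1) y & bO F g (fun a t => x a t - y a t)].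

Lemma close_mul g x y x' y' : closeO g x y -> closeO g x' y' ->
  closeO g (fun a t => x a t * x' a t) (fun a t => y a t * y' a t).
Proof.
move=> [bx by_ d] [bx' by' d']; split; [exact: bO_mull|exact: bO_mull|].
apply: (@bO_eq _ _ _ _ _ (fun a t => (x a t - y a t) * x' a t + y a t * (x' a t - y' a t))).
  by move=> a t; ring.
by apply: bO_add; [exact: bO_mulr|exact: bO_mull].
Qed.

Lemma close_add g x y x' y' : closeO g x y -> closeO g x' y' ->
  closeO g (fun a t => x a t + x' a t) (fun a t => y a t + y' a t).
Proof.
move=> [bx by_ d] [bx' by' d']; split; [exact: bO_add|exact: bO_add|].
by apply: (bO_eq _ (bO_add d d')) => a t; ring.
Qed.

Lemma close_cst g c : closeO g (fun _ _ => c) (fun _ _ => c).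
Proof.
split; [exact: bO_const|exact: bO_const|].
by apply: (bO_eq _ (bO_0 _ g)) => a t; rewrite subrr.
Qed.

Lemma close_ext g x y x' y' : (forall a t, x a t = x' a t) -> (forall a t, y a t = y' a t) ->
  closeO g x y -> closeO g x' y'.
Proof.
move=> ex ey [bx by_ d]; split; [exact: bO_eq bx|exact: bO_eq by_|].
by apply: bO_eq d => a t; rewrite ex ey.
Qed.

Lemma close_sum g (I : Type) (s : seq I) (X Y : I -> R -> R -> R[i]) :
  (forall i, closeO g (X i) (Y i)) ->
  closeO g (fun a t => \sum_(i <- s) X i a t) (fun a t => \sum_(i <- s) Y i a t).
Proof.
move=> h; elim: s => [|i s IH].
  by apply: close_ext (close_cst g 0) => a t; rewrite big_nil.
by apply: close_ext (close_add (h i) IH) => a t; rewrite big_cons.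
Qed.

Lemma close_prod g (I : Type) (s : seq I) (X Y : I -> R -> R -> R[i]) :
  (forall i, closeO g (X i) (Y i)) ->
  closeO g (fun a t => \prod_(i <- s) X i a t) (fun a t => \prod_(i <- s) Y i a t).
Proof.
move=> h; elim: s => [|i s IH].
  by apply: close_ext (close_cst g 1) => a t; rewrite big_nil.
by apply: close_ext (close_mul (h i) IH) => a t; rewrite big_cons.
Qed.

Lemma close_det g n (X Y : R -> 'M[R[i]]_n) :
  (forall i j, closeO g (fun a _ => X a i j) (fun a _ => Y a i j)) ->
  closeO g (fun a _ => \det (X a)) (fun a _ => \det (Y a)).
Proof.
move=> h; apply: close_sum => s; apply: close_mul; first exact: close_cst.
by apply: close_prod => i; exact: h.
Qed.

Lemma close_conj g x y : closeO g x y -> closeO g (fun a t => (x a t)^*) (fun a t => (y a t)^*).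
Proof.
move=> [bx by_ d]; split; [exact: bO_conj|exact: bO_conj|].
by apply: (bO_eq _ (bO_conj d)) => a t; rewrite rmorphB.
Qed.

End Perturbation.

Section Lipschitz.
Variables (R : realType) (F : set_system R) (s : R).
Context {FF : Filter F}.
Hypothesis near_s : forall e : R, 0 < e -> \forall a \near F, `|a - s| < e.
Let de a : R := a - s.
Implicit Types (x y : R -> R[i]).

(** Increments are measured from the base point s only, which is all that
    expansions at s require. *)
Definition lip x := bO F de (fun a (_ : R) => x a - x s).

Lemma de_le1 : \forall a \near F, `|de a| <= `|(1 : R)|.
Proof. by rewrite normr1; apply: filterS (near_s ltr01) => a /ltW. Qed.

Lemma lip_close x : lip x -> closeO F de (fun a _ => x a) (fun _ _ => x s).
Proof.
move=> h; split => //; last exact: bO_const.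
apply: (@bO_eq _ _ _ _ _ (fun a _ => (x a - x s) + x s)); first by move=> a t; rewrite subrK.
by apply: bO_add; [exact: bO_gauge de_le1 h|exact: bO_const].
Qed.

Lemma close_lip x : closeO F de (fun a _ => x a) (fun _ _ => x s) -> lip x.
Proof. by case. Qed.

Lemma lip_ext x y : (forall a, x a = y a) -> lip x -> lip y.
Proof. by move=> e; apply: bO_eq => a t; rewrite !e. Qed.

Lemma lip_cst c : lip (fun=> c).
Proof. exact/close_lip/close_cst. Qed.

Lemma lip_add x y : lip x -> lip y -> lip (fun a => x a + y a).
Proof. by move=> /lip_close h /lip_close h'; apply: close_lip; exact: close_add. Qed.

Lemma lip_mul x y : lip x -> lip y -> lip (fun a => x a * y a).
Proof. by move=> /lip_close h /lip_close h'; apply: close_lip; exact: close_mul. Qed.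

Lemma lip_opp x : lip x -> lip (fun a => - x a).
Proof. by move=> h; apply: (lip_ext _ (lip_mul (lip_cst (-1)) h)) => a; rewrite mulN1r. Qed.

Lemma lip_sub x y : lip x -> lip y -> lip (fun a => x a - y a).
Proof. by move=> h h'; apply: lip_add => //; exact: lip_opp. Qed.

Lemma lip_sum (I : Type) (r : seq I) (X : I -> R -> R[i]) : (forall i, lip (X i)) ->
  lip (fun a => \sum_(i <- r) X i a).
Proof.
by move=> h; apply/close_lip/close_sum => i; exact: lip_close.
Qed.

Lemma lip_conj x : lip x -> lip (fun a => (x a)^*).
Proof. by move=> /lip_close h; apply: close_lip; exact: close_conj. Qed.

Lemma lip_Re x : lip x -> lip (fun a => (Re (x a))%:C%C).
Proof.
move=> h; apply: (bO_le _ h); apply: nearW => a _.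
have -> : (Re (x a))%:C%C - (Re (x s))%:C%C = (Re (x a - x s))%:C%C.
  by rewrite cReD cReN rmorphB.
by rewrite cmodC; exact: cmod_Re.
Qed.

Lemma lip_lower x : lip x -> x s != 0 -> \forall a \near F, cmod (x s) / 2 <= cmod (x a).
Proof.
move=> /bO_pos[C C0 hC] x0.
have c0 : 0 < cmod (x s) by rewrite cmod_gt0.
have e0 : 0 < cmod (x s) / 2 / C by rewrite !divr_gt0.
apply: filterS2 hC (near_s e0) => a h1 h2.
have h3 : cmod (x a - x s) <= cmod (x s) / 2.
  by apply: (le_trans (h1 0)); rewrite mulrC -ler_pdivlMr // ltW.
have : cmod (x s) <= cmod (x a) + cmod (x a - x s).
  by rewrite -[x s in leLHS](subKr (x a)); exact: cmodB.
rewrite addrC -lerBlDl => /(le_trans _); apply.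
by rewrite lerBrDr -lerBrDl (le_trans h3) // [X in X - _](@splitr R) addrK.
Qed.

Lemma lip_inv x : lip x -> x s != 0 -> lip (fun a => (x a)^-1).
Proof.
move=> h x0; have hl := lip_lower h x0.
have c0 : 0 < cmod (x s) by rewrite cmod_gt0.
apply: (@bO_near _ _ _ _ _ (fun a _ => - ((x a)^-1 * ((x s)^-1 * (x a - x s))))).
  apply: filterS hl => a ha _.
  have xa0 : x a != 0 by rewrite -cmod_gt0 (lt_le_trans _ ha) // divr_gt0.
  move: xa0 x0; move: (x a) (x s) => u v u0 v0.
  by field; rewrite u0 v0.
apply: bO_opp; apply: bO_mull.
  exists (2 / cmod (x s)); apply: filterS hl => a ha _.
  rewrite normr1 mulr1 cmodV -[2]invrK -invfM mulrC lef_pV2 // posrE ?divr_gt0 //.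
  by rewrite (lt_le_trans _ ha) // divr_gt0.
exact: bO_scale.
Qed.

Lemma lip_det n (X : R -> 'M[R[i]]_n) : (forall i j, lip (fun a => X a i j)) ->
  lip (fun a => \det (X a)).
Proof. by move=> h; apply: close_lip; apply: close_det => i j; exact: lip_close. Qed.

Definition lipm m n (X : R -> 'M[R[i]]_(m, n)) := forall i j, lip (fun a => X a i j).

Lemma lipm_mul m n p (X : R -> 'M[R[i]]_(m, n)) (Y : R -> 'M[R[i]]_(n, p)) :
  lipm X -> lipm Y -> lipm (fun a => X a *m Y a).
Proof.
move=> hX hY i j; apply: (@lip_ext (fun a => \sum_k X a i k * Y a k j)).
  by move=> a; rewrite mxE.
by apply: lip_sum => k; exact: lip_mul.
Qed.

Lemma lipm_cst m n (X : 'M[R[i]]_(m, n)) : lipm (fun=> X).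
Proof. by move=> i j; exact: lip_cst. Qed.

Lemma lipm_add m n (X Y : R -> 'M[R[i]]_(m, n)) : lipm X -> lipm Y -> lipm (fun a => X a + Y a).
Proof.
move=> hX hY i j; apply: (@lip_ext (fun a => X a i j + Y a i j)); first by move=> a; rewrite mxE.
exact: lip_add.
Qed.

Lemma lipm_opp m n (X : R -> 'M[R[i]]_(m, n)) : lipm X -> lipm (fun a => - X a).
Proof.
move=> hX i j; apply: (@lip_ext (fun a => - X a i j)); first by move=> a; rewrite mxE.
exact: lip_opp.
Qed.

Lemma lipm_scale m n (c : R -> R[i]) (X : R -> 'M[R[i]]_(m, n)) : lip c -> lipm X ->
  lipm (fun a => c a *: X a).
Proof.
move=> hc hX i j; apply: (@lip_ext (fun a => c a * X a i j)); first by move=> a; rewrite mxE.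
exact: lip_mul.
Qed.

Lemma lipm_scalar n (c : R -> R[i]) : lip c -> lipm (fun a => (c a)%:M : 'M[R[i]]_n).
Proof.
move=> hc i j; apply: (@lip_ext (fun a => (i == j)%:R * c a)).
  by move=> a; rewrite mxE mulr_natl.
exact: lip_mul (lip_cst _) hc.
Qed.

Lemma lipm_conj m n (X : R -> 'M[R[i]]_(m, n)) : lipm X ->
  lipm (fun a => map_mx (fun z : R[i] => z^*) (X a)).
Proof.
move=> hX i j; apply: (@lip_ext (fun a => (X a i j)^*)); first by move=> a; rewrite mxE.
exact: lip_conj.
Qed.

Lemma lipm_tr m n (X : R -> 'M[R[i]]_(m, n)) : lipm X -> lipm (fun a => (X a)^T).
Proof.
by move=> hX i j; apply: (lip_ext _ (hX j i)) => a; rewrite mxE.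
Qed.

Lemma lipm_unit n (X : R -> 'M[R[i]]_n) : lipm X -> X s \in unitmx ->
  \forall a \near F, X a \in unitmx.
Proof.
move=> h; rewrite unitmxE unitfE => d0.
apply: filterS (lip_lower (lip_det h) d0) => a ha.
rewrite unitmxE unitfE -cmod_gt0 (lt_le_trans _ ha) // divr_gt0 // cmod_gt0 //.
Qed.

(** The entries of the inverse are cofactors divided by the determinant. *)
Lemma lipm_inv n (X : R -> 'M[R[i]]_n) : lipm X -> X s \in unitmx ->
  lipm (fun a => invmx (X a)).
Proof.
move=> h Xs; have hd := lip_det h.
have d0 : \det (X s) != 0 by move: Xs; rewrite unitmxE unitfE.
have hadj : lipm (fun a => \adj (X a)).
  move=> i j; apply: (@lip_ext (fun a => cofactor (X a) j i)); first by move=> a; rewrite mxE.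
  apply: lip_mul (lip_cst _) _; apply: lip_det => k l.
  by apply: (lip_ext _ (h (lift j k) (lift i l))) => a; rewrite !mxE.
move=> i j; apply: (bO_near _ (lipm_scale (lip_inv hd d0) hadj i j)).
by apply: filterS (lipm_unit h Xs) => a Xa t; rewrite /invmx Xa Xs.
Qed.

End Lipschitz.

(** * The normal form coefficient and the slope of the mean state *)

Section Multilinear.
Variables (R : realType) (n : nat).
Variables (b : 'I_n -> 'I_n -> 'I_n -> R[i]) (c : 'I_n -> 'I_n -> 'I_n -> 'I_n -> R[i]).
Implicit Types (x y u : 'cV[R[i]]_n) (k : R[i]).

Lemma BformDl x x' y : Bform b (x + x') y = Bform b x y + Bform b x' y.
Proof.
apply/matrixP => m j; rewrite !mxE -big_split; apply: eq_bigr => i _.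
by rewrite -big_split; apply: eq_bigr => l _; rewrite mxE /=; ring.
Qed.

Lemma BformZl k x y : Bform b (k *: x) y = k *: Bform b x y.
Proof.
apply/matrixP => m j; rewrite !mxE mulr_sumr; apply: eq_bigr => i _.
by rewrite mulr_sumr; apply: eq_bigr => l _; rewrite mxE; ring.
Qed.

Lemma BformZr k x y : Bform b x (k *: y) = k *: Bform b x y.
Proof.
apply/matrixP => m j; rewrite !mxE mulr_sumr; apply: eq_bigr => i _.
by rewrite mulr_sumr; apply: eq_bigr => l _; rewrite mxE; ring.
Qed.

Lemma CformZ k1 k2 k3 x y u :
  Cform c (k1 *: x) (k2 *: y) (k3 *: u) = (k1 * k2 * k3) *: Cform c x y u.
Proof.
apply/matrixP => m j; rewrite !mxE mulr_sumr; apply: eq_bigr => i _.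
rewrite mulr_sumr; apply: eq_bigr => l _; rewrite mulr_sumr; apply: eq_bigr => r _.
by rewrite !mxE; ring.
Qed.

Lemma BformC x y : (forall m j l, b m j l = b m l j) -> Bform b x y = Bform b y x.
Proof.
move=> bs; apply/matrixP => m j; rewrite !mxE exchange_big.
by apply: eq_bigr => i _; apply: eq_bigr => l _; rewrite bs; ring.
Qed.

Lemma conjv_Bform x y : (forall m j l, (b m j l)^* = b m j l) ->
  conjv (Bform b x y) = Bform b (conjv x) (conjv y).
Proof.
move=> br; apply/matrixP => m j; rewrite !mxE rmorph_sum; apply: eq_bigr => i _.
by rewrite rmorph_sum; apply: eq_bigr => l _; rewrite !rmorphM /= br !mxE.
Qed.

Lemma conjvD x y : conjv (x + y) = conjv x + conjv y.
Proof. exact: map_mxD. Qed.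

Lemma conjvN x : conjv (- x) = - conjv x.
Proof. exact: map_mxN. Qed.

Lemma conjvZ k x : conjv (k *: x) = k^* *: conjv x.
Proof. exact: map_mxZ. Qed.

Lemma conjvK x : conjv (conjv x) = x.
Proof. by apply/matrixP => i j; rewrite !mxE conjCK. Qed.

Lemma inner_conjl x y : inner (conjv x) y = (inner x (conjv y))^*.
Proof.
rewrite /inner rmorph_sum; apply: eq_bigr => j _.
by rewrite !mxE rmorphM /= !conjCK.
Qed.

Lemma innerZl k x y : inner (k *: x) y = k^* * inner x y.
Proof. by rewrite /inner mulr_sumr; apply: eq_bigr => j _; rewrite mxE rmorphM mulrA. Qed.

End Multilinear.

Section HopfCoefficients.
Variables (R : realType) (n : nat).
Variables (A : 'M[R[i]]_n) (b : 'I_n -> 'I_n -> 'I_n -> R[i]).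
Variables (c : 'I_n -> 'I_n -> 'I_n -> 'I_n -> R[i]) (lam : R[i]) (q p : 'cV[R[i]]_n).
Local Notation B := (Bform b).
Local Notation qb := (conjv q).

Definition noncritical (v : 'cV[R[i]]_n) := v - inner p v *: q - inner (conjv p) v *: qb.
(** The vectors [eta20] and [eta11], for an arbitrary matrix and an arbitrary
    array of quadratic coefficients. *)
Definition second_harmonic := invmx ((2 * lam)%:M - A) *m noncritical (B q q).
Definition mean_mode := invmx ((2 * (Re lam)%:C%C)%:M - A) *m noncritical (B q qb).

(** The coefficient [c1] as a function of its scalar ingredients, where r and
    s stand for the couplings of the critical mode with [eta11] and [eta20].
    Squared moduli are written as products with the conjugate, so that ring
    identities apply. *)
Definition cubic_part (l a20 a11 a02 a21 r s : R[i]) : R[i] :=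
  (2 * l + l^*) / (2 * (l * l^*)) * a20 * a11
  + l^-1 * (a11 * a11^*)
  + (2 * (2 * l - l^*))^-1 * (a02 * a02^*)
  + 2^-1 * (a21 + 2 * r + s).

Definition normal_form : R[i] := cubic_part lam
  (inner p (B q q)) (inner p (B q qb)) (inner p (B qb qb)) (inner p (Cform c q q qb))
  (inner p (B q mean_mode)) (inner p (B qb second_harmonic)).

(** The terms of [Kvec] along the real and imaginary parts of q are together
    the real part of one complex vector. *)
Definition slope_of (l a11 : R[i]) (s : R) (u r : 'cV[R[i]]_n) : 'cV[R[i]]_n :=
  - toC (map_mx (fun z => Re z) ((2 * a11 / (l^* * s%:C%C)) *: u)) - (s^-1)%:C%C *: r.

Definition mean_slope : 'cV[R[i]]_n :=
  slope_of lam (inner p (B q qb)) (Re normal_form) q mean_mode.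

End HopfCoefficients.

Section SlopeProperties.
Variables (R : realType) (n : nat).
Implicit Types (A : 'M[R[i]]_n) (b : 'I_n -> 'I_n -> 'I_n -> R[i]).
Implicit Types (c : 'I_n -> 'I_n -> 'I_n -> 'I_n -> R[i]) (lam k : R[i]) (q p v : 'cV[R[i]]_n).

Lemma inner_scale p k v : inner ((k^*)^-1 *: p) v = k^-1 * inner p v.
Proof. by rewrite innerZl fmorphV /= conjCK. Qed.

Lemma conjv_scale p k : conjv ((k^*)^-1 *: p) = ((k^*)^*)^-1 *: conjv p.
Proof. by rewrite conjvZ fmorphV. Qed.

Lemma noncriticalZ q p k v : k != 0 ->
  noncritical (k *: q) ((k^*)^-1 *: p) v = noncritical q p v.
Proof.
move=> k0; have kb0 : k^* != 0 by rewrite conjC_eq0.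
rewrite /noncritical conjv_scale !inner_scale conjvZ !scalerA.
by rewrite mulrAC mulVf // mul1r mulrAC mulVf // mul1r.
Qed.

Lemma noncritical_scale q p k v : noncritical q p (k *: v) = k *: noncritical q p v.
Proof. by rewrite /noncritical !innerZ !scalerBr !scalerA. Qed.

Lemma mean_mode_scale A b lam q p k : k != 0 ->
  mean_mode A b lam (k *: q) ((k^*)^-1 *: p) = (k * k^*) *: mean_mode A b lam q p.
Proof.
move=> k0; rewrite /mean_mode noncriticalZ // conjvZ BformZl BformZr scalerA.
by rewrite noncritical_scale -scalemxAr.
Qed.

Lemma second_harmonic_scale A b lam q p k : k != 0 ->
  second_harmonic A b lam (k *: q) ((k^*)^-1 *: p) = (k * k) *: second_harmonic A b lam q p.
Proof.
move=> k0; rewrite /second_harmonic noncriticalZ // BformZl BformZr scalerA.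
by rewrite noncritical_scale -scalemxAr.
Qed.

Lemma cubic_part_scale (l a20 a11 a02 a21 r s k : R[i]) : k != 0 ->
  cubic_part l (k^-1 * (k * (k * a20))) (k^-1 * (k * (k^* * a11))) (k^-1 * (k^* * (k^* * a02)))
    (k^-1 * (k * k * k^* * a21)) (k^-1 * (k * (k * k^* * r))) (k^-1 * (k^* * (k * k * s))) =
  k * k^* * cubic_part l a20 a11 a02 a21 r s.
Proof.
move=> k0; have kb0 : k^* != 0 by rewrite conjC_eq0.
rewrite /cubic_part !rmorphM /= fmorphV /= !conjCK.
move: ((2 * l + l^*) / (2 * (l * l^*))) (l^-1) ((2 * (2 * l - l^*))^-1) => x y z.
move: (a11^*) (a02^*) (k^*) kb0 => u v kb kb0.
by field; rewrite k0 kb0.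
Qed.

Lemma normal_form_scale A b c lam q p k : k != 0 ->
  normal_form A b c lam (k *: q) ((k^*)^-1 *: p) = k * k^* * normal_form A b c lam q p.
Proof.
move=> k0; rewrite /normal_form -cubic_part_scale // mean_mode_scale // second_harmonic_scale //.
move: (mean_mode _ _ _ _ _) (second_harmonic _ _ _ _ _) => r s.
rewrite conjvZ CformZ !inner_scale !BformZl !BformZr !innerZ; reflexivity.
Qed.

Lemma Re_mulJ k z : Re (k * k^* * z) = Re (k * k^*) * Re z.
Proof. by rewrite cmod_mulJ cReM /= mul0r subr0. Qed.

Lemma mulJ_Re k : (Re (k * k^*))%:C%C = k * k^*.
Proof. by rewrite cmod_mulJ. Qed.

Lemma slope_of_scale (l a11 : R[i]) (s : R) q v k : k != 0 ->
  slope_of l (k^-1 * (k * (k^* * a11))) (Re (k * k^*) * s) (k *: q) ((k * k^*) *: v) =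
  slope_of l a11 s q v.
Proof.
move=> k0; have kb0 : k^* != 0 by rewrite conjC_eq0.
have kk0 : k * k^* != 0 by rewrite mulf_neq0.
rewrite /slope_of rmorphM /= mulJ_Re; congr (- toC (map_mx _ _) - _).
  rewrite scalerA; congr (_ *: q).
  move: (s%:C%C) (l^*) => x y.
  rewrite !invfM; move: (x^-1) (y^-1) => x' y'.
  by field; rewrite k0 kb0.
rewrite invfM rmorphM /= fmorphV /= mulJ_Re scalerA mulrAC.
by rewrite mulVf ?mul1r.
Qed.

(** When q is multiplied by k and p divided by the conjugate of k, which
    preserves the normalisation, the numerators and the real part of the
    normal form coefficient all scale by |k|^2. The slope therefore does not
    depend on the choice of eigenvectors. *)
Lemma mean_slope_scale A b c lam q p k : k != 0 ->
  mean_slope A b c lam (k *: q) ((k^*)^-1 *: p) = mean_slope A b c lam q p.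
Proof.
move=> k0; rewrite /mean_slope (normal_form_scale A b c lam q p k0).
rewrite (mean_mode_scale A b lam q p k0) Re_mulJ conjvZ BformZl BformZr inner_scale !innerZ.
exact: slope_of_scale.
Qed.

Lemma conjv_noncritical q p v : conjv v = v ->
  conjv (noncritical q p v) = noncritical q p v.
Proof.
move=> vr; rewrite /noncritical !conjvD !conjvN !conjvZ conjvK !inner_conjl vr conjCK.
by rewrite addrAC.
Qed.

Lemma mean_mode_real A b lam q p : map_mx (fun z : R[i] => z^*) A = A ->
  (forall m j l, b m j l = b m l j) -> (forall m j l, (b m j l)^* = b m j l) ->
  conjv (mean_mode A b lam q p) = mean_mode A b lam q p.
Proof.
move=> Ar bs br; rewrite /mean_mode /conjv map_mxM map_invmx map_mxB map_scalar_mx /= Ar.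
have e (x : R) : (2 * x%:C%C)^* = 2 * x%:C%C :> R[i].
  by apply: complexP; rewrite ?cReJ // cImJ cImM /=; ring.
rewrite e; congr (_ *m _).
by apply: conjv_noncritical; rewrite conjv_Bform // conjvK BformC.
Qed.

Lemma toC_Re m m' (X : 'M[R[i]]_(m, m')) : map_mx (fun z : R[i] => z^*) X = X ->
  toC (map_mx (fun z => Re z) X) = X.
Proof.
move=> Xr; apply/matrixP => i j; rewrite !mxE.
have /matrixP/(_ i j) := Xr; rewrite mxE.
case: (X i j) => x y [] /eqP; rewrite -subr_eq0 -opprD oppr_eq0 -mulr2n mulrn_eq0 /=.
by move=> /eqP ->.
Qed.

Lemma toC_conj m m' (X : 'M[R]_(m, m')) : map_mx (fun z : R[i] => z^*) (toC X) = toC X.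
Proof. by apply/matrixP => i j; rewrite !mxE conjCR. Qed.

Lemma mean_slope_real A b c lam q p : map_mx (fun z : R[i] => z^*) A = A ->
  (forall m j l, b m j l = b m l j) -> (forall m j l, (b m j l)^* = b m j l) ->
  toC (map_mx (fun z => Re z) (mean_slope A b c lam q p)) = mean_slope A b c lam q p.
Proof.
move=> Ar bs br; apply: toC_Re; have := mean_mode_real lam q p Ar bs br.
rewrite /mean_slope; move: (mean_mode A b lam q p) (Re (normal_form _ _ _ _ _ _)) => v s vr.
rewrite /slope_of -[LHS]/(conjv _) conjvD !conjvN conjvZ vr conjCR.
by rewrite /conjv toC_conj.
Qed.

Section AtCriticality.
Variables (A : 'M[R[i]]_n) (b : 'I_n -> 'I_n -> 'I_n -> R[i]).
Variables (c : 'I_n -> 'I_n -> 'I_n -> 'I_n -> R[i]) (l : R[i]) (q p h0 h2 : 'cV[R[i]]_n).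
Local Notation qb := (conjv q).
Hypothesis l_imaginary : l^* = - l.
Hypothesis l_neq0 : l != 0.
Hypothesis b_sym : forall m j o, b m j o = b m o j.
Hypothesis b_real : forall m j o, (b m j o)^* = b m j o.
Hypothesis A_real : map_mx (fun z : R[i] => z^*) A = A.
Hypothesis Aq : A *m q = l *: q.
Hypothesis A_unit : A \in unitmx.
Hypothesis A2_unit : (2 * l)%:M - A \in unitmx.
Hypothesis h0E : A *m h0 = - Bform b q qb.
Hypothesis h2E : ((2 * l)%:M - A) *m h2 = Bform b q q.

Lemma Aqb : A *m qb = - l *: qb.
Proof.
have := congr1 (map_mx (fun z : R[i] => z^*)) Aq.
by rewrite map_mxM A_real map_mxZ /= l_imaginary.
Qed.

Lemma Re_imaginary : Re l = 0.
Proof.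
have := congr1 (fun z => Re z) l_imaginary; rewrite cReJ cReN => /eqP.
by rewrite -subr_eq0 opprK -mulr2n mulrn_eq0 => /eqP.
Qed.

Let r := mean_mode A b l q p.
Let s := second_harmonic A b l q p.
Let a11 := inner p (Bform b q qb).
Let a20 := inner p (Bform b q q).
Let a02 := inner p (Bform b qb qb).

(** The quadratic term B(q, qb) is split along q, qb and the noncritical
    directions; A acts on the first two as l and - l, and the third is the one
    that [mean_mode] resolves. *)
Lemma mean_mode_critical : h0 = r - (a11 / l) *: q + (a11^* / l) *: qb.
Proof.
apply: (can_inj (mulKmx A_unit)); rewrite h0E.
have rE : A *m r = - noncritical q p (Bform b q qb).
  rewrite /r /mean_mode Re_imaginary mulr0 raddf0 sub0r.
  have -> : invmx (- A) = - invmx A.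
    by rewrite -scaleN1r invmxZ ?unitmxZ ?unitrN1 // invrN1 scaleN1r.
  by rewrite mulNmx mulmxN mulKVmx.
rewrite !mulmxDr mulmxN -!scalemxAr rE Aq Aqb /noncritical inner_conjl.
rewrite conjv_Bform // conjvK [Bform b qb q]BformC // -/a11 !scalerA.
rewrite mulrN !divfK //; move: (Bform b _ _) => v; apply/matrixP => i j.
by rewrite !mxE; ring.
Qed.

(** The same splitting, with 2 l - A acting as l on q and as 3 l on qb. *)
Lemma second_harmonic_critical : h2 = s + (a20 / l) *: q + (a02^* / (3 * l)) *: qb.
Proof.
apply: (can_inj (mulKmx A2_unit)); rewrite h2E.
have sE : ((2 * l)%:M - A) *m s = noncritical q p (Bform b q q) by rewrite mulKVmx.
rewrite !mulmxDr -!scalemxAr sE !mulmxBl !mul_scalar_mx Aq Aqb /noncritical inner_conjl.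
rewrite conjv_Bform // -/a20 -/a02; move: (Bform b _ _) => v; apply/matrixP => i j.
by rewrite !mxE; field; exact: l_neq0.
Qed.

(** Substituting the two splittings into the cubic coefficient of harmonic
    balance produces exactly the terms of the normal form coefficient. *)
Lemma normal_form_critical : normal_form A b c l q p =
  inner p (Bform b h0 q + 2^-1 *: Bform b h2 qb + 2^-1 *: Cform c q q qb).
Proof.
rewrite mean_mode_critical second_harmonic_critical /normal_form /cubic_part l_imaginary.
rewrite -/r -/s; move: (r) (s) => r' s'.
rewrite -scaleNr !(BformDl, BformZl) !(innerD, innerZ).
rewrite (BformC r') // (BformC s') // (BformC qb q) // -/a20 -/a02 -/a11.
move: (a02^*) (a11^*) => v' t'; move: (a20) (a02) (a11) => u v t.
move: (inner p (Cform _ _ _ _)) (inner p (Bform _ _ r')) (inner p (Bform _ _ s')) => x y z.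
have e1 : 2 * l - l = l by ring.
have e2 : 2 * l - - l = 3 * l by ring.
by rewrite e1 e2; field; exact: l_neq0.
Qed.

(** The two critical components of h0 are conjugate to each other, and their
    sum is the real part that occurs in the slope. *)
Lemma mean_slope_critical : Re (normal_form A b c l q p) != 0 ->
  mean_slope A b c l q p = - ((Re (normal_form A b c l q p))^-1)%:C%C *: h0.
Proof.
rewrite /mean_slope mean_mode_critical -/r -/a11; move: (Re (normal_form _ _ _ _ _ _)) => k k0.
rewrite /slope_of l_imaginary.
have kE : k%:C%C != 0 :> R[i] by rewrite -(rmorph0 (real_complex R)) (inj_eq (@complexI R)).
have ReE (v : 'cV[R[i]]_n) : toC (map_mx (fun z => Re z) v) = 2^-1 *: (v + conjv v).
  apply/matrixP => i j; rewrite !mxE; apply: complexP.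
    by rewrite cReM cReD cReJ /=; field.
  by rewrite cImM cImD cImJ /=; field.
rewrite ReE conjvZ !rmorphM /= fmorphV /= rmorphM /= rmorphN /= l_imaginary conjCR rmorph_nat.
move: (r) => r'; apply/matrixP => i j; rewrite !mxE fmorphV /=.
move: (a11^*) (k%:C%C) kE ((q i j)^*) => t z z0 qc.
by field; rewrite z0 l_neq0.
Qed.

End AtCriticality.

End SlopeProperties.

Section DefinedCoefficients.
Variables (R : realType) (n : nat) (g : 'cV[R]_n -> 'cV[R]_n) (x0 : 'cV[R]_n).
Variables (lam : R[i]) (q p : 'cV[R[i]]_n).
Let b m j k : R[i] := (partial j (partial k (fun x => nonlin g x0 x m 0)) 0)%:C%C.
Let c m j k l : R[i] :=
  (partial l (partial j (partial k (fun x => nonlin g x0 x m 0))) 0)%:C%C.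

Lemma c1_normal_form : c1 g x0 lam q p = normal_form (toC (jac g x0)) b c lam q p.
Proof. by rewrite /c1 !normCK. Qed.

Lemma Kvec_mean_slope : Kvec g x0 lam q p = mean_slope (toC (jac g x0)) b c lam q p.
Proof.
rewrite /mean_slope -c1_normal_form /slope_of -/(eta11 g x0 lam q p) -/(g11 g x0 q p) /Kvec.
move: (Re (c1 _ _ _ _ _)) (g11 _ _ _ _) => s a.
congr (_ - _).
apply/matrixP => i j; rewrite !mxE.
move: (2 * a / _) (q i j) => z w.
by rewrite cReM rmorphB !rmorphM /=; ring.
Qed.

End DefinedCoefficients.

Section LipschitzForms.
Variables (R : realType) (F : set_system R) (s : R) (n : nat).
Context {FF : Filter F}.
Hypothesis near_s : forall e : R, 0 < e -> \forall a \near F, `|a - s| < e.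
Local Notation lip := (lip F s).
Local Notation lipm := (lipm F s).
Implicit Types (q p u v y : R -> 'cV[R[i]]_n) (b : R -> 'I_n -> 'I_n -> 'I_n -> R[i]).

Lemma lip_inner p v : lipm p -> lipm v -> lip (fun a => inner (p a) (v a)).
Proof.
by move=> hp hv; apply: lip_sum => // j; apply: lip_mul => //; apply: lip_conj.
Qed.

Lemma lipm_conjv v : lipm v -> lipm (fun a => conjv (v a)).
Proof. exact: lipm_conj. Qed.

Lemma lipm_Bform b u v : (forall m j k, lip (fun a => b a m j k)) -> lipm u -> lipm v ->
  lipm (fun a => Bform (b a) (u a) (v a)).
Proof.
move=> hb hu hv i o; apply: (@lip_ext _ _ _ _ (fun a => \sum_j \sum_k b a i j k * u a k 0 * v a j 0)).
  by move=> a; rewrite mxE.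
by apply: lip_sum => // j; apply: lip_sum => // k; apply: lip_mul => //; exact: lip_mul.
Qed.

Lemma lipm_Cform c u v y : (forall m j k l, lip (fun a => c a m j k l)) ->
  lipm u -> lipm v -> lipm y -> lipm (fun a => Cform (c a) (u a) (v a) (y a)).
Proof.
move=> hc hu hv hy i o; apply: (@lip_ext _ _ _ _
  (fun a => \sum_j \sum_k \sum_l c a i j k l * u a k 0 * v a j 0 * y a l 0)).
  by move=> a; rewrite mxE.
apply: lip_sum => // j; apply: lip_sum => // k; apply: lip_sum => // l.
by do 2!apply: lip_mul => //; exact: lip_mul.
Qed.

Lemma lipm_sub m k (X Y : R -> 'M[R[i]]_(m, k)) : lipm X -> lipm Y -> lipm (fun a => X a - Y a).
Proof. by move=> hX hY; apply: lipm_add => //; exact: lipm_opp. Qed.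

Lemma lipm_Re m k (X : R -> 'M[R[i]]_(m, k)) : lipm X ->
  lipm (fun a => toC (map_mx (fun z => Re z) (X a))).
Proof.
move=> hX i j; apply: (@lip_ext _ _ _ _ (fun a => (Re (X a i j))%:C%C)); first by move=> a; rewrite !mxE.
exact: lip_Re.
Qed.

Variables (A : R -> 'M[R[i]]_n) (b : R -> 'I_n -> 'I_n -> 'I_n -> R[i]).
Variables (c : R -> 'I_n -> 'I_n -> 'I_n -> 'I_n -> R[i]) (lam : R -> R[i]).
Variables (q p : R -> 'cV[R[i]]_n).
Hypothesis hA : lipm A.
Hypothesis hb : forall m j k, lip (fun a => b a m j k).
Hypothesis hc : forall m j k l, lip (fun a => c a m j k l).
Hypothesis hlam : lip lam.
Hypothesis hq : lipm q.
Hypothesis hp : lipm p.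
Hypothesis lam0 : lam s != 0.
Hypothesis lam1 : 2 * lam s - (lam s)^* != 0.
Hypothesis A0u : (2 * (Re (lam s))%:C%C)%:M - A s \in unitmx.
Hypothesis A2u : (2 * lam s)%:M - A s \in unitmx.

Lemma lipm_noncritical v : lipm v -> lipm (fun a => noncritical (q a) (p a) (v a)).
Proof.
move=> hv; apply: lipm_sub; first apply: lipm_sub => //.
  by apply: lipm_scale => //; exact: lip_inner.
by apply: lipm_scale => //; [apply: lip_inner => //|]; exact: lipm_conjv.
Qed.

Lemma lipm_resolvent (z : R -> R[i]) v : lip z -> lipm v -> (z s)%:M - A s \in unitmx ->
  lipm (fun a => invmx ((z a)%:M - A a) *m v a).
Proof.
move=> hz hv zu; apply: lipm_mul => //; apply: (lipm_inv near_s) => //.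
by apply: lipm_sub => //; exact: lipm_scalar.
Qed.

Lemma lip_double (z : R -> R[i]) : lip z -> lip (fun a => 2 * z a).
Proof. by move=> h; apply: lip_mul => //; exact: lip_cst. Qed.

Lemma lipm_mean_mode : lipm (fun a => mean_mode (A a) (b a) (lam a) (q a) (p a)).
Proof.
apply: (@lipm_resolvent (fun a => 2 * (Re (lam a))%:C%C)) => //; first exact/lip_double/lip_Re.
by apply: lipm_noncritical; apply: lipm_Bform => //; exact: lipm_conjv.
Qed.

Lemma lipm_second_harmonic : lipm (fun a => second_harmonic (A a) (b a) (lam a) (q a) (p a)).
Proof.
apply: (@lipm_resolvent (fun a => 2 * lam a)) => //; first exact/lip_double.
by apply: lipm_noncritical; exact: lipm_Bform.
Qed.

Lemma lip_cubic_part (x1 x2 x3 x4 x5 x6 : R -> R[i]) :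
  lip x1 -> lip x2 -> lip x3 -> lip x4 -> lip x5 -> lip x6 ->
  lip (fun a => cubic_part (lam a) (x1 a) (x2 a) (x3 a) (x4 a) (x5 a) (x6 a)).
Proof.
move=> h1 h2 h3 h4 h5 h6; have hj : lip (fun a => (lam a)^*) by exact: (lip_conj near_s).
have hd := lip_double hlam; have two0 : 2 != 0 :> R[i] by rewrite pnatr_eq0.
apply: lip_add => //; first apply: lip_add => //; first apply: lip_add => //.
- apply: lip_mul => //; apply: lip_mul => //; apply: lip_mul => //; first exact: lip_add.
  apply: (lip_inv near_s); first by apply: lip_double; exact: lip_mul.
  by rewrite !mulf_neq0 // conjC_eq0.
- apply: lip_mul => //; first exact: (lip_inv near_s).
  by apply: lip_mul => //; exact: lip_conj.
- apply: lip_mul => //; last by apply: lip_mul => //; exact: lip_conj.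
  apply: (lip_inv near_s); first by apply: lip_double; exact: lip_sub.
  by rewrite mulf_neq0.
- apply: lip_mul => //; first exact: lip_cst.
  by apply: lip_add => //; apply: lip_add => //; exact: lip_double.
Qed.

Lemma lip_normal_form : lip (fun a => normal_form (A a) (b a) (c a) (lam a) (q a) (p a)).
Proof.
have hqb := lipm_conjv hq; have hr := lipm_mean_mode; have hs := lipm_second_harmonic.
apply: (@lip_cubic_part (fun a => inner (p a) (Bform (b a) (q a) (q a)))
  (fun a => inner (p a) (Bform (b a) (q a) (conjv (q a))))
  (fun a => inner (p a) (Bform (b a) (conjv (q a)) (conjv (q a))))
  (fun a => inner (p a) (Cform (c a) (q a) (q a) (conjv (q a))))
  (fun a => inner (p a) (Bform (b a) (q a) (mean_mode (A a) (b a) (lam a) (q a) (p a))))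
  (fun a => inner (p a) (Bform (b a) (conjv (q a)) (second_harmonic (A a) (b a) (lam a) (q a) (p a)))));
  apply: lip_inner => //; first [exact: lipm_Bform|exact: lipm_Cform].
Qed.

(** The slope is a rational expression in the matrix, the tensors, the
    eigenvalue and the eigenvectors, whose denominators do not vanish at
    s. *)
Lemma lipm_mean_slope : Re (normal_form (A s) (b s) (c s) (lam s) (q s) (p s)) != 0 ->
  lipm (fun a => mean_slope (A a) (b a) (c a) (lam a) (q a) (p a)).
Proof.
move=> nf0; have hqb := lipm_conjv hq; have hr := lipm_mean_mode.
have hlb : lip (fun a => (lam a)^*) by exact: (lip_conj near_s).
have hg : lip (fun a => inner (p a) (Bform (b a) (q a) (conjv (q a)))).
  by apply: lip_inner => //; exact: lipm_Bform.
pose nf a := Re (normal_form (A a) (b a) (c a) (lam a) (q a) (p a)).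
have hnf : lip (fun a => (nf a)%:C%C) by apply: lip_Re; exact: lip_normal_form.
have nfC : (nf s)%:C%C != 0 :> R[i] by rewrite -(rmorph0 (real_complex R)) (inj_eq (@complexI R)).
apply: lipm_sub; first apply: lipm_opp => //.
  apply: (@lipm_Re _ _ (fun a => (2 * inner (p a) (Bform (b a) (q a) (conjv (q a))) /
     ((lam a)^* * (nf a)%:C%C)) *: q a)).
  apply: lipm_scale => //; apply: lip_mul => //; first exact: lip_double.
  apply: (lip_inv near_s); first exact: lip_mul.
  by rewrite mulf_neq0 // conjC_eq0.
apply: lipm_scale => //.
apply: (@lip_ext _ _ _ _ (fun a => ((nf a)%:C%C)^-1)); first by move=> a; rewrite fmorphV.
exact: (lip_inv near_s).
Qed.

End LipschitzForms.

(** * Smooth vector fields depending on a parameter *)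

Section SmoothFields.
Variables (R : realType) (n : nat).
Local Notation vec := ('cV[R]_n.+1).
Local Notation V := (vec * R)%type.

Lemma mx_norm_entry m k (X : 'M[R]_(m, k)) i j : `|X i j| <= `|X|.
Proof. by rewrite [leRHS]/Num.Def.normr /= mx_normrE; exact: (le_bigmax _ _ (i, j)). Qed.

Lemma mx_norm_le m k (X : 'M[R]_(m, k)) (B : R) : 0 <= B ->
  (forall i j, `|X i j| <= B) -> `|X| <= B.
Proof. by move=> B0 h; rewrite [leLHS]/Num.Def.normr /= mx_normrE bigmax_le. Qed.

Lemma Ck_entry (U : normedModType R) m (h : U -> 'cV[R]_m) i k : Ck k h -> Ck k (fun z => h z i 0).
Proof.
elim: k h => [|k IH] h.
  move=> ch z; apply: (@continuous_comp _ _ _ h (fun M : 'cV[R]_m => M i 0)).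
    exact: ch.
  exact: coord_continuous.
move=> H v; have [dv Cv] := H v; split.
  by move=> z; have /derivable_mxP := dv z; apply.
rewrite (_ : (fun z => 'D_v (fun z => h z i 0) z) = fun z => 'D_v h z i 0); first exact: IH.
by apply/funext => z; rewrite derive_mx // mxE.
Qed.

Lemma slice_quotient (g : V -> R) (a : R) (x v : vec) :
  (fun h : R => h^-1 *: (((fun y => g (y, a)) \o shift x) (h *: v) - g (x, a))) =
  (fun h : R => h^-1 *: ((g \o shift ((x, a) : V)) (h *: ((v, 0) : V)) - g (x, a))).
Proof.
apply/funext => h /=; congr (_ *: (g _ - _)); rewrite /shift /=.
by apply/pair_equal_spec; split => //=; rewrite scaler0 add0r.
Qed.

Lemma derive_slice (g : V -> R) (a : R) (x v : vec) :
  'D_v (fun y => g (y, a)) x = 'D_((v, 0) : V) g (x, a).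
Proof. by rewrite /derive slice_quotient. Qed.

Lemma derivable_slice (g : V -> R) (a : R) (x v : vec) :
  derivable g (x, a) ((v, 0) : V) -> derivable (fun y => g (y, a)) x v.
Proof. by rewrite /derivable -slice_quotient. Qed.

(** Basis vectors of the product space; the summand 'I_1 is the parameter
    direction. *)
Definition dir (j : 'I_n.+1 + 'I_1) : V := if j is inl k then (delta_mx k 0, 0) else (0, 1).
Definition dir_co (z : V) (j : 'I_n.+1 + 'I_1) : R := if j is inl k then z.1 k 0 else z.2.

Lemma dir_co_sum z : z = \sum_j dir_co z j *: dir j.
Proof.
rewrite big_sumType /= big_ord1.
have e (F : 'I_n.+1 -> V) : \sum_i F i = (\sum_i (F i).1, \sum_i (F i).2).
  by elim/big_rec3: _ => // i x1 x2 x3 _ ->.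
rewrite e [z in LHS]surjective_pairing [RHS]surjective_pairing /=; congr pair.
  rewrite scaler0 addr0; apply/matrixP => i j; rewrite ord1 summxE (bigD1 i) //= !mxE !eqxx mulr1.
  rewrite big1 ?addr0 // => k ki; rewrite !mxE.
  by rewrite eq_sym (negbTE ki) mulr0.
rewrite big1 ?addr0 => [|i _]; last by rewrite scaler0.
by rewrite add0r; exact: (esym (mulr1 _)).
Qed.

Lemma dir_co_le z j : `|dir_co z j| <= `|z|.
Proof.
rewrite prod_normE le_max; case: j => [k|k] /=; last by rewrite lexx orbT.
by rewrite mx_norm_entry.
Qed.

Lemma state_norm (v : vec) : `|((v, 0) : V)| = `|v|.
Proof. by rewrite prod_normE /= normr0; apply/max_idPl. Qed.

Lemma state_sum (v : vec) : ((v, 0) : V) = \sum_k v k 0 *: dir (inl k).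
Proof.
by rewrite [LHS]dir_co_sum big_sumType /= big_ord1 scale0r addr0.
Qed.

Lemma derive_state (g : V -> R) z (v : vec) : smooth g ->
  'D_((v, 0) : V) g z = \sum_k v k 0 * 'D_(dir (inl k)) g z.
Proof. by move=> sg; rewrite state_sum smooth_derive_sum. Qed.

Variable f : vec -> R -> vec.
Hypothesis hf : smooth (fun z : V => f z.1 z.2).

Definition component m (z : V) : R := f z.1 z.2 m 0.

Lemma smooth_component m : smooth (component m).
Proof. by move=> k; exact: Ck_entry. Qed.

Local Notation e_ k := (dir (inl k)).

Lemma jac_component a y m j : jac (f^~ a) y m j = 'D_(e_ j) (component m) (y, a).
Proof. by rewrite mxE /partial -[RHS]derive_slice. Qed.

Lemma derive_jac a y (v : vec) m : 'D_((v, 0) : V) (component m) (y, a) = (jac (f^~ a) y *m v) m 0.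
Proof.
rewrite derive_state; last exact: smooth_component.
by rewrite mxE; apply: eq_bigr => k _; rewrite jac_component mulrC.
Qed.

Lemma partial_translate (g : V -> R) (y : vec) a k (c : R) : smooth g ->
  partial k (fun x => g (y + x, a) - c) = fun x => 'D_(e_ k) g (y + x, a).
Proof.
move=> sg; apply/funext => x; rewrite /partial.
have d : derivable (fun x => g (x, a)) (x + y) (delta_mx k 0).
  by apply: derivable_slice; exact: smooth_derivable.
have E : (fun x => g (y + x, a) - c) = (fun x => (fun z => g (z, a)) (x + y)) - cst c.
  by apply/funext => z; rewrite (addrC y z).
have [_ dE] := is_deriveB (is_derive_translate d) (is_derive_cst c x (delta_mx k 0)).
by rewrite E dE subr0 derive_slice (addrC x y).
Qed.

(** Subtracting the linear part shifts the first derivatives by constants, so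
    that second and third derivatives of the nonlinear part are those of the
    field itself. *)
Lemma partial_nonlin a y m k : partial k (fun x => nonlin (f^~ a) y x m 0) =
  fun x => 'D_(e_ k) (component m) (y + x, a) - jac (f^~ a) y m k.
Proof.
apply/funext => x; rewrite /partial.
have sm := @smooth_component m.
have d : derivable (fun x => component m (x, a)) (x + y) (delta_mx k 0).
  by apply: derivable_slice; exact: smooth_derivable.
have dl : is_derive x (delta_mx k 0 : vec) (fun x => (jac (f^~ a) y *m x) m 0) (jac (f^~ a) y m k).
  have E : (fun h : R => h^-1 *: (((fun x : vec => (jac (f^~ a) y *m x) m 0) \o shift x) (h *: delta_mx k 0)
      - (jac (f^~ a) y *m x) m 0)) =
      (fun h : R => h^-1 *: (h *: jac (f^~ a) y m k)).
    apply/funext => h /=; congr (_ *: _); rewrite /shift /= mulmxDr mxE addrK -scalemxAr mxE.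
    by rewrite -colE mxE.
  have cv : (fun h : R => h^-1 *: (h *: jac (f^~ a) y m k)) @ 0^' --> jac (f^~ a) y m k.
    apply: cvg_near_cst; rewrite near_withinE; apply: nearW => h h0.
    by rewrite scalerA mulVf ?scale1r.
  apply: DeriveDef; rewrite /derivable /derive E; [exact: cvgP cv|exact: (cvg_lim _ cv)].
have [_ dE] := is_deriveB (is_derive_translate d) dl.
rewrite (_ : (fun x => nonlin (f^~ a) y x m 0) =
   (fun x => component m (x + y, a)) - (fun x => (jac (f^~ a) y *m x) m 0)).
  by rewrite dE derive_slice (addrC x y).
by apply/funext => z; rewrite /nonlin mxE [X in _ + X]mxE (addrC y z).
Qed.

Lemma Btensor_component a y m j k : partial j (partial k (fun x => nonlin (f^~ a) y x m 0)) 0 =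
  Dseq [:: e_ j; e_ k] (component m) (y, a).
Proof.
have h := partial_translate y a j (jac (f^~ a) y m k) (smoothD (e_ k) (@smooth_component m)).
by rewrite partial_nonlin h addr0.
Qed.

Lemma Ctensor_component a y m j k l :
  partial l (partial j (partial k (fun x => nonlin (f^~ a) y x m 0))) 0 =
  Dseq [:: e_ l; e_ j; e_ k] (component m) (y, a).
Proof.
have h := partial_translate y a j (jac (f^~ a) y m k) (smoothD (e_ k) (@smooth_component m)).
have h' := partial_translate y a l 0 (smooth_Dseq [:: e_ j; e_ k] (@smooth_component m)).
rewrite partial_nonlin h -[RHS]/('D_(e_ l) (Dseq [:: e_ j; e_ k] (component m)) (y, a)).
have := congr1 (fun h => h 0) h'; rewrite addr0 => <-; congr (partial l _ 0).
by apply/funext => x; rewrite subr0.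
Qed.

Lemma derive2_state m (z : V) (u v : vec) :
  Dseq [:: (u, 0) : V; (v, 0) : V] (component m) z =
  \sum_j \sum_k Dseq [:: e_ j; e_ k] (component m) z * v k 0 * u j 0.
Proof.
have sm := @smooth_component m.
rewrite -[LHS]/('D_((u, 0) : V) (fun x => 'D_((v, 0) : V) (component m) x) z).
rewrite (_ : (fun x => 'D_((v, 0) : V) (component m) x) =
   (fun x => \sum_k v k 0 * 'D_(e_ k) (component m) x)); last first.
  by apply/funext => x; rewrite derive_state.
rewrite derive_lincomb => [|k]; last exact/smoothD.
rewrite exchange_big; apply: eq_bigr => k _.
rewrite derive_state; last exact/smoothD.
rewrite mulr_sumr; apply: eq_bigr => j _.
rewrite -[X in _ * (_ * X)]/(Dseq [:: e_ j; e_ k] (component m) z).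
by move: (Dseq _ _ _) (v _ _) (u _ _) => a b c; ring.
Qed.

Lemma derive3_state m (z : V) (u v w : vec) :
  Dseq [:: (u, 0) : V; (v, 0) : V; (w, 0) : V] (component m) z =
  \sum_j \sum_k \sum_l Dseq [:: e_ l; e_ j; e_ k] (component m) z * w k 0 * v j 0 * u l 0.
Proof.
have sm := @smooth_component m.
have E : Dseq [:: (v, 0) : V; (w, 0) : V] (component m) = fun y =>
   \sum_(i <- index_enum ('I_n.+1 * 'I_n.+1)%type) w i.2 0 * v i.1 0 * Dseq [:: e_ i.1; e_ i.2] (component m) y.
  apply/funext => y; rewrite derive2_state pair_bigA; apply: eq_bigr => i _.
  by rewrite [in RHS]mulrC mulrA.
rewrite -[LHS]/('D_((u, 0) : V) (Dseq [:: (v, 0) : V; (w, 0) : V] (component m)) z) E.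
rewrite (@derive_lincomb _ _ _ _ (fun i => w i.2 0 * v i.1 0)
  (fun i => Dseq [:: e_ i.1; e_ i.2] (component m))) => [|i]; last exact: smooth_Dseq.
rewrite pair_bigA; apply: eq_bigr => i _.
rewrite derive_state; last exact: smooth_Dseq.
rewrite mulr_sumr; apply: eq_bigr => l _.
rewrite -[X in _ * (_ * X)]/(Dseq [:: e_ l; e_ i.1; e_ i.2] (component m) z).
move: (Dseq _ _ _) (w _ _) (v _ _) (u _ _) => a b c d; ring.
Qed.

End SmoothFields.

(** * The branch of equilibria *)

Section LocalTaylor.
Variables (R : realType) (V : normedModType R).
Variables (J : finType) (b : J -> V) (co : V -> J -> R).
Hypothesis co_sum : forall v, v = \sum_j co v j *: b j.
Hypothesis co_le : forall v j, `|co v j| <= `|v|.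

Lemma smooth_lipschitz (g : V -> R) c : smooth g -> exists2 C : R, 0 < C &
  \forall z \near c, `|g z - g c| <= C * `|z - c|.
Proof.
move=> sg; have [C C0 hC] := Dseq_bounded co_sum co_le 1 c sg.
exists (C + 1); first by rewrite ltr_wpDl.
move/nbhs_ballP: hC => [r /= r0 hr]; apply/nbhs_ballP; exists r => //= z.
rewrite -ball_normE /= => zr.
have [t /andP[t0 t1] e] := @line_mvt _ _ g c (z - c) (fun y => @smooth_derivable _ _ g y (z - c) sg).
have zc : c + (z - c) = z by rewrite addrC subrK.
rewrite zc in e; rewrite e.
have /hr/(_ [:: z - c] erefl) : ball c r (c + t *: (z - c)).
  rewrite -ball_normE /= opprD addNKr normrN normrZ ger0_norm //.
  by apply: le_lt_trans zr; rewrite distrC ler_piMl.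
rewrite big_seq1 => /le_trans; apply.
by rewrite ler_wpM2r // lerDl.
Qed.

Lemma smooth_linearization (g : V -> R) c : smooth g -> exists2 C : R, 0 < C &
  \forall z \near c, `|g z - g c - 'D_(z - c) g c| <= C * `|z - c| ^+ 2.
Proof.
move=> sg; have [C C0 hC] := Dseq_bounded co_sum co_le 2 c sg.
exists (C + 1); first by rewrite ltr_wpDl.
move/nbhs_ballP: hC => [r /= r0 hr]; apply/nbhs_ballP; exists r => //= z.
rewrite -ball_normE /= => zr.
have hK (t : R) : 0 <= t <= 1 -> `|Dseq (nseq 2 (z - c)) g (c + t *: (z - c))| <= C * `|z - c| ^+ 2.
  move=> /andP[t0 t1]; have /hr/(_ (nseq 2 (z - c)) erefl) : ball c r (c + t *: (z - c)).
    rewrite -ball_normE /= opprD addNKr normrN normrZ ger0_norm //.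
    by apply: le_lt_trans zr; rewrite distrC ler_piMl.
  by rewrite big_cons big_seq1.
have := taylor_bound sg hK (s := 1); rewrite lexx ler01 => /(_ isT).
rewrite scale1r [c + _]addrC subrK !big_ord_recl big_ord0 /= !expr1n !invr1 !mul1r addr0 opprD addrA.
by move=> /le_trans; apply; rewrite ler_wpM2r // lerDl.
Qed.

End LocalTaylor.

Section Branch.
Variables (R : realType) (n : nat) (F : set_system R) (s : R).
Context {FF : Filter F}.
Hypothesis near_s : forall e : R, 0 < e -> \forall a \near F, `|a - s| < e.
Local Notation vec := ('cV[R]_n.+1).
Local Notation V := (vec * R)%type.
Variables (f : vec -> R -> vec) (x0 : R -> vec).
Hypothesis hf : smooth (fun z : V => f z.1 z.2).
Hypothesis x0_eq : \forall a \near F, f (x0 a) a = 0.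
Hypothesis x0s_eq : f (x0 s) s = 0.
Hypothesis x0_cont : forall e : R, 0 < e -> \forall a \near F, `|x0 a - x0 s| < e.
Local Notation jacC a := (toC (jac (f^~ a) (x0 a))).
Hypothesis jac_unit : jacC s \in unitmx.

Definition basepoint a : V := (x0 a, a).

Lemma near_basepoint (P : V -> Prop) : (\forall z \near basepoint s, P z) ->
  \forall a \near F, P (basepoint a).
Proof.
move/nbhs_ballP => [r /= r0 hr]; apply: filterS2 (near_s r0) (x0_cont r0) => a h1 h2.
apply: hr; rewrite -ball_normE /= prod_normE gt_max /=.
by rewrite [ltLHS]distrC h2 /= distrC.
Qed.

Lemma basepoint_dist a : `|basepoint a - basepoint s| <= `|x0 a - x0 s| + `|a - s|.
Proof. by rewrite prod_normE ge_max /= lerDl lerDr !normr_ge0. Qed.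

(** Linearising the equation of equilibria at the base point gives A (x0 a -
    x0 s) = O(|a - s| + |x0 a - x0 s|^2). The Jacobian A is invertible, and
    the square is absorbed because x0 is continuous. *)
Lemma x0_lipschitz : exists2 C : R, 0 < C & \forall a \near F, `|x0 a - x0 s| <= C * `|a - s|.
Proof.
pose N a : R := `|x0 a - x0 s|; pose g a : R := `|a - s| + N a ^+ 2.
have g0 a : 0 <= g a by rewrite addr_ge0 // sqr_ge0.
have lin : vbO F g (fun a _ => jacC s *m toC (x0 a - x0 s)).
  move=> m.
  have sm := smooth_component hf m.
  have [C C0 hC] := smooth_linearization (@dir_co_sum R n) (@dir_co_le R n) (basepoint s) sm.
  pose K := `|'D_((0, 1) : V) (component f m) (basepoint s)|.
  exists (K + C * 4).
  apply: filterS3 (near_basepoint hC) x0_eq (filterI (near_s ltr01) (x0_cont ltr01)) => a h xa [d1 N1] _.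
  have e : (jacC s *m toC (x0 a - x0 s)) m 0 = ((jac (f^~ s) (x0 s) *m (x0 a - x0 s)) m 0)%:C%C.
    by rewrite -map_mxM mxE.
  rewrite e cmodC -(derive_jac hf).
  have eD : 'D_(basepoint a - basepoint s) (component f m) (basepoint s) =
     'D_((x0 a - x0 s, 0) : V) (component f m) (basepoint s) +
     (a - s) * 'D_((0, 1) : V) (component f m) (basepoint s).
    rewrite -smooth_deriveZ // -smooth_deriveD //; congr ('D_ _ _ _).
    by rewrite [LHS]surjective_pairing [RHS]surjective_pairing /= scaler0 addr0 add0r [_ *: 1]mulr1.
  move: h; rewrite eD {1 2}/component /= xa x0s_eq !mxE subrr sub0r normrN => h.
  have hd := basepoint_dist a.
  have hd2 : `|basepoint a - basepoint s| ^+ 2 <= 4 * g a.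
    apply: (@le_trans _ _ ((N a + `|a - s|) ^+ 2)).
      by rewrite lerXn2r // ?nnegrE ?addr_ge0 ?normr_ge0.
    have := sqr_ge0 (N a - `|a - s|); have : 0 <= `|a - s| by [].
    move: d1; rewrite /g; move: (N a) (`|a - s|) => x y; nra.
  move: h hd2; set D0 := 'D_ _ _ _; set D1 := 'D_ _ _ _ => h hd2.
  have h1 : `|D0| <= `|D0 + (a - s) * D1| + `|a - s| * K.
    rewrite -[X in `|X| <= _](addrK ((a - s) * D1)) (le_trans (ler_normB _ _)) //.
    by rewrite normrM.
  rewrite [`|g a|]ger0_norm // mulrDl; apply: (le_trans h1); rewrite addrC lerD //.
    by rewrite mulrC ler_wpM2l ?normr_ge0 // /g lerDl sqr_ge0.
  apply: (le_trans h); rewrite -mulrA ler_wpM2l //; exact: ltW.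
have [B B0 hB] : exists2 B, 0 < B & \forall a \near F, N a <= B * g a.
  have [B B0 hB] := vbO_unif (vbO_mul (invmx (jacC s)) lin).
  exists B => //; apply: filterS hB => a h.
  apply: mx_norm_le; first by rewrite mulr_ge0 // ltW.
  move=> i j; have := h 0 i; rewrite mulKmx // ger0_norm // mxE cmodC.
  by rewrite ord1.
exists (2 * B); first by rewrite mulr_gt0.
have e0 : 0 < (2 * B)^-1 by rewrite invr_gt0 mulr_gt0.
apply: filterS2 hB (x0_cont e0) => a h1 h2.
have h3 : N a * B <= 2^-1.
  have : N a * (2 * B) <= 1 by rewrite -ler_pdivlMr ?mulr_gt0 // div1r ltW.
  rewrite mulrA mulrAC -mulrA mulrC => h3; rewrite -[2^-1]mul1r ler_pdivlMr //; lra.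
have N0 : 0 <= N a := normr_ge0 _.
move: h1 h3 N0; rewrite /g -/(N a); move: (N a) (`|a - s|) => x y h1 h3 N0.
nra.
Qed.

Lemma lip_field (g : V -> R) : smooth g -> lip F s (fun a => (g (basepoint a))%:C%C).
Proof.
move=> sg; have [C C0 hC] := smooth_lipschitz (@dir_co_sum R n) (@dir_co_le R n) (basepoint s) sg.
have [B B0 hB] := x0_lipschitz.
exists (C * (B + 1)); apply: filterS2 (near_basepoint hC) hB => a h1 h2 _.
have -> : (g (basepoint a))%:C%C - (g (basepoint s))%:C%C =
  (g (basepoint a) - g (basepoint s))%:C%C by rewrite rmorphB.
rewrite cmodC; apply: (le_trans h1); rewrite -mulrA ler_wpM2l ?(ltW C0) //.
apply: (le_trans (basepoint_dist a)); rewrite mulrDl mul1r.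
by rewrite lerD.
Qed.

Lemma lipm_jac : lipm F s (fun a => jacC a).
Proof.
move=> i j.
have h : lip F s (fun a => ('D_(dir R (inl j)) (component f i) (basepoint a))%:C%C).
  by apply: (@lip_field (fun z => 'D_(dir R (inl j)) (component f i) z)); apply: smoothD; exact: smooth_component.
have e a : ('D_(dir R (inl j)) (component f i) (basepoint a))%:C%C = jacC a i j.
  by rewrite mxE jac_component.
exact: lip_ext e h.
Qed.

End Branch.

(** * Perturbation of the critical eigenvalue and its eigenvectors *)

Section EigenvaluePerturbation.
Variables (R : realType) (n : nat) (F : set_system R) (s : R).
Context {FF : Filter F}.
Hypothesis near_s : forall e : R, 0 < e -> \forall a \near F, `|a - s| < e.
Variables (A : R -> 'M[R[i]]_n.+1) (lam : R -> R[i]) (q p : R -> 'cV[R[i]]_n.+1) (w : R).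
Hypothesis w_gt0 : 0 < w.
Hypothesis hA : lipm F s A.
Hypothesis A_real : forall a, map_mx (fun z : R[i] => z^*) (A a) = A a.
Definition eigendata a := [/\ A a *m q a = lam a *: q a,
  (p a)^T *m A a = (lam a)^* *: (p a)^T & inner (p a) (q a) = 1].
Hypothesis near_eigen : \forall a \near F, eigendata a.
Hypothesis eigen_s : eigendata s.
Hypothesis lam_s : lam s = 'i%C * w%:C%C.
Hypothesis simple_lam : mup (lam s) (char_poly (A s)) = 1%N.
Hypothesis stable_rest : forall z : R[i], eigenvalue (A s) z -> z != lam s -> z != (lam s)^* -> Re z < 0.
Hypothesis Im_lam : \forall a \near F, 0 < Im (lam a).
Hypothesis Re_lam : forall e : R, 0 < e -> \forall a \near F, `|Re (lam a)| < e.

Lemma lamJ_s : (lam s)^* = - lam s.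
Proof. by rewrite lam_s; apply: complexP; rewrite ?(cReJ, cImJ, cReN, cImN) ?cReM ?cImM /=; ring. Qed.

Lemma Im_lam_s : Im (lam s) = w. Proof. by rewrite lam_s cImM /=; ring. Qed.

Lemma root_dichotomy z : root (char_poly (A s)) z -> [\/ z = lam s, z = - lam s | Re z < 0].
Proof.
rewrite -eigenvalue_root_char => h.
have [->|z1] := eqVneq z (lam s); first by constructor 1.
have [->|z2] := eqVneq z (lam s)^*; first by constructor 2; rewrite lamJ_s.
by constructor 3; exact: stable_rest.
Qed.

Lemma resolvent_unit z : ~~ root (char_poly (A s)) z -> z%:M - A s \in unitmx.
Proof. by rewrite unitmxE unitfE -horner_char_poly. Qed.

(** The points z considered have positive imaginary part and a real part
    bounded below by a small negative number, whereas the other roots are -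
    lam s, in the lower half-plane, or have negative real part. *)
Lemma separation (r : seq R[i]) : (forall y, y \in r -> y = - lam s \/ Re y < 0) ->
  exists2 rho : R, 0 < rho & forall z, 0 < Im z -> - rho <= Re z ->
    forall y, y \in r -> rho <= cmod (z - y).
Proof.
elim: r => [|y r IH] h; first by exists 1.
have [z zr|rho rho0 hrho] := IH; first by apply: h; rewrite inE zr orbT.
have [ly|ly] := h y (mem_head _ _).
  exists (Num.min rho w); first by rewrite lt_min rho0.
  move=> z z1 z2 x; rewrite inE => /orP[/eqP->|xr].
    rewrite ly opprK (le_trans _ (cmod_Im _)) // cImD Im_lam_s ger0_norm ?addr_ge0 ?(ltW z1) ?(ltW w_gt0) //.
    by rewrite ge_min lerDr (ltW z1) orbT.
  rewrite ge_min (hrho z) // (le_trans _ z2) // lerN2 ge_min lexx //.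
exists (Num.min rho (- Re y / 2)); first by rewrite lt_min rho0 divr_gt0 // oppr_gt0.
move=> z z1 z2 x; rewrite inE => /orP[/eqP->|xr].
  apply: (le_trans _ (cmod_Re _)); rewrite cReD cReN (le_trans _ (ler_norm _)) //.
  have h1 : Num.min rho (- Re y / 2) <= - Re y / 2 by rewrite ge_min lexx orbT.
  move: z2 h1; set m := Num.min _ _; lra.
rewrite ge_min (hrho z) // (le_trans _ z2) // lerN2 ge_min lexx //.
Qed.

(** One factor z - lam s of the characteristic polynomial is split off; lam s
    being simple, the remaining roots stay at a distance rho. *)
Lemma char_poly_lower : exists2 c : R, 0 < c & exists2 rho : R, 0 < rho &
  forall z, 0 < Im z -> - rho <= Re z -> c * cmod (z - lam s) <= cmod (char_poly (A s)).[z].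
Proof.
have [r rE] := closed_field_poly_normal (char_poly (A s)).
move: rE; rewrite (monicP (char_poly_monic _)) scale1r => rE.
have r1 : count_mem (lam s) r = 1%N by rewrite -mu_prod_XsubC -rE.
have lr : lam s \in r by rewrite -has_pred1 has_count r1.
pose r' := rem (lam s) r.
have nr' : lam s \notin r'.
  rewrite -has_pred1 has_count -leqNgt leqn0 /r'.
  have := perm_to_rem lr => /permP/(_ (pred1 (lam s))); rewrite r1 /= eqxx /=.
  by rewrite add1n => -[<-].
have [y yr'|rho rho0 hrho] := @separation r'.
  have yr : y \in r by apply: mem_rem yr'.
  have ry : root (char_poly (A s)) y by rewrite rE root_prod_XsubC.
  have [yl|yl|yl] := root_dichotomy ry; [|by left|by right].
  by move: nr'; rewrite -yl yr'.
exists (rho ^+ size r'); first by rewrite exprn_gt0.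
exists rho => // z z1 z2; rewrite rE horner_prod (big_rem (lam s)) //= hornerXsubC cmodM.
rewrite -/r' mulrC ler_wpM2l ?cmod_ge0 //.
have := hrho z z1 z2; elim: (r') => [|y t IH] h; first by rewrite big_nil cmod1 expr0.
rewrite big_cons cmodM hornerXsubC exprS ler_pM ?exprn_ge0 ?(ltW rho0) //.
  by apply: h; rewrite inE eqxx.
by apply: IH => x xt; apply: h; rewrite inE xt orbT.
Qed.

Lemma eigenvector_neq0 a : eigendata a -> q a != 0.
Proof.
move=> [_ _ h]; apply/eqP => q0; move/eqP: h; rewrite q0 /inner big1 ?[0 == 1]eq_sym ?oner_eq0 //.
by move=> j _; rewrite mxE mulr0.
Qed.

Lemma eigenvalue_bound (M : 'M[R[i]]_n.+1) (v : 'cV[R[i]]_n.+1) z : v != 0 ->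
  M *m v = z *: v -> cmod z <= mxbound M.
Proof.
move=> v0 Mv.
have [i hi] : exists i, forall j, cmod (v j 0) <= cmod (v i 0).
  have [i _ hi] := @arg_maxP _ _ _ (ord0 : 'I_n.+1) xpredT (fun j => cmod (v j 0)) isT.
  by exists i => j; exact: hi.
have vi : 0 < cmod (v i 0).
  rewrite lt_neqAle cmod_ge0 andbT eq_sym cmod_eq0; apply: contraNneq v0 => vi0.
  apply/eqP/matrixP => j k; rewrite ord1 mxE; apply/eqP; rewrite -cmod_eq0.
  by rewrite eq_le cmod_ge0 andbT (le_trans (hi j)) // vi0 cmod0.
have := @mxbound_mul _ _ M v _ hi i; rewrite Mv mxE cmodM.
by rewrite ler_pM2r.
Qed.

Lemma det_eigen a : eigendata a -> \det ((lam a)%:M - A a) = 0.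
Proof.
move=> ea; have [Aq _ _] := ea.
apply/eqP; rewrite -[_ == 0]negbK -unitfE -unitmxE; apply/negP => u.
move/eqP: (eigenvector_neq0 ea); apply; apply: (can_inj (mulKmx u)).
by rewrite mulmx0 mulmxBl mul_scalar_mx Aq subrr.
Qed.

(** The determinant of lam a - A a is 0, hence that of lam a - A s is O(|a -
    s|); by [char_poly_lower] it is also bounded below by a multiple of |lam a
    - lam s|. The signs of Im (lam a) and the smallness of Re (lam a) keep lam
    a away from the other eigenvalues. *)
Lemma lip_lam : lip F s lam.
Proof.
have lamb : bO F (fun=> 1) (fun a (_ : R) => lam a).
  have hb : bO F (fun=> 1) (fun a (_ : R) => (mxbound (A a))%:C%C).
    apply: (@bO_le _ _ _ _ _ (fun a (_ : R) => \sum_i \sum_j (cmod (A a i j))%:C%C)).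
      apply: nearW => a _; rewrite /mxbound rmorph_sum /=.
      by under [X in _ <= cmod X]eq_bigr do rewrite -rmorph_sum.
    apply: bO_sum => i; apply: bO_sum => j; have [h _ _] := lip_close near_s (hA i j).
    by apply: bO_le h; apply: nearW => a _; rewrite cmodC ger0_norm ?cmod_ge0.
  apply: bO_le hb; apply: filterS near_eigen => a ea _; have [Aq _ _] := ea.
  rewrite cmodC ger0_norm ?mxbound_ge0 //.
  exact: eigenvalue_bound (eigenvector_neq0 ea) Aq.
have hdet : bO F (fun a => a - s) (fun a (_ : R) => \det ((lam a)%:M - A a) - \det ((lam a)%:M - A s)).
  have cl : closeO F (fun a => a - s) (fun a (_ : R) => lam a) (fun a (_ : R) => lam a).
    split => //; apply: (bO_eq _ (bO_0 _ _)) => a t; rewrite subrr //.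
  suff [] : closeO F (fun a => a - s) (fun a (_ : R) => \det ((lam a)%:M - A a))
    (fun a (_ : R) => \det ((lam a)%:M - A s)) by [].
  apply: close_det => i j.
  apply: (@close_ext _ _ _ _ (fun a (_ : R) => (i == j)%:R * lam a - A a i j)
    (fun a (_ : R) => (i == j)%:R * lam a - A s i j)).
  - by move=> a t; rewrite !mxE mulr_natl.
  - by move=> a t; rewrite !mxE mulr_natl.
  - apply: close_add; first by apply: close_mul => //; exact: close_cst.
    have h : closeO F (fun a => a - s) (fun _ (_ : R) => - 1 : R[i]) (fun _ (_ : R) => - 1).
      exact: close_cst.
    by apply: close_ext (close_mul h (lip_close near_s (hA i j))) => a t; rewrite mulN1r.
have [c c0 [rho rho0 hc]] := char_poly_lower.
have [C hC] := hdet; exists (C / c).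
apply: filterS3 hC near_eigen (filterI Im_lam (Re_lam rho0)) => a h ea [la ra] t.
have := h t; rewrite (det_eigen ea) sub0r cmodN -horner_char_poly => h1.
have h2 : c * cmod (lam a - lam s) <= cmod (char_poly (A s)).[lam a].
  by apply: hc => //; move: ra; rewrite ltr_norml => /andP[/ltW].
by rewrite mulrAC ler_pdivlMr // mulrC (le_trans h2).
Qed.

Local Notation adj u := (map_mx (fun z : R[i] => z^*) u)^T.
Let P := adj (p s).

(** The rank one term, built from the eigenvectors at s, makes lam a - A a
    invertible near s; eigenvectors at a are then solutions of linear systems,
    and depend on a as regularly as A and lam. They are normalised against the
    eigenvectors at s: the pairings of p s with [right_vector], and of
    [left_vector] with [right_vector], equal 1. *)
Definition bordered a : 'M[R[i]]_n.+1 := (lam a)%:M - A a + q s *m P.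
Definition right_vector a := invmx (bordered a) *m q s.
Definition left_row a := P *m invmx (bordered a).
Definition left_vector a := adj (((left_row a *m right_vector a) 0 0)^-1 *: left_row a).

Lemma left_eigen_row a : eigendata a -> adj (p a) *m A a = lam a *: adj (p a).
Proof.
move=> [_ h _]; have := congr1 (map_mx (fun z : R[i] => z^*)) h.
by rewrite map_mxM A_real map_mxZ /= conjCK map_trmx.
Qed.

Lemma adjK m k (u : 'M[R[i]]_(m, k)) : adj (adj u) = u.
Proof. by apply/matrixP => i j; rewrite !mxE conjCK. Qed.

Lemma lipm_bordered : lipm F s bordered.
Proof.
apply: lipm_add => //; last exact: lipm_cst.
by apply: lipm_add => //; [apply: lipm_scalar => //; exact: lip_lam|exact: lipm_opp].
Qed.

Lemma bordered_unit : bordered s \in unitmx.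
Proof.
have [Aq _ pq] := eigen_s.
have e : P *m q s = 1%:M by rewrite innerE pq.
exact: simple_eigen_unit Aq e simple_lam.
Qed.

Lemma bordered_q a : eigendata a -> bordered a *m q a = inner (p s) (q a) *: q s.
Proof.
move=> [Aq _ _]; rewrite /bordered mulmxDl mulmxBl mul_scalar_mx Aq subrr add0r -mulmxA innerE.
by rewrite mul_mx_scalar.
Qed.

Lemma bordered_p a : eigendata a -> adj (p a) *m bordered a = inner (p a) (q s) *: P.
Proof.
move=> ea; rewrite /bordered mulmxDr mulmxBr mul_mx_scalar (left_eigen_row ea) subrr add0r mulmxA innerE.
by rewrite mul_scalar_mx.
Qed.

(** The bordered matrix sends q a to a multiple of q s, by [bordered_q]. *)
Lemma right_vector_eigen a : eigendata a -> bordered a \in unitmx ->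
  q a = inner (p s) (q a) *: right_vector a.
Proof.
move=> ea u; apply: (can_inj (mulKmx u)).
by rewrite bordered_q // -scalemxAr mulKVmx.
Qed.

Lemma overlap_neq0 a : eigendata a -> bordered a \in unitmx -> inner (p s) (q a) != 0.
Proof.
move=> ea u; apply: contraNneq (eigenvector_neq0 ea) => c0.
by rewrite (right_vector_eigen ea u) c0 scale0r.
Qed.

Lemma right_vector_normalized a : eigendata a -> bordered a \in unitmx ->
  inner (p s) (right_vector a) = 1.
Proof.
move=> ea u; apply: (mulfI (overlap_neq0 ea u)).
by rewrite mulr1 -innerZ -right_vector_eigen.
Qed.

Lemma left_vector_eigen a : eigendata a -> bordered a \in unitmx ->
  p a = ((inner (p s) (q a))^*)^-1 *: left_vector a.
Proof.
move=> ea u; set c := inner (p s) (q a); have c0 : c != 0 := overlap_neq0 ea u.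
set d := inner (p a) (q s).
have pE : adj (p a) = d *: left_row a.
  apply: (can_inj (mulmxK u)); rewrite bordered_p // -scalemxAl /left_row.
  by rewrite mulmxKV.
have [_ _ pq] := ea.
have e1 : d * c * (left_row a *m right_vector a) 0 0 = 1.
  have := innerE (p a) (q a); rewrite pE (right_vector_eigen ea u) -/c -scalemxAr -scalemxAl scalerA.
  rewrite -right_vector_eigen // pq => /matrixP/(_ 0 0); rewrite !mxE mulr1n => <-.
  by rewrite mulrC [c * d]mulrC mulrC.
set eps := (left_row a *m right_vector a) 0 0 in e1.
rewrite -[LHS](adjK (p a)) pE /left_vector -/eps.
have -> : eps^-1 = d * c.
  have eps0 : eps != 0 by apply: contra_eq_neq e1 => ->; rewrite mulr0 eq_sym oner_eq0.
  by apply: (mulIf eps0); rewrite mulVf.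
rewrite [d * c]mulrC -scalerA; move: (d *: left_row a) => v.
rewrite map_mxZ linearZ /= scalerA mulVf ?scale1r // conjC_eq0 //.
Qed.

Lemma vectors_at_s : right_vector s = q s /\ left_vector s = p s.
Proof.
have [_ _ pq] := eigen_s; have u := bordered_unit.
have := right_vector_eigen eigen_s u; rewrite pq scale1r => e; split => //.
by have := left_vector_eigen eigen_s u; rewrite pq rmorph1 invr1 scale1r.
Qed.

Lemma lipm_right_vector : lipm F s right_vector.
Proof.
apply: lipm_mul => //; last exact: lipm_cst.
exact: (lipm_inv near_s) lipm_bordered bordered_unit.
Qed.

Lemma lipm_left_vector : lipm F s left_vector.
Proof.
have hl : lipm F s left_row.
  apply: lipm_mul => //; first exact: lipm_cst.
  exact: (lipm_inv near_s) lipm_bordered bordered_unit.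
have hr := lipm_right_vector.
have he : lip F s (fun a => (left_row a *m right_vector a) 0 0) by exact: (lipm_mul near_s hl hr).
apply: lipm_tr; apply: (lipm_conj near_s); apply: lipm_scale => //.
apply: (lip_inv near_s) => //.
have [qE pE] := vectors_at_s.
have [_ _ pq] := eigen_s.
apply/negP => /eqP z; move: pE; rewrite /left_vector z invr0 scale0r.
move=> p0; move/eqP: pq; rewrite -p0 /inner big1 ?[0 == 1]eq_sym ?oner_eq0 // => j _.
by rewrite !mxE !rmorph0 mul0r.
Qed.

(** Pairing A a - A s with p s on the left and [right_vector] on the right
    gives lam a - lam s exactly; replacing the right vector by q s costs a
    product of two increments. *)
Lemma eigenvalue_shift :
  bO F (fun a => `|a - s| ^+ 2) (fun a (_ : R) => inner (p s) ((A a - A s) *m q s) - (lam a - lam s)).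
Proof.
have hu : \forall a \near F, bordered a \in unitmx.
  exact: (lipm_unit near_s lipm_bordered bordered_unit).
pose D a := A a - A s.
apply: (@bO_near _ _ _ _ _ (fun a (_ : R) => - inner (p s) (D a *m (right_vector a - right_vector s)))).
  apply: filterS2 hu near_eigen => a u ea _.
  have [qE _] := vectors_at_s; rewrite qE mulmxBr innerB.
  have e1 : inner (p s) (D a *m right_vector a) = lam a - lam s.
    have n1 := right_vector_normalized ea u; have [Aq _ _] := ea; have [_ pA _] := eigen_s.
    have Ar : A a *m right_vector a = lam a *: right_vector a.
      have c0 := overlap_neq0 ea u.
      have qe : right_vector a = (inner (p s) (q a))^-1 *: q a.
        have e := right_vector_eigen ea u.
        move: e c0; move: (inner (p s) (q a)) => k e k0.
        by rewrite e scalerA mulVf // scale1r.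
      by rewrite qe -scalemxAr Aq !scalerA mulrC.
    by rewrite mulmxBl innerB Ar innerZ n1 (inner_left_eigen _ (A_real s) pA) n1 !mulr1.
  by rewrite e1 opprB.
apply: bO_opp; apply: bO_inner.
have h : vbO F (fun a => (a - s) * (a - s)) (fun a (_ : R) => D a *m (right_vector a - right_vector s)).
  apply: vbO_mulf.
    by move=> i j; apply: bO_eq (hA i j) => a t; rewrite !mxE.
  by move=> i; apply: bO_eq (lipm_right_vector i 0) => a t; rewrite !mxE.
apply: vbO_gauge h; apply: nearW => a.
by rewrite -expr2 !normrX normr_id.
Qed.

End EigenvaluePerturbation.

(** * Splitting a periodic orbit into odd and even parts *)

Section OrbitSplitting.
Variables (R : realType) (n : nat).
Local Notation vec := ('cV[R]_n.+1).
Variables (f : vec -> vec) (A0 : 'M[R]_n.+1) (z0 : vec) (y : R -> vec) (T : R).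
Hypothesis f_cont : forall i, continuous (fun z => f z i 0).
Hypothesis y_orbit : periodic_orbit f y T.
Hypothesis y_bounded : forall t, `|y t - z0| <= 1.

Definition odd_part (g : R -> vec) (t : R) : vec := 2^-1 *: (g t - g (t + T / 2)).
Definition even_part (g : R -> vec) (t : R) : vec := 2^-1 *: (g t + g (t + T / 2)).
Definition amplitude : R := sup (range (fun t => `|y t - z0|)).

Let u t := y t - z0.
Let O := odd_part u.
Let E := even_part u.
Let B := jac f z0.

Definition odd_rest t : vec := odd_part (f \o y) t - B *m O t.
Definition even_rest t : vec := even_part (f \o y) t - B *m E t.

Lemma orbit_T_gt0 : 0 < T. Proof. by case: y_orbit => _ []. Qed.

Lemma orbit_period t : y (t + T) = y t. Proof. by case: y_orbit => _ [_ h _]; exact: h. Qed.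

Lemma orbit_split t : z0 + E t + O t = y t /\ z0 + E t - O t = y (t + T / 2).
Proof.
rewrite /E /O /odd_part /even_part /u; by split; apply/matrixP => i j; rewrite !mxE; field.
Qed.

Lemma half_twice t : t + T / 2 + T / 2 = t + T.
Proof. by rewrite -addrA -splitr. Qed.

Lemma odd_part_shift (g : R -> vec) t : g (t + T) = g t -> odd_part g (t + T / 2) = - odd_part g t.
Proof. by move=> h; rewrite /odd_part half_twice h -scalerN opprB. Qed.

Lemma even_part_shift (g : R -> vec) t : g (t + T) = g t -> even_part g (t + T / 2) = even_part g t.
Proof. by move=> h; rewrite /even_part half_twice h addrC. Qed.

Lemma orbit_derive i t : is_derive t (1 : R) (fun t => y t i 0) (f (y t) i 0).
Proof.
have [dy ey] := y_orbit.1 t; apply: DeriveDef; first by move/derivable_mxP: dy; apply.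
by rewrite -ey derive_mx // mxE.
Qed.

Lemma orbit_derive_shift i t (r : R) :
  is_derive t (1 : R) (fun t => y (t + r) i 0) (f (y (t + r)) i 0).
Proof.
have [d e] := orbit_derive i (t + r).
by rewrite -e; exact: is_derive_translate d.
Qed.

Lemma orbit_cont i : continuous (fun t => y t i 0).
Proof. exact: derive_continuous (orbit_derive i). Qed.

Lemma amplitude_le (C : R) : (forall t, `|y t - z0| <= C) -> amplitude <= C.
Proof.
move=> h; apply: ge_sup; first by exists `|y 0 - z0|, 0.
by move=> _ [t _ <-].
Qed.

Lemma le_amplitude t : `|u t| <= amplitude.
Proof.
apply: ub_le_sup; last by exists t.
by exists 1 => _ [t' _ <-].
Qed.

Lemma amplitude_gt0 : 0 < amplitude.
Proof.
rewrite ltNge; apply/negP => h.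
have c t : y t = z0.
  apply/eqP; rewrite -subr_eq0 -normr_le0; exact: le_trans (le_amplitude t) h.
have [_ [T0 _ min]] := y_orbit.
have [|t] := min (T / 2); last by rewrite !c.
by rewrite divr_gt0 //= ltr_pdivrMr // ltr_pMr // ltr1n.
Qed.

Lemma odd_amplitude t : `|O t| <= amplitude.
Proof.
rewrite /O /odd_part normrZ ger0_norm // mulrC ler_pdivrMr // mulr_natr mulr2n.
apply: (le_trans (ler_normB _ _)); rewrite lerD //; exact: le_amplitude.
Qed.

Lemma even_amplitude t : `|E t| <= amplitude.
Proof.
rewrite /E /even_part normrZ ger0_norm // mulrC ler_pdivrMr // mulr_natr mulr2n.
apply: (le_trans (ler_normD _ _)); rewrite lerD //; exact: le_amplitude.
Qed.

Lemma ccont_toC (g : R -> vec) i : continuous (fun t => g t i 0) -> ccont (fun t => toC (g t) i 0).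
Proof.
move=> c; split; last first.
  rewrite (_ : (fun t => _) = fun=> 0); first exact: continuous_cst.
  by apply/funext => t; rewrite mxE.
by rewrite (_ : (fun t => _) = fun t => g t i 0) //; apply/funext => t; rewrite mxE.
Qed.

Lemma cder_toC (g g' : R -> vec) i :
  (forall t, is_derive t (1 : R) (fun t => g t i 0) (g' t i 0)) ->
  cder (fun t => toC (g t) i 0) (fun t => toC (g' t) i 0).
Proof.
move=> d t; rewrite mxE /=; split.
  by rewrite (_ : (fun t => _) = fun t => g t i 0) //; apply/funext => r; rewrite mxE.
rewrite (_ : (fun t => _) = cst 0); first exact: is_derive_cst.
by apply/funext => r; rewrite mxE.
Qed.

Lemma field_cont i (r : R) : continuous (fun t => f (y (t + r)) i 0).
Proof.
move=> t; apply: (@continuous_comp _ _ _ (fun t => y (t + r)) (fun z => f z i 0)); last exact: f_cont.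
apply/cvgrPdist_le => e e0.
have h : \forall t' \near t, forall j : 'I_n.+1, `|y (t + r) j 0 - y (t' + r) j 0| <= e.
  apply: (@filter_forall _ _ (fun j t' => `|y (t + r) j 0 - y (t' + r) j 0| <= e) (nbhs t)) => j.
  have cj : continuous (fun t => y t j 0) by exact: orbit_cont.
  have c : continuous (fun t => y (t + r) j 0) by exact: continuous_comp_addr cj.
  by have /cvgrPdist_le /(_ _ e0) := c t.
apply: filterS h => t' h; apply: mx_norm_le; first exact: ltW.
by move=> j k; rewrite !mxE ord1; exact: h.
Qed.

Lemma toCD m k (X Y : 'M[R]_(m, k)) : toC (X + Y) = toC X + toC Y.
Proof. exact: (map_mxD (real_complex R)). Qed.

Lemma toCB m k (X Y : 'M[R]_(m, k)) : toC (X - Y) = toC X - toC Y.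
Proof. exact: (map_mxB (real_complex R)). Qed.

Lemma toCM m k l (X : 'M[R]_(m, k)) (Y : 'M[R]_(k, l)) : toC (X *m Y) = toC X *m toC Y.
Proof. exact: (map_mxM (real_complex R)). Qed.

Lemma vder_orbit (r : R) : vder (fun t => toC (y (t + r))) (fun t => toC (f (y (t + r)))).
Proof. by move=> i; apply: cder_toC => t; exact: orbit_derive_shift. Qed.

Lemma vder_halves (a : vec -> vec -> vec) (X Y X' Y' : R -> vec) (k l : R) :
  (forall U V i, a U V i 0 = k * U i 0 + l * V i 0) ->
  vder (fun t => toC (X t)) (fun t => toC (X' t)) ->
  vder (fun t => toC (Y t)) (fun t => toC (Y' t)) ->
  vder (fun t => toC (a (X t) (Y t))) (fun t => toC (a (X' t) (Y' t))).
Proof.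
move=> ha dX dY i; apply: (cder_ext (cderD (cderZ k%:C%C (dX i)) (cderZ l%:C%C (dY i)))) => t.
  by rewrite !mxE ha !rmorphD !rmorphM.
by rewrite !mxE ha !rmorphD !rmorphM.
Qed.

Lemma vder_orbit0 : vder (fun t => toC (y t)) (fun t => toC (f (y t))).
Proof.
by move=> i; apply: cder_toC => t; exact: orbit_derive.
Qed.

Lemma vder_odd : vder (fun t => toC (O t)) (fun t => toC (odd_part (f \o y) t)).
Proof.
have ha (U V : vec) i : (2^-1 *: (U - V)) i 0 = 2^-1 * U i 0 + - 2^-1 * V i 0.
  by rewrite !mxE; ring.
apply: (vder_ext (vder_halves ha vder_orbit0 (vder_orbit (T / 2)))) => t //.
by congr toC; rewrite /O /odd_part /u; congr (_ *: _); rewrite opprB addrA subrK.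
Qed.

Lemma vder_even : vder (fun t => toC (E t)) (fun t => toC (even_part (f \o y) t)).
Proof.
have ha (U V : vec) i : (2^-1 *: (U + V)) i 0 = 2^-1 * U i 0 + 2^-1 * V i 0.
  by rewrite !mxE; ring.
have d := vder_halves ha vder_orbit0 (vder_orbit (T / 2)).
move=> i; apply: (cder_ext (cderB (d i) (cder_cst (z0 i 0)%:C%C))) => t; last by rewrite subr0.
by rewrite !mxE -rmorphB /=; congr (_%:C%C); field.
Qed.

Lemma ccont_entry_mul (X : 'M[R[i]]_n.+1) (v : R -> 'cV[R[i]]_n.+1) i :
  (forall j, ccont (fun t => v t j 0)) -> ccont (fun t => (X *m v t) i 0).
Proof.
move=> c; apply: (@ccont_ext _ (fun t => \sum_j X i j * v t j 0)).
  by apply: ccont_sum => j; exact: ccontZ.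
by move=> t; rewrite mxE.
Qed.

Lemma ccont_halves (g : R -> vec) (k l : R) i :
  (forall t, g t i 0 = k * f (y t) i 0 + l * f (y (t + T / 2)) i 0) ->
  ccont (fun t => toC (g t) i 0).
Proof.
move=> hg; apply: ccont_toC; rewrite (_ : (fun t => _) = fun t => k * f (y (t + 0)) i 0 + l * f (y (t + T / 2)) i 0).
  move=> t; apply: cvgD; apply: cvgMr; exact: field_cont.
by apply/funext => t; rewrite hg addr0.
Qed.

(** Half differences and half sums of a solution and its shift by T / 2
    commute with the time derivative and with the linear part, so the equation
    separates by parity, each part being forced by the nonlinear terms of its
    own parity. The distance to the equilibrium is at most |o| + |e|, whence
    the minimality of the amplitude. *)
Lemma orbit_oscillation : oscillation (toC A0) (toC (B - A0)) T (2 * pi / T) amplitude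
  (fun t => toC (O t)) (fun t => toC (E t)) (fun t => toC (odd_rest t)) (fun t => toC (even_rest t)).
Proof.
have T0 := orbit_T_gt0.
have uT t : u (t + T) = u t by rewrite /u orbit_period.
have cO i : ccont (fun t => toC (O t) i 0) := cder_cont (vder_odd i).
have cE i : ccont (fun t => toC (E t) i 0) := cder_cont (vder_even i).
have rest (X Y : vec) : toC A0 *m toC X + (toC (B - A0) *m toC X + toC (Y - B *m X)) = toC Y.
  rewrite -!toCM -!toCD; congr toC; rewrite mulmxBl.
  by move: (A0 *m X) (B *m X) => U V; apply/matrixP => i j; rewrite !mxE; ring.
split.
- exact: T0.
- by rewrite divfK // gt_eqF.
- exact: amplitude_gt0.
- by apply: (vder_ext vder_odd) => t //; rewrite rest.
- by apply: (vder_ext vder_even) => t //; rewrite rest.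
- move=> t; rewrite /O odd_part_shift //; exact: (map_mxN (real_complex R)).
- by move=> t; rewrite /E even_part_shift.
- by move=> t i; rewrite mxE conjCR.
- move=> i; apply: (@ccont_ext _ (fun t => toC (odd_part (f \o y) t) i 0 - (toC B *m toC (O t)) i 0)).
    apply: ccontB; last exact: ccont_entry_mul.
    by apply: (@ccont_halves _ 2^-1 (- 2^-1)) => t; rewrite !mxE /=; ring.
  by move=> t; rewrite -toCM /odd_rest toCB; move: (toC _) (toC _) => X Y; rewrite !mxE.
- move=> i; apply: (@ccont_ext _ (fun t => toC (even_part (f \o y) t) i 0 - (toC B *m toC (E t)) i 0)).
    apply: ccontB; last exact: ccont_entry_mul.
    by apply: (@ccont_halves _ 2^-1 2^-1) => t; rewrite !mxE /=; ring.
  by move=> t; rewrite -toCM /even_rest toCB; move: (toC _) (toC _) => X Y; rewrite !mxE.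
- move=> C hC; apply: amplitude_le => t.
  have C0 : 0 <= C by apply: le_trans (hC 0 0); rewrite addr_ge0 ?cmod_ge0.
  apply: mx_norm_le => // i j; rewrite ord1; have := hC t i; rewrite !mxE !cmodC.
  move: (y t i 0 - _) (y (t + T / 2) i 0 - _) => U V; apply: le_trans.
  apply: le_trans (ler_normD _ _); rewrite le_eqVlt; apply/orP; left; apply/eqP.
  by congr `|_|; field.
Qed.

(** The odd part averages to zero. *)
Lemma time_average_even : toC (time_average y T - z0) = vmode T (fun=> 1) (fun t => toC (E t)).
Proof.
have T0 := orbit_T_gt0.
have uT t : u (t + T) = u t by rewrite /u orbit_period.
have cO i : ccont (fun t => toC (O t) i 0) := cder_cont (vder_odd i).
have cE i : ccont (fun t => toC (E t) i 0) := cder_cont (vder_even i).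
apply/matrixP => i j; rewrite ord1 !mxE.
rewrite (@cmean_ext _ _ _ (fun t => toC (E t) i 0)); last by move=> t; rewrite mulr1.
have o0 : cmean T (fun t => toC (O t) i 0) = 0.
  apply: cmean_antiperiodic => // t; rewrite /O odd_part_shift // !mxE; exact: rmorphN.
rewrite -[RHS]add0r -o0 -cmeanD //.
rewrite (@cmean_ext _ _ _ (fun t => toC (y t) i 0 + (- z0 i 0)%:C%C)); last first.
  by move=> t; rewrite /O /E /odd_part /even_part /u !mxE -!rmorphD /=; congr (_%:C%C); field.
rewrite cmeanD; last by rewrite /ccont; split; exact: continuous_cst.
  rewrite cmean_cst // rmorphB rmorphN /=; congr (_ - _).
  rewrite /cmean; apply: complexP => /=.
    by rewrite /mean; congr (_ * _); congr (Rintegral _ _ _); apply/funext => t; rewrite mxE.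
  by rewrite (_ : (fun t => _) = fun=> 0) ?mean_cst //; apply/funext => t; rewrite mxE.
exact: cder_cont (vder_orbit0 i).
Qed.

End OrbitSplitting.

(** * Taylor expansion of the field along the cycles *)

(** The variables p1 and p2 stand for the norms of the even and odd parts, d
    for the distance between base points, m for the amplitude and e for the
    distance of parameters. *)
Section TaylorArithmetic.
Variables (R : realType) (p1 p2 d m e B C : R).
Hypotheses (p10 : 0 <= p1) (p20 : 0 <= p2) (d0 : 0 <= d) (m0 : 0 <= m) (e0 : 0 <= e).
Hypotheses (B0 : 0 <= B) (C0 : 0 <= C).
Hypotheses (hp1 : p1 <= B * m ^+ 2) (hp2 : p2 <= m) (hd : d <= C * e).

Let p1d : p1 + d <= B * m ^+ 2 + C * e. Proof. exact: lerD. Qed.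
Let p1d0 : 0 <= p1 + d. Proof. exact: addr_ge0. Qed.
Let pw k : p2 ^+ k <= m ^+ k. Proof. by rewrite lerXn2r. Qed.
Let m2 : 0 <= m ^+ 2. Proof. exact: exprn_ge0. Qed.

Lemma even_remainder :
  p1 ^+ 2 + p2 ^+ 4 + (p1 + d) * p2 ^+ 2 <= (B ^+ 2 + 1 + B + C) * ((m ^+ 2 + e) * m ^+ 2).
Proof.
have q1 : p1 ^+ 2 <= B ^+ 2 * m ^+ 4.
  by rewrite (le_trans (y := (B * m ^+ 2) ^+ 2)) ?lerXn2r ?nnegrE ?mulr_ge0 // exprMn -exprM.
have q3 : (p1 + d) * p2 ^+ 2 <= (B * m ^+ 2 + C * e) * m ^+ 2 by rewrite ler_pM ?exprn_ge0.
apply: (le_trans (lerD (lerD q1 (pw 4)) q3)).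
have r1 : 0 <= C * m ^+ 4 by rewrite mulr_ge0 ?exprn_ge0.
have r2 : 0 <= (B ^+ 2 + 1 + B) * (e * m ^+ 2) by rewrite mulr_ge0 ?addr_ge0 ?exprn_ge0 ?mulr_ge0.
rewrite -subr_ge0; apply: le_trans (addr_ge0 r1 r2) _.
by rewrite le_eqVlt; apply/orP; left; apply/eqP; ring.
Qed.

Lemma odd_remainder : p2 ^+ 5 + p1 ^+ 2 * p2 + d * (p1 * p2) + (p1 + d) * p2 ^+ 3 <=
  (B ^+ 2 + 1 + B + C + C * B) * ((m ^+ 2 + e) * m ^+ 3).
Proof.
have q1 : p1 ^+ 2 * p2 <= B ^+ 2 * m ^+ 4 * m.
  rewrite ler_pM ?exprn_ge0 //.
  by rewrite (le_trans (y := (B * m ^+ 2) ^+ 2)) ?lerXn2r ?nnegrE ?mulr_ge0 // exprMn -exprM.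
have q2 : d * (p1 * p2) <= C * e * (B * m ^+ 2 * m).
  by rewrite ler_pM ?mulr_ge0 // ler_pM.
have q3 : (p1 + d) * p2 ^+ 3 <= (B * m ^+ 2 + C * e) * m ^+ 3 by rewrite ler_pM ?exprn_ge0.
apply: (le_trans (lerD (lerD (lerD (pw 5) q1) q2) q3)).
have r1 : 0 <= (C + C * B) * m ^+ 5 by rewrite mulr_ge0 ?addr_ge0 ?mulr_ge0 ?exprn_ge0.
have r2 : 0 <= (B ^+ 2 + 1 + B) * (e * m ^+ 3).
  by rewrite mulr_ge0 ?addr_ge0 ?exprn_ge0 ?mulr_ge0 ?exprn_ge0.
rewrite -subr_ge0; apply: le_trans (addr_ge0 r1 r2) _.
by rewrite le_eqVlt; apply/orP; left; apply/eqP; ring.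
Qed.

End TaylorArithmetic.

Section TaylorFamilies.
Variables (R : realType) (n : nat) (F : set_system R) (s : R).
Context {FF : Filter F}.
Hypothesis near_s : forall e : R, 0 < e -> \forall a \near F, `|a - s| < e.
Local Notation vec := ('cV[R]_n.+1).
Local Notation V := (vec * R)%type.
Variables (f : vec -> R -> vec) (x0 : R -> vec) (x : R -> R -> vec) (T : R -> R).
Hypothesis hf : smooth (fun z : V => f z.1 z.2).
Hypothesis x0_eq : \forall a \near F, f (x0 a) a = 0.
Hypothesis x0_cont : forall e : R, 0 < e -> \forall a \near F, `|x0 a - x0 s| < e.
Hypothesis x0_lip : exists2 C : R, 0 < C & \forall a \near F, `|x0 a - x0 s| <= C * `|a - s|.
Hypothesis x_small : forall e : R, 0 < e -> \forall a \near F, forall t, `|x a t - x0 a| < e.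

Definition tensor2 (z : V) (m j k : 'I_n.+1) : R[i] :=
  (Dseq [:: dir R (inl j); dir R (inl k)] (component f m) z)%:C%C.
Definition tensor3 (z : V) (m j k l : 'I_n.+1) : R[i] :=
  (Dseq [:: dir R (inl l); dir R (inl j); dir R (inl k)] (component f m) z)%:C%C.

Lemma Dseq_swap (g : V -> R) u v : smooth g -> Dseq [:: u; v] g = Dseq [:: v; u] g.
Proof. by move=> sg; apply/funext => z; exact: derive_comm. Qed.

Lemma tensor2_sym z m j k : tensor2 z m j k = tensor2 z m k j.
Proof. by rewrite /tensor2 Dseq_swap //; exact: smooth_component. Qed.

Lemma tensor3_sym12 z m j k l : tensor3 z m j k l = tensor3 z m k j l.
Proof.
have h := Dseq_swap (dir R (inl j)) (dir R (inl k)) (smooth_component hf m).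
exact: (congr1 (fun g : V -> R => (Dseq [:: dir R (inl l)] g z)%:C%C) h).
Qed.

Lemma tensor3_swap z m j k l : tensor3 z m j k l = tensor3 z m l k j.
Proof.
have h := Dseq_swap (dir R (inl l)) (dir R (inl j)) (smoothD (dir R (inl k)) (smooth_component hf m)).
exact: (congr1 (fun g => (g z)%:C%C) h).
Qed.

Lemma tensor3_sym23 z m j k l : tensor3 z m j k l = tensor3 z m j l k.
Proof. by rewrite tensor3_sym12 tensor3_swap tensor3_sym12. Qed.

Lemma Bform_tensor2 z (u v : vec) m :
  Bform (tensor2 z) (toC u) (toC v) m 0 = (Dseq [:: (v, 0) : V; (u, 0) : V] (component f m) z)%:C%C.
Proof.
rewrite derive2_state // mxE rmorph_sum; apply: eq_bigr => j _.
by rewrite rmorph_sum; apply: eq_bigr => k _; rewrite !mxE !rmorphM.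
Qed.

Lemma Cform_tensor3 z (u v w : vec) m : Cform (tensor3 z) (toC u) (toC v) (toC w) m 0 =
  (Dseq [:: (w, 0) : V; (v, 0) : V; (u, 0) : V] (component f m) z)%:C%C.
Proof.
rewrite derive3_state // mxE rmorph_sum; apply: eq_bigr => j _.
rewrite rmorph_sum; apply: eq_bigr => k _.
by rewrite rmorph_sum; apply: eq_bigr => l _; rewrite !mxE !rmorphM.
Qed.

(** Order five is the highest one met: odd parts are expanded to fourth order,
    with a remainder of order five. *)
Lemma derivatives_bounded : exists2 K : R, 0 <= K & exists2 r : R, 0 < r &
  forall m y, `|basepoint x0 s - y| < r -> forall vs, (1 < size vs <= 5)%N ->
    `|Dseq vs (component f m) y| <= K * \prod_(v <- vs) `|v|.
Proof.
pose c := basepoint x0 s.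
have H (p : 'I_n.+1 * 'I_6) := Dseq_bounded (@dir_co_sum R n) (@dir_co_le R n) p.2 c
  (smooth_component hf p.1).
pose C p := sval (cid2 (H p)).
have C0 p : 0 <= C p by rewrite /C; case: cid2.
have hC : \forall y \near c, forall p : 'I_n.+1 * 'I_6, forall vs : seq V, size vs = p.2 ->
    `|Dseq vs (component f p.1) y| <= C p * \prod_(v <- vs) `|v|.
  apply: (@filter_forall _ _ (fun (p : 'I_n.+1 * 'I_6) y => forall vs : seq V, size vs = p.2 ->
    `|Dseq vs (component f p.1) y| <= C p * \prod_(v <- vs) `|v|) (nbhs c)) => p.
  by rewrite /C; case: cid2.
exists (\sum_p C p); first exact: sumr_ge0.
move/nbhs_ballP: hC => [r /= r0 hr]; exists r => // m y yr vs /andP[_ s5].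
have /hr/(_ (m, inord (size vs)) vs) : ball c r y by rewrite -ball_normE.
rewrite /= inordK // => /(_ erefl) /le_trans; apply.
rewrite ler_wpM2r ?prodr_ge0 // (bigD1 (m, inord (size vs))) //= lerDl.
by apply: sumr_ge0 => p _.
Qed.

Local Notation O a t := (odd_part (T a) (fun t0 => x a t0 - x0 a) t).
Local Notation E a t := (even_part (T a) (fun t0 => x a t0 - x0 a) t).
Local Notation M a := (amplitude (x0 a) (x a)).
Local Notation de a := `|a - s|.
Local Notation Fo a t := (odd_rest (f^~ a) (x0 a) (x a) (T a) t).
Local Notation Fe a t := (even_rest (f^~ a) (x0 a) (x a) (T a) t).
Local Notation bs := (basepoint x0 s).

(** The central expansions around the equilibrium at parameter a, with second
    and third derivatives taken at the fixed parameter s so that the tensors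
    do not vary. *)
Lemma rest_taylor : exists2 K : R, 0 <= K & \forall a \near F, forall t m,
  let d := `|bs - basepoint x0 a| in
  `|Fe a t m 0 - 2^-1 * Dseq [:: (O a t, 0) : V; (O a t, 0) : V] (component f m) bs| <=
     K * (`|E a t| ^+ 2 + `|O a t| ^+ 4 + (`|E a t| + d) * `|O a t| ^+ 2) /\
  `|Fo a t m 0 - (Dseq [:: (O a t, 0) : V; (E a t, 0) : V] (component f m) bs +
     6^-1 * Dseq [:: (O a t, 0) : V; (O a t, 0) : V; (O a t, 0) : V] (component f m) bs)| <=
     K * (`|O a t| ^+ 5 + `|E a t| ^+ 2 * `|O a t| + d * (`|E a t| * `|O a t|) +
       (`|E a t| + d) * `|O a t| ^+ 3).
Proof.
have [K K0 [r r0 hK]] := derivatives_bounded; exists K => //.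
have r3 : 0 < r / 4 by rewrite divr_gt0.
near=> a; move=> t m; set d := `|bs - basepoint x0 a|.
have xa : f (x0 a) a = 0 by near: a.
have x1 t' : `|x a t' - x0 a| <= 1 by apply: ltW; move: t'; near: a; exact: x_small.
have M3 : M a <= r / 4.
  by apply: amplitude_le => t'; apply: ltW; move: t'; near: a; exact: x_small.
have d3 : d < r / 4.
  rewrite /d distrC (le_lt_trans (basepoint_dist _ _ _)) //.
  have h1 : `|a - s| < r / 8 by near: a; apply: near_s; rewrite divr_gt0.
  have h2 : `|x0 a - x0 s| < r / 8 by near: a; apply: x0_cont; rewrite divr_gt0.
  lra.
have [s1 s2] := orbit_split (x0 a) (x a) (T a) t.
have hE := le_trans (even_amplitude (T a) x1 t) M3.
have hO := le_trans (odd_amplitude (T a) x1 t) M3.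
move: s1 s2 hE hO; rewrite /odd_rest /even_rest.
move: (O a t) (E a t) => Ot Et s1 s2 hE hO.
have sm := smooth_component hf m.
have nb : `|bs - basepoint x0 a| + `|((Et, 0) : V)| + `|((Ot, 0) : V)| < r.
  by rewrite !state_norm -/d; move: d3 hE hO; move: d (`|Et|) (`|Ot|) => p1 p2 p3; lra.
have bE : basepoint x0 a + ((Et, 0) : V) + ((Ot, 0) : V) = (x a t, a).
  by rewrite -s1 /basepoint; apply/pair_equal_spec; rewrite /= !addr0.
have bO' : basepoint x0 a + ((Et, 0) : V) - ((Ot, 0) : V) = (x a (t + T a / 2), a).
  by rewrite -s2 /basepoint; apply/pair_equal_spec; rewrite /= subr0 addr0.
split.
- have := even_taylor sm K0 (hK m) nb.
  rewrite bE bO' {1}/component /= xa mxE => /(_ erefl).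
  by rewrite (derive_jac hf) !state_norm /even_part /component /= !mxE.
- have := odd_taylor sm K0 (hK m) nb.
  rewrite bE bO' (derive_jac hf) !state_norm /odd_part /component /=.
  by rewrite !mxE.
Unshelve. all: by end_near. Qed.

Lemma vbO_toC (g : R -> R) (X : R -> R -> vec) (C : R) :
  (\forall a \near F, forall t m, `|X a t m 0| <= C * `|g a|) -> vbO F g (fun a t => toC (X a t)).
Proof. by move=> h m; exists C; apply: filterS h => a h t; rewrite mxE cmodC. Qed.

Lemma vbO_toC_norm (g : R -> R) (X : R -> R -> vec) : vbO F g (fun a t => toC (X a t)) ->
  exists2 C : R, 0 < C & \forall a \near F, forall t, `|X a t| <= C * `|g a|.
Proof.
move=> /vbO_unif[C C0 h]; exists C => //; apply: filterS h => a h t.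
apply: mx_norm_le; first by rewrite mulr_ge0 // ltW.
by move=> i j; rewrite ord1; have := h t i; rewrite mxE cmodC.
Qed.

Lemma amplitude_small (r : R) : 0 < r -> \forall a \near F, M a < r.
Proof.
move=> r0; have r2 : 0 < r / 2 by rewrite divr_gt0.
apply: filterS (x_small r2) => a h; apply: (@le_lt_trans _ _ (r / 2)).
  by apply: amplitude_le => t; exact: ltW.
by rewrite ltr_pdivrMr // ltr_pMr // ltr1n.
Qed.

Lemma parts_le : \forall a \near F, [/\ 0 <= M a, M a <= 1 &
  forall t, `|E a t| <= M a /\ `|O a t| <= M a].
Proof.
apply: filterS2 (x_small ltr01) (amplitude_small ltr01) => a h M1.
have x1 t : `|x a t - x0 a| <= 1 by exact: ltW.
split; [exact: le_trans (even_amplitude (T a) x1 0)|exact: ltW|move=> t; split].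
  exact: even_amplitude.
exact: odd_amplitude.
Qed.

Lemma basepoint_lipschitz : exists2 C : R, 0 < C &
  \forall a \near F, `|bs - basepoint x0 a| <= C * de a.
Proof.
have [C C0 h] := x0_lip; exists (C + 1); first by rewrite addr_gt0.
apply: filterS h => a h; rewrite distrC (le_trans (basepoint_dist _ _ _)) //.
by rewrite mulrDl mul1r lerD.
Qed.

Local Notation o := (fun a t => toC (O a t)).
Local Notation e := (fun a t => toC (E a t)).

Lemma odd_bO : vbO F (fun a => M a) o.
Proof.
apply: (@vbO_toC _ _ 1); apply: filterS parts_le => a [M0 _ h] t m.
rewrite mul1r (ger0_norm M0); have h1 := mx_norm_entry (O a t) m 0.
by apply: (le_trans h1); have [] := h t.
Qed.

Lemma real_sub_entry (X : vec) (Y : 'cV[R[i]]_n.+1) (y : R) m : Y m 0 = y%:C%C ->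
  cmod ((toC X - Y) m 0) = `|X m 0 - y|.
Proof. by move=> Ym; rewrite !mxE Ym -cmodC rmorphB. Qed.

Lemma half_Bform_entry (u v : vec) m : (2^-1 *: Bform (tensor2 bs) (toC u) (toC v)) m 0 =
  (2^-1 * Dseq [:: (v, 0) : V; (u, 0) : V] (component f m) bs)%:C%C.
Proof. by rewrite mxE Bform_tensor2 rmorphM /= fmorphV /= rmorph_nat. Qed.

(** First of two passes: from |E| <= M alone it follows that Fe = O(M^2),
    whence e = O(M^2) by the linear estimate. [Fe_taylor] repeats the estimate
    with this better bound on the even part. *)
Lemma Fe_taylor_crude : vbO F (fun a => M a ^+ 2) (fun a t => toC (Fe a t) -
  2^-1 *: Bform (tensor2 bs) (toC (O a t)) (toC (O a t))).
Proof.
have [K K0 hK] := rest_taylor; have [C C0 hC] := basepoint_lipschitz.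
apply: (@vbO_of_unif _ _ _ _ _ _ (K * 4)).
have e0 : 0 < C^-1 by rewrite invr_gt0.
apply: filterS3 hK (filterI parts_le hC) (near_s e0) => a hK' [[M0 M1 h] hC'] hs t m.
rewrite (real_sub_entry _ (half_Bform_entry _ _ m)).
have [hE hO] := h t; have [+ _] := hK' t m; move=> /le_trans; apply.
have d1 : `|bs - basepoint x0 a| <= 1.
  by rewrite (le_trans hC') // -ler_pdivlMl // mulr1 ltW.
rewrite -mulrA ler_wpM2l // normrX ger0_norm //.
have n1 : 0 <= `|E a t| by []. have n2 : 0 <= `|O a t| by []. have n3 : 0 <= `|bs - basepoint x0 a| by [].
move: n1 n2 n3 hE hO d1 M0 M1; move: (`|E a t|) (`|O a t|) `|bs - _| (M a) => p1 p2 d m0.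
clear; move=> n1 n2 n3 hE hO d1 M0 M1.
have q1 : p1 ^+ 2 <= m0 ^+ 2 by rewrite lerXn2r.
have q2 : p2 ^+ 2 <= m0 ^+ 2 by rewrite lerXn2r.
have q3 : p2 ^+ 4 <= m0 ^+ 2.
  by rewrite (le_trans (y := m0 ^+ 4)) ?lerXn2r // ler_wiXn2l.
have q4 : (p1 + d) * p2 ^+ 2 <= 2 * m0 ^+ 2.
  rewrite ler_pM ?addr_ge0 ?exprn_ge0 //; lra.
lra.
Qed.

Lemma even_rest_small : vbO F (fun a => M a ^+ 2) (fun a t => toC (Fe a t)).
Proof.
have h : vbO F (fun a => M a * M a) (fun a t => Bform (tensor2 bs) (toC (O a t)) (toC (O a t))).
  exact: vbO_Bform odd_bO odd_bO.
have h2 : vbO F (fun a => M a ^+ 2) (fun a t => 2^-1 *: Bform (tensor2 bs) (toC (O a t)) (toC (O a t))).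
  by move=> m; apply: (bO_eq _ (bO_scale 2^-1 (h m))) => a t; rewrite [RHS]mxE.
apply: (vbO_near _ (vbO_add Fe_taylor_crude h2)).
by apply: nearW => a t; rewrite subrK.
Qed.

Hypothesis even_quadratic : vbO F (fun a => M a ^+ 2) e.

Lemma Fe_taylor : vbO F (fun a => (M a ^+ 2 + de a) * M a ^+ 2) (fun a t => toC (Fe a t) -
  2^-1 *: Bform (tensor2 bs) (toC (O a t)) (toC (O a t))).
Proof.
have [K K0 hK] := rest_taylor; have [C C0 hC] := basepoint_lipschitz.
have [B B0 hB] := vbO_toC_norm even_quadratic.
apply: (@vbO_of_unif _ _ _ _ _ _ (K * (B ^+ 2 + 1 + B + C))).
apply: filterS3 hK (filterI parts_le hC) hB => a hK' [[M0 M1 h] hC'] hB' t m.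
rewrite (real_sub_entry _ (half_Bform_entry _ _ m)).
have [_ hO] := h t; have [+ _] := hK' t m; move=> /le_trans; apply.
have hE := hB' t; rewrite normrX (ger0_norm M0) in hE.
have n1 : 0 <= `|E a t| by []. have n2 : 0 <= `|O a t| by []. have n3 : 0 <= `|bs - basepoint x0 a| by [].
have n4 : 0 <= de a by [].
rewrite -mulrA ler_wpM2l // (ger0_norm (mulr_ge0 (addr_ge0 (exprn_ge0 _ M0) n4) (exprn_ge0 _ M0))).
exact: even_remainder n1 n2 n3 M0 n4 (ltW B0) (ltW C0) hE hO hC'.
Qed.

Lemma Fo_taylor : vbO F (fun a => (M a ^+ 2 + de a) * M a ^+ 3) (fun a t => toC (Fo a t) -
  (Bform (tensor2 bs) (toC (E a t)) (toC (O a t)) +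
   6^-1 *: Cform (tensor3 bs) (toC (O a t)) (toC (O a t)) (toC (O a t)))).
Proof.
have [K K0 hK] := rest_taylor; have [C C0 hC] := basepoint_lipschitz.
have [B B0 hB] := vbO_toC_norm even_quadratic.
apply: (@vbO_of_unif _ _ _ _ _ _ (K * (B ^+ 2 + 1 + B + C + C * B))).
apply: filterS3 hK (filterI parts_le hC) hB => a hK' [[M0 M1 h] hC'] hB' t m.
have eC : (Bform (tensor2 bs) (toC (E a t)) (toC (O a t)) +
   6^-1 *: Cform (tensor3 bs) (toC (O a t)) (toC (O a t)) (toC (O a t))) m 0 =
   (Dseq [:: (O a t, 0) : V; (E a t, 0) : V] (component f m) bs +
     6^-1 * Dseq [:: (O a t, 0) : V; (O a t, 0) : V; (O a t, 0) : V] (component f m) bs)%:C%C.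
  rewrite mxE [X in _ + X]mxE Bform_tensor2 Cform_tensor3 rmorphD rmorphM /= fmorphV /=.
  by rewrite rmorph_nat.
rewrite (real_sub_entry _ eC).
have [_ hO] := h t; have [_ +] := hK' t m; move=> /le_trans; apply.
have hE := hB' t; rewrite normrX (ger0_norm M0) in hE.
have n1 : 0 <= `|E a t| by []. have n2 : 0 <= `|O a t| by []. have n3 : 0 <= `|bs - basepoint x0 a| by [].
have n4 : 0 <= de a by [].
rewrite -mulrA ler_wpM2l // (ger0_norm (mulr_ge0 (addr_ge0 (exprn_ge0 _ M0) n4) (exprn_ge0 _ M0))).
exact: odd_remainder n1 n2 n3 M0 n4 (ltW B0) (ltW C0) hE hO hC'.
Qed.

Lemma odd_rest_small : vbO F (fun a => M a ^+ 3) (fun a t => toC (Fo a t)).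
Proof.
have h1 : vbO F (fun a => M a ^+ 2 * M a) (fun a t => Bform (tensor2 bs) (toC (E a t)) (toC (O a t))).
  exact: vbO_Bform even_quadratic odd_bO.
have h2 : vbO F (fun a => M a * M a * M a)
    (fun a t => Cform (tensor3 bs) (toC (O a t)) (toC (O a t)) (toC (O a t))).
  exact: vbO_Cform odd_bO odd_bO odd_bO.
have h3 : vbO F (fun a => M a ^+ 3) (fun a t => toC (Fo a t) -
  (Bform (tensor2 bs) (toC (E a t)) (toC (O a t)) +
   6^-1 *: Cform (tensor3 bs) (toC (O a t)) (toC (O a t)) (toC (O a t)))).
  move=> m; have := Fo_taylor m; apply: (@bO_weak _ _ _ _ _ _ _ 2).
  apply: filterS2 parts_le (near_s ltr01) => a [M0 M1 _] d1.
  rewrite normrM ler_wpM2r // ger0_norm ?addr_ge0 ?exprn_ge0 //.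
  have : M a ^+ 2 <= 1 by rewrite exprn_ile1.
  by move: d1; move: (de a) (M a ^+ 2) => u v; lra.
have h4 : vbO F (fun a => M a ^+ 3) (fun a t => Bform (tensor2 bs) (toC (E a t)) (toC (O a t)) +
   6^-1 *: Cform (tensor3 bs) (toC (O a t)) (toC (O a t)) (toC (O a t))).
  apply: vbO_add => m.
    by apply: bO_gauge (h1 m); apply: nearW => a; rewrite -exprSr.
  apply: (bO_eq _ (bO_scale 6^-1 _)); last first.
    by apply: bO_gauge (h2 m); apply: nearW => a; rewrite !exprS expr0 mulr1 mulrA.
  by move=> a t; rewrite [RHS]mxE.
apply: (vbO_near _ (vbO_add h3 h4)).
by apply: nearW => a t; rewrite subrK.
Qed.

End TaylorFamilies.

(** * The mean state near a Hopf bifurcation *)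

Section CrossingSpeed.
Variables (R : realType) (mu : R -> R) (s : R).
Hypothesis d_mu : derivable mu s 1.
Hypothesis d_neq0 : 'D_1 mu s != 0.
Hypothesis mu_s : mu s = 0.

(** A nonzero derivative makes |a - s| and |mu a| interchangeable as orders of
    magnitude. *)
Lemma crossing_speed : exists2 C : R, 0 < C & \forall a \near s,
  `|a - s| <= C * `|mu a| /\ `|mu a| <= C * `|a - s|.
Proof.
set d := 'D_1 mu s.
have d0 : 0 < `|d| by rewrite normr_gt0; exact: d_neq0.
have q : (fun h : R => h^-1 *: ((mu \o shift s) (h *: (1 : R)) - mu s)) @ 0^' --> d by exact: d_mu.
have e0 : 0 < `|d| / 2 by rewrite divr_gt0.
have /cvgrPdist_le /(_ _ e0) := q.
case=> r /= r0 hr; exists (2 / `|d| + 2 * `|d|); first by rewrite addr_gt0 ?divr_gt0 ?mulr_gt0.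
apply/nbhs_ballP; exists r => //= a; rewrite -ball_normE /= => ar.
have [->|as0] := eqVneq a s; first by rewrite mu_s subrr normr0 mulr0.
have h0 : a - s != 0 by rewrite subr_eq0.
have ar' : `|a - s| < r by rewrite distrC.
have := hr (a - s); rewrite /ball_ /= sub0r normrN => /(_ ar' h0).
rewrite mu_s subr0 /shift /= (_ : (a - s)%:A + s = a); last first.
  by rewrite [_ *: 1]mulr1 subrK.
have sc (x y : R) : x *: y = x * y by [].
rewrite sc => hq.
have p0 : 0 < `|a - s| by rewrite normr_gt0.
have e1 : `|mu a| = `|(a - s)^-1 * mu a| * `|a - s|.
  by rewrite -normrM mulrAC mulVf // mul1r.
have l1 : `|d| / 2 <= `|(a - s)^-1 * mu a|.
  have := ler_normD (d - (a - s)^-1 * mu a) ((a - s)^-1 * mu a); rewrite subrK.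
  move: hq; set u := `|d - _|; set v := `|_ * _|; move: (`|d|) => k; lra.
have l2 : `|(a - s)^-1 * mu a| <= 2 * `|d|.
  have := ler_normB d (d - (a - s)^-1 * mu a); rewrite opprB addrC subrK.
  move: hq; set u := `|d - _|; set v := `|_ * _|; move: (`|d|) d0 => k; lra.
rewrite e1; move: (`|(a - s)^-1 * mu a|) (`|a - s|) p0 l1 l2 => v h hp l1 l2.
have i0 : 0 < 2 / `|d| by rewrite divr_gt0.
split.
  rewrite mulrA ler_peMl ?(ltW hp) // mulrDl.
  have : 1 <= 2 / `|d| * v by rewrite mulrAC ler_pdivlMr // mul1r; lra.
  have : 0 <= 2 * `|d| * v by rewrite !mulr_ge0 // (le_trans _ l1) // divr_ge0.
  lra.
rewrite ler_wpM2r ?(ltW hp) //; lra.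
Qed.

End CrossingSpeed.

Section AveragedHopf.
Variables (R : realType) (n : nat) (f : 'cV[R]_n.+1 -> R -> 'cV[R]_n.+1).
Hypothesis hf : smooth (fun z : 'cV[R]_n.+1 * R => f z.1 z.2).
Variables (s : R) (J : set R) (x0 : R -> 'cV[R]_n.+1).
Hypothesis hx0 : equilibrium_branch f x0 s J.
Variables (mu omega : R -> R) (q p : R -> 'cV[R[i]]_n.+1).
Hypothesis hqp : eigenvectors f x0 s mu omega q p.
Hypothesis hH : codim1_hopf f x0 s mu omega q p.
Variables (I : set R) (x : R -> R -> 'cV[R]_n.+1) (T : R -> R).
Hypothesis hx : emerging_cycle f x0 s omega I x T.

(** The filter of parameters for which there is a cycle of positive
    amplitude. *)
Let F := within (I `\ s) (nbhs s).
Let w := omega s.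
Let lam a : R[i] := (mu a +i* omega a)%C.
Let A a := toC (jac (f^~ a) (x0 a)).
Let b a := tensor2 f (x0 a, a).
Let c a := tensor3 f (x0 a, a).
(** The real vector underlying [Kvec], whose entries are real by [slopeE]. *)
Definition slope a : 'cV[R]_n.+1 :=
  map_mx (fun z => Re z) (Kvec (f^~ a) (x0 a) (lam a) (q a) (p a)).

#[local] Instance FF : Filter F. Proof. exact: within_filter. Qed.

Lemma nbhs_F (P : R -> Prop) : (\forall a \near s, P a) -> \forall a \near F, P a.
Proof. by move=> h; rewrite near_withinE; apply: filterS h. Qed.

Lemma near_s e : 0 < e -> \forall a \near F, `|a - s| < e.
Proof.
move=> e0; apply: nbhs_F; apply/nbhs_ballP; exists e => //= a.
by rewrite -ball_normE /= distrC.
Qed.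

Lemma near_I : \forall a \near F, I a /\ a != s.
Proof. by rewrite near_withinE; apply: nearW => a [Ia /eqP]. Qed.

Lemma bE a : (fun m j k : 'I_n.+1 =>
  (partial j (partial k (fun y => nonlin (f^~ a) (x0 a) y m 0)) 0)%:C%C) = b a.
Proof.
by apply/funext => m; apply/funext => j; apply/funext => k; rewrite (Btensor_component hf).
Qed.

Lemma cE a : (fun m j k l : 'I_n.+1 =>
  (partial l (partial j (partial k (fun y => nonlin (f^~ a) (x0 a) y m 0))) 0)%:C%C) = c a.
Proof.
apply/funext => m; apply/funext => j; apply/funext => k; apply/funext => l.
by rewrite (Ctensor_component hf).
Qed.

Lemma KvecE a : Kvec (f^~ a) (x0 a) (lam a) (q a) (p a) =
  mean_slope (A a) (b a) (c a) (lam a) (q a) (p a).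
Proof.
apply: etrans (Kvec_mean_slope _ _ _ _ _) _.
exact: (congr2 (fun b c => mean_slope (A a) b c (lam a) (q a) (p a)) (bE a) (cE a)).
Qed.

Lemma c1E a : c1 (f^~ a) (x0 a) (lam a) (q a) (p a) =
  normal_form (A a) (b a) (c a) (lam a) (q a) (p a).
Proof.
apply: etrans (c1_normal_form _ _ _ _ _) _.
exact: (congr2 (fun b c => normal_form (A a) b c (lam a) (q a) (p a)) (bE a) (cE a)).
Qed.

Lemma A_real a : map_mx (fun z : R[i] => z^*) (A a) = A a.
Proof. exact: toC_conj. Qed.

Lemma b_real z m j k : (tensor2 f z m j k)^* = tensor2 f z m j k.
Proof. exact: conjCR. Qed.

Lemma slopeE a : toC (slope a) = mean_slope (A a) (b a) (c a) (lam a) (q a) (p a).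
Proof.
rewrite /slope KvecE; apply: mean_slope_real; first exact: A_real.
  by move=> *; exact: tensor2_sym.
by move=> *; exact: b_real.
Qed.

Lemma branch_data : [/\ f (x0 s) s = 0, \forall a \near F, f (x0 a) a = 0 &
  forall e : R, 0 < e -> \forall a \near F, `|x0 a - x0 s| < e].
Proof.
have [oJ _ Js h] := hx0; split; first by have [] := h s Js.
  apply: nbhs_F; have : nbhs s J by exact: open_nbhs_nbhs.
  by apply: filterS => a /h[].
move=> e e0; apply: nbhs_F; have [_ /cvgrPdist_lt /(_ _ e0)] := h s Js.
by apply: filterS => a; rewrite distrC.
Qed.

Lemma critical_data : [/\ 0 < w, mup (lam s) (char_poly (A s)) = 1%N,
  mup (lam s)^* (char_poly (A s)) = 1%N &
  forall z : R[i], eigenvalue (A s) z -> z != lam s -> z != (lam s)^* -> Re z < 0].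
Proof. by have [/nbhs_singleton] := hH. Qed.

Lemma lam_s : lam s = 'i%C * w%:C%C.
Proof.
have [_ mu0 _ _] := hH.
by rewrite /lam mu0 /w; apply: complexP; rewrite ?cReM ?cImM /=; ring.
Qed.

Lemma mu_near : exists2 C : R, 0 < C & \forall a \near F,
  `|a - s| <= C * `|mu a| /\ `|mu a| <= C * `|a - s|.
Proof.
have [_ mu0 [d d0] _] := hH; have [C C0 h] := crossing_speed d d0 mu0.
by exists C => //; exact: nbhs_F.
Qed.

Lemma Re_lam e : 0 < e -> \forall a \near F, `|Re (lam a)| < e.
Proof.
move=> e0; have [C C0 h] := mu_near.
apply: filterS2 h (near_s (divr_gt0 e0 C0)) => a [_ h1] h2 /=.
by apply: (le_lt_trans h1); rewrite mulrC -ltr_pdivlMr.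
Qed.

Lemma Im_lam : \forall a \near F, 0 < Im (lam a).
Proof. by apply: nbhs_F; have [h _ _ _] := hH; apply: filterS h => a []. Qed.

Lemma eigen_s : eigendata A lam q p s.
Proof. exact: (nbhs_singleton hqp). Qed.

Lemma near_eigen : \forall a \near F, eigendata A lam q p a.
Proof. exact: (nbhs_F hqp). Qed.

Lemma cycle_small e : 0 < e -> \forall a \near F, forall t, `|x a t - x0 a| < e.
Proof.
move=> e0; have := nbhs_F (cycle_amplitude hx e0).
by apply: filterS2 near_I => a [Ia _]; apply.
Qed.

Lemma cycle_orbits : \forall a \near F, periodic_orbit (f^~ a) (x a) (T a).
Proof. by apply: filterS near_I => a [Ia ane]; exact: (Defs.cycle_orbit hx). Qed.

Lemma frequency e : 0 < e -> \forall a \near F, `|2 * pi / T a - w| < e.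
Proof.
move=> e0; have [w0 _ _ _] := critical_data.
have T0 : 2 * pi / w != 0 by rewrite mulf_neq0 ?invr_neq0 ?mulf_neq0 ?gt_eqF ?pi_gt0.
have h : (fun a => 2 * pi / T a) @ F --> 2 * pi / (2 * pi / w).
  by apply: cvgM; [exact: cvg_cst|apply: cvgV => //; exact: (cycle_period hx)].
have e1 : 2 * pi / (2 * pi / w) = w.
  by rewrite invf_div mulrCA divff ?mulr1 // mulf_neq0 ?gt_eqF ?pi_gt0.
rewrite e1 in h; have /cvgrPdist_lt /(_ _ e0) := h.
by apply: filterS => a; rewrite distrC.
Qed.

Let M a := amplitude (x0 a) (x a).
Let o a t := toC (odd_part (T a) (fun t0 => x a t0 - x0 a) t).
Let e a t := toC (even_part (T a) (fun t0 => x a t0 - x0 a) t).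
Let Fo a t := toC (odd_rest (f^~ a) (x0 a) (x a) (T a) t).
Let Fe a t := toC (even_rest (f^~ a) (x0 a) (x a) (T a) t).
Let D a := toC (jac (f^~ a) (x0 a) - jac (f^~ s) (x0 s)).
Let qs := q s.
Let ps := p s.

Lemma w_gt0 : 0 < w. Proof. by have [] := critical_data. Qed.

Lemma spectrum k : root (char_poly (A s)) k -> stable_or_critical w k.
Proof.
have [_ _ _ h] := critical_data.
by move/(root_dichotomy lam_s h) => [->|->|]; rewrite /stable_or_critical ?lam_s; tauto.
Qed.

Lemma regular_point z : 0 <= Re z -> z != lam s -> z != - lam s -> z%:M - A s \in unitmx.
Proof.
move=> z0 z1 z2; apply: resolvent_unit; have [_ _ _ h] := critical_data.
apply/negP => /(root_dichotomy lam_s h)[/eqP|/eqP|]; rewrite ?(negbTE z1) ?(negbTE z2) //.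
by rewrite ltNge z0.
Qed.

Lemma Im_critical : Im (lam s) = w. Proof. by []. Qed.
Lemma Re_critical : Re (lam s) = 0. Proof. by have [_ mu0 _ _] := hH; rewrite /= mu0. Qed.

Lemma unit0 : (0 : R[i])%:M - A s \in unitmx.
Proof.
apply: regular_point => //=; apply/eqP => /(congr1 (fun z => Im z)); rewrite ?cImN Im_critical /=.
  by move=> h; have := w_gt0; rewrite -h ltxx.
by move/esym/eqP; rewrite oppr_eq0 => /eqP h; have := w_gt0; rewrite h ltxx.
Qed.

Lemma A_unit : A s \in unitmx.
Proof.
have := unit0; rewrite raddf0 sub0r -scaleN1r unitmxZ //.
by rewrite unitrN1.
Qed.

Lemma A2_unit : (2 * lam s)%:M - A s \in unitmx.
Proof.
have i2 : Im (2 * lam s) = 2 * w by rewrite cImM Im_critical Re_critical /=; ring.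
apply: regular_point.
- by rewrite (_ : Re _ = 0) // cReM Im_critical Re_critical /=; ring.
- apply/eqP => /(congr1 (fun z => Im z)); rewrite i2 Im_critical => h.
  by have := w_gt0; rewrite /w in h *; lra.
- apply/eqP => /(congr1 (fun z => Im z)); rewrite i2 cImN Im_critical => h.
  by have := w_gt0; rewrite /w in h *; lra.
Qed.

Lemma lip_A : lipm F s A.
Proof.
have [h1 h2 h3] := branch_data.
exact: (lipm_jac near_s hf h2 h1 h3 A_unit).
Qed.

Lemma lip_Dseq vs m : lip F s (fun a => (Dseq vs (component f m) (x0 a, a))%:C%C).
Proof.
have [h1 h2 h3] := branch_data.
exact: (lip_field near_s hf h2 h1 h3 A_unit (smooth_Dseq vs (smooth_component hf m))).
Qed.

Lemma x0_lip : exists2 C : R, 0 < C & \forall a \near F, `|x0 a - x0 s| <= C * `|a - s|.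
Proof.
have [h1 h2 h3] := branch_data.
exact: (x0_lipschitz near_s hf h2 h1 h3 A_unit).
Qed.

Lemma f_cont a i : continuous (fun z => f z a i 0).
Proof.
move=> z; apply: (@continuous_comp _ _ _ (fun z => (z, a)) (component f i)).
  apply: (@cvg_pair _ _ _ (nbhs z) (nbhs z) (nbhs a) (nbhs_filter (z : 'cV[R]_n.+1))
    (nbhs_filter (z : 'cV[R]_n.+1)) (nbhs_filter a) idfun (cst a)) => [P //|].
  exact: (@cvg_cst _ a _ _ (nbhs_filter (z : 'cV[R]_n.+1))).
exact: (smooth_continuous (smooth_component hf i)).
Qed.

Lemma near_oscillation : \forall a \near F,
  oscillation (A s) (D a) (T a) (2 * pi / T a) (M a) (o a) (e a) (Fo a) (Fe a).
Proof.
apply: filterS2 cycle_orbits (cycle_small ltr01) => a orb small.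
have small' t : `|x a t - x0 a| <= 1 by exact: ltW.
exact (@orbit_oscillation R n (f^~ a) (jac (f^~ s) (x0 s)) _ _ _ (fun i => @f_cont a i) orb small').
Qed.

Lemma D_bO i j : bO F (fun a => `|a - s|) (fun a (_ : R) => D a i j).
Proof.
have h : bO F (fun a => `|a - s|) (fun a (_ : R) => A a i j - A s i j).
  by apply: bO_gauge (lip_A i j); apply: nearW => a; rewrite normr_id.
by apply: bO_eq h => a t; rewrite !mxE rmorphB.
Qed.

Lemma de_ge0 : \forall a \near F, 0 <= `|a - s|. Proof. exact: nearW. Qed.

(** Uses only the crude Taylor bound of the even nonlinear terms, as the sharp
    one presupposes this estimate. *)
Lemma even_quadratic : vbO F (fun a => M a ^+ 2) e.
Proof.
have [h1 h2 h3] := branch_data.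
apply: (even_small w_gt0 spectrum near_oscillation de_ge0 near_s frequency D_bO).
exact: (even_rest_small near_s T hf h2 h3 x0_lip cycle_small).
Qed.

Let h0 := invmx (A s) *m - Bform (b s) qs (conjv qs).
Let h2 := invmx ((2 * lam s)%:M - A s) *m Bform (b s) qs qs.

Lemma h0E : A s *m h0 = - Bform (b s) qs (conjv qs).
Proof. exact: (mulKVmx A_unit). Qed.

Lemma h2E : ((2 * lam s)%:M - A s) *m h2 = Bform (b s) qs qs.
Proof. exact: (mulKVmx A2_unit). Qed.

Let G := Bform (b s) h0 qs + 2^-1 *: Bform (b s) h2 (conjv qs) + 2^-1 *: Cform (c s) qs qs (conjv qs).
Let nf := normal_form (A s) (b s) (c s) (lam s) qs ps.

Lemma lamJ : (lam s)^* = - lam s.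
Proof. by apply: complexP; rewrite ?(cReJ, cReN, cImJ, cImN) // Re_critical oppr0. Qed.

Lemma lam_neq0 : lam s != 0.
Proof. by apply/eqP => /(congr1 (fun z => Im z)); rewrite Im_critical /= => h; have := w_gt0; rewrite h ltxx. Qed.

Lemma normal_formE : nf = inner ps G.
Proof.
have [Aq _ _] := eigen_s.
apply: (normal_form_critical (c s) ps lamJ lam_neq0 _ _ (A_real s) Aq A_unit A2_unit h0E h2E) => *.
  exact: tensor2_sym.
exact: b_real.
Qed.

Lemma nf_neq0 : Re nf != 0.
Proof. by have [_ _ _] := hH; rewrite c1E. Qed.

Lemma mean_slope_s : toC (slope s) = - ((Re nf)^-1)%:C%C *: h0.
Proof.
have [Aq _ _] := eigen_s.
rewrite slopeE; apply: (mean_slope_critical lamJ lam_neq0 _ _ (A_real s) Aq A_unit h0E nf_neq0) => *.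
  exact: tensor2_sym.
exact: b_real.
Qed.

(** The given eigenvectors may depend on the parameter in an irregular way. By
    [mean_slope_scale] they can be replaced by multiples that are Lipschitz at
    s, for which the slope is Lipschitz. *)
Lemma slope_lipschitz : vbO F (fun a => `|a - s|) (fun a _ => toC (slope a) - toC (slope s)).
Proof.
have [w0 m1 _ st] := critical_data.
pose qt := right_vector s A lam q p; pose pt := left_vector s A lam q p.
have [qE pE] := vectors_at_s A_real eigen_s m1.
pose proof (lipm_right_vector near_s w0 lip_A near_eigen eigen_s lam_s m1 st Im_lam Re_lam) as hq.
pose proof (lipm_left_vector near_s w0 lip_A A_real near_eigen eigen_s lam_s m1 st Im_lam Re_lam) as hp.
pose proof (lip_lam near_s w0 lip_A near_eigen lam_s m1 st Im_lam Re_lam) as hl.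
have hS : lipm F s (fun a => mean_slope (A a) (b a) (c a) (lam a) (qt a) (pt a)).
  apply: (lipm_mean_slope near_s lip_A _ _ hl hq hp lam_neq0 _ _ A2_unit).
  - by move=> m j k; exact: lip_Dseq.
  - by move=> m j k l; exact: lip_Dseq.
  - have -> : 2 * lam s - (lam s)^* = 3 * lam s by rewrite lamJ; ring.
    by rewrite mulf_neq0 ?lam_neq0 // pnatr_eq0.
  - by rewrite Re_critical mulr0 unit0.
  - by rewrite /qt /pt qE pE; exact: nf_neq0.
have hu : \forall a \near F, bordered s A lam q p a \in unitmx.
  apply: (lipm_unit near_s); last exact: bordered_unit eigen_s m1.
  exact: (lipm_bordered near_s w0 lip_A near_eigen lam_s m1 st Im_lam Re_lam).
have eS : \forall a \near F, toC (slope a) = mean_slope (A a) (b a) (c a) (lam a) (qt a) (pt a).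
  apply: filterS2 hu near_eigen => a u ea; rewrite slopeE.
  have c0 := overlap_neq0 ea u.
  rewrite {1}(right_vector_eigen ea u) (left_vector_eigen A_real ea u).
  exact: mean_slope_scale.
have eSs : toC (slope s) = mean_slope (A s) (b s) (c s) (lam s) (qt s) (pt s).
  by rewrite slopeE /qt /pt qE pE.
move=> i; have := hS i 0; rewrite /lip => h.
apply: (@bO_near _ _ _ _ _ (fun a _ => mean_slope (A a) (b a) (c a) (lam a) (qt a) (pt a) i 0 -
   mean_slope (A s) (b s) (c s) (lam s) (qt s) (pt s) i 0)).
  have entryB (X Y : 'cV[R[i]]_n.+1) : X i 0 - Y i 0 = (X - Y) i 0 by rewrite !mxE.
  by apply: filterS eS => a ea t; rewrite -ea -eSs; exact: entryB.
by apply: bO_gauge h; apply: nearW => a; rewrite normr_id.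
Qed.

Lemma distance_le_mu : exists2 C : R, 0 < C & \forall a \near F, `|a - s| <= C * `|mu a|.
Proof. by have [C C0 h] := mu_near; exists C => //; apply: filterS h => a []. Qed.

Lemma eigenvalue_derivative : bO F (fun a => `|a - s| ^+ 2)
  (fun a (_ : R) => inner ps (D a *m qs) - (lam a - lam s)).
Proof.
have [w0 m1 _ st] := critical_data.
pose proof (eigenvalue_shift near_s w0 lip_A A_real near_eigen eigen_s lam_s m1 st Im_lam Re_lam) as h.
by apply: bO_eq h => a t; rewrite /D toCB.
Qed.

Lemma even_mean_leading : vbO F (fun a => mu a ^+ 2) (fun a (_ : R) =>
  vmode (T a) (fun=> 1) (e a) + (mu a / Re nf)%:C%C *: h0).
Proof.
have [b1 b2 b3] := branch_data; have [w0 m1 _ st] := critical_data.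
have [Aq pA pq] := eigen_s; have ls := lam_s.
pose proof (fun r => amplitude_small cycle_small (r:=r)) as Msm.
pose proof (odd_bO T cycle_small) as ob.
pose proof (odd_rest_small near_s hf b2 b3 x0_lip cycle_small even_quadratic) as fo3.
pose proof (Fe_taylor near_s hf b2 b3 x0_lip cycle_small even_quadratic) as fet.
pose proof (Fo_taylor near_s hf b2 b3 x0_lip cycle_small even_quadratic) as fot.
have pA' u : inner ps (A s *m u) = 'i%C * w%:C%C * inner ps u.
  by rewrite -ls; exact: inner_left_eigen (A_real s) pA.
have Nu : ('i%C * w%:C%C)%:M - A s + qs *m (map_mx (fun z : R[i] => z^*) ps)^T \in unitmx.
  by rewrite -ls; exact: bordered_unit eigen_s m1.
have Aq' : A s *m qs = 'i%C * w%:C%C *: qs by rewrite -ls.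
have A2u : (2 * ('i%C * w%:C%C))%:M - A s \in unitmx by rewrite -ls; exact: A2_unit.
have h2' : ((2 * ('i%C * w%:C%C))%:M - A s) *m h2 = Bform (b s) qs qs by rewrite -ls; exact: h2E.
have reD : \forall a \near F, Re (lam a - lam s) = mu a.
  by apply: nearW => a; rewrite cReD cReN Re_critical subr0.
have nd : Re (inner ps G) != 0 by rewrite -normal_formE; exact: nf_neq0.
pose proof (mean_leading w0 spectrum near_oscillation de_ge0 Msm near_s frequency D_bO ob fo3
  Aq' pA' pq Nu even_quadratic (@tensor2_sym _ _ _ hf _) (@tensor3_sym12 _ _ _ hf _)
  (@tensor3_sym23 _ _ _ hf _) fet fot A_unit A2u h0E h2' reD eigenvalue_derivative nd distance_le_mu) as h.
by rewrite normal_formE; exact: h.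
Qed.

(** The slope at s is the leading coefficient of the mean by [mean_slope_s];
    evaluating it at a instead changes the product with mu by O(|mu| |a - s|),
    which is O(mu^2). *)
Lemma mean_expansion : vbO F (fun a => mu a ^+ 2) (fun a (_ : R) =>
  toC (time_average (x a) (T a) - x0 a - mu a *: slope a)).
Proof.
have [C C0 hC] := distance_le_mu.
have h : vbO F (fun a => mu a * `|a - s|) (fun a (_ : R) => (mu a)%:C%C *: (toC (slope a) - toC (slope s))).
  apply: vbO_scale slope_lipschitz.
  by exists 1; apply: nearW => a _; rewrite cmodC mul1r.
have h' : vbO F (fun a => mu a ^+ 2) (fun a (_ : R) => (mu a)%:C%C *: (toC (slope a) - toC (slope s))).
  move=> i; apply: (bO_weak (K := C) _ (h i)).
  apply: filterS hC => a ha; rewrite expr2 !normrM normr_id.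
  by rewrite mulrCA ler_wpM2l.
apply: (vbO_near _ (vbO_add even_mean_leading (vbO_opp h'))).
have key (U S S0 Z : 'cV[R[i]]_n.+1) (m r : R[i]) : S0 = - r *: Z ->
    U + (m * r) *: Z - m *: (S - S0) = U - m *: S.
  by move=> ->; apply/matrixP => i j; rewrite !mxE; ring.
apply: filterS cycle_orbits => a orb t.
have -> : toC (time_average (x a) (T a) - x0 a - mu a *: slope a) =
    toC (time_average (x a) (T a) - x0 a) - (mu a)%:C%C *: toC (slope a).
  by apply: etrans (toCB _ _) _; congr (_ - _); exact: (map_mxZ (real_complex R)).
have -> : (mu a / Re nf)%:C%C = (mu a)%:C%C * ((Re nf)^-1)%:C%C by exact: rmorphM.
rewrite (time_average_even (x0 a) orb); exact: key mean_slope_s.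
Qed.

Theorem averaged_hopf : exists C : R, \forall a \near s, I a ->
  `|mean_state x0 I x T a - x0 a - mu a *: slope a| <= C * mu a ^+ 2.
Proof.
have [C C0 hC] := vbO_toC_norm mean_expansion.
exists C; move: hC; rewrite near_withinE; apply: filterS => a hC Ia.
rewrite /mean_state (mem_set Ia).
(* At s both the deviation of the mean and mu vanish. *)
have [as0|as0] := eqVneq a s; last first.
  have /hC/(_ 0) : (I `\ s) a by split => //; apply/eqP.
  by rewrite normrX real_normK ?num_real.
have [_ mu0 _ _] := hH; have [T0 xs] := cycle_at_astar hx.
rewrite as0 mu0 scale0r subr0 expr0n mulr0.
suff -> : time_average (x s) (T s) = x0 s by rewrite subrr normr0.
apply/matrixP => i j; rewrite ord1 mxE.
have -> : (fun t => x s t i 0) = fun=> x0 s i 0 by apply/funext => t; rewrite xs.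
exact: mean_cst.
Qed.

End AveragedHopf.

Theorem mainTheorem2 (R : realType) (n : nat) (hn : (2 < n)%N)
    (f : 'cV[R]_n -> R -> 'cV[R]_n)
    (hf : smooth (fun z : 'cV[R]_n * R => f z.1 z.2))
    (astar : R) (J : set R) (x0 : R -> 'cV[R]_n)
    (hx0 : equilibrium_branch f x0 astar J)
    (mu omega : R -> R) (q p : R -> 'cV[R[i]]_n)
    (hqp : eigenvectors f x0 astar mu omega q p)
    (hH : codim1_hopf f x0 astar mu omega q p)
    (I : set R) (hIJ : I `<=` J) (x : R -> R -> 'cV[R]_n) (T : R -> R)
    (hx : emerging_cycle f x0 astar omega I x T) :
  exists K : R -> 'cV[R]_n,
    [/\ \forall a \near astar,
          toC (K a) =
          Kvec (f^~ a) (x0 a) (mu a +i* omega a)%C (q a) (p a),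
        exists C : R, \forall a \near astar, I a ->
          `|mean_state x0 I x T a - x0 a - mu a *: K a| <= C * mu a ^+ 2
      & forall a, ~ I a -> mean_state x0 I x T a - x0 a = 0].
Proof.
case: n hn f hf x0 hx0 q p hqp hH x hx => [//|n] _ f hf x0 hx0 q p hqp hH x hx.
exists (slope f x0 mu omega q p); split.
- apply/nbhs_ballP; exists 1 => //= a _; rewrite (KvecE hf); exact: slopeE.
- exact (averaged_hopf hf hx0 hqp hH hx).
- by move=> a nI; rewrite /mean_state memNset // subrr.
Qed.
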